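(* Let $\mathcal C$ be the class of unlabeled connected outerplanar graphs and $\hat{\mathcal C}$ the class of unlabeled vertex-rooted connected outerplanar graphs. Then $$Z(\mathcal C)=Z(\hat{\mathcal C})+Z\big(\mathcal D;Z(\hat{\mathcal C})\big)-Z\big(\mathcal V;Z(\hat{\mathcal C})\big),$$ where for a cycle index sum $Z(\mathcal K)$ the expression $Z(\mathcal K;Z(\hat{\mathcal C}))$ denotes the series obtained from $Z(\mathcal K)$ by replacing each $s_i$ by $Z(\hat{\mathcal C};s_i,s_{2i},s_{3i},\dots)$.
   Context: Cycle index: for a permutation group $A$ on $\{1,\dots,n\}$, $Z(A)=\frac1{|A|}\sum_{\alpha\in A}\prod_k s_k^{j_k(\alpha)}$, $j_k(\alpha)$ the number of $k$-cycles of $\alpha$. For a graph, $Z(G)$ is the cycle index of its automorphism group acting on vertices; for a rooted graph the automorphisms are required to fix the root. For a class $\mathcal K$ of unlabeled (possibly rooted) graphs, $Z(\mathcal K)=\sum_{K\in\mathcal K}Z(K)$, one representative per isomorphism class; $Z(\mathcal K;t_1,t_2,\dots)$ denotes $Z(\mathcal K)$ with $s_i$ replaced by $t_i$. An outerplanar graph embeds in the plane with all vertices on the outer face. A dissection is a two-connected outerplanar graph with at least three vertices; $\mathcal D$ is the class of unlabeled dissections together with the single edge $K_2$, and $\mathcal V$ is the class of unlabeled vertex-rooted dissections together with the vertex-rooted single edge. Explicitly $Z(\mathcal V;s_1,s_2)=\frac{s_1}{8}\big(1+s_1-\sqrt{s_1^2-6s_1+1}\big)+\frac{s_1}{8s_2^2}(s_1+s_2)\big(1-3s_2-\sqrt{s_2^2-6s_2+1}\big)$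 and $Z(\mathcal V)=s_1\frac{\partial}{\partial s_1}Z(\mathcal D)$. *)

(* Defs.v *)
From HB Require Import structures.
From mathcomp Require Import all_boot all_order all_algebra all_fingroup.
From mathcomp Require Import finmap.
From mathcomp.multinomials Require Import monalg.

Set Implicit Arguments.
Unset Strict Implicit.
Unset Printing Implicit Defensive.

Import GRing.Theory.

Local Open Scope ring_scope.

(** * Formal power series in s_1, s_2, ... *)

(* A monomial is an element of {cmonom nat}; since nat starts at 0, the
   generator indexed by i stands for s_(i+1). *)
Definition monomial := {cmonom nat}.

Definition cpoly := {malg rat[monomial]}.

Definition series := monomial -> rat.

(* s_k, for k >= 1 *)
Definition var (k : nat) : cpoly := << ucm k.-1 >>.

Definition series_of_poly (p : cpoly) : series := fun m => p@_m.

(* s_k has weight k. *)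
Definition weight (m : monomial) : nat :=
  (\sum_(i <- finsupp m) i.+1 * m i)%N.

Definition monomial_of_exponents (N : nat) (f : {ffun 'I_N -> 'I_N.+1}) :
    monomial :=
  \big[mmul/mone]_(i < N) expcmn (ucm (val i)) (f i).

(* The monomials of weight at most N, without repetition: they only involve
   s_1, ..., s_N, with exponents at most N. *)
Definition monomials_upto (N : nat) : seq monomial :=
  [seq m <- [seq monomial_of_exponents f | f : {ffun 'I_N -> 'I_N.+1}]
     | (weight m <= N)%N].

Definition truncate (N : nat) (F : series) : cpoly :=
  \sum_(m <- monomials_upto N) << F m *g m >>.

(* F(t_1, t_2, ...), the series obtained from F by replacing each s_k by the
   series t k (t 0 is not used).  It is meant for families in which t k only
   contains monomials of weight at least k: the coefficient of m then only
   depends on the parts of F and of the t k of weight at most weight m, and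
   is computed by substituting polynomials. *)
Definition subst (F : series) (t : nat -> series) : series := fun m =>
  let N := weight m in
  (\sum_(u <- monomials_upto N)
      F u *: \prod_(i < N) truncate N (t i.+1) ^+ u (val i))@_m.

(* F(s_i, s_(2i), s_(3i), ...), for i >= 1 *)
Definition dilate (i : nat) (F : series) : series :=
  subst F (fun j => series_of_poly (var (i * j))).

(** * Cycle indices *)

Definition num_cycles (T : finType) (k : nat) (a : {perm T}) : nat :=
  #|[set c in porbits a | #|c| == k]|.

Definition cycle_index (T : finType) (A : {set {perm T}}) : cpoly :=
  (#|A|%:R : rat)^-1 *:
    \sum_(a in A) \prod_(1 <= k < #|T|.+1) var k ^+ num_cycles k a.

(* In this section X n is the set of structures (graphs or rooted graphs) with
   vertex set 'I_n, [iso s G H] says that s is an isomorphism from G to H, and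
   K is a class of structures. *)
Section CycleIndexSum.

Variables (X : nat -> finType) (iso : forall n, {perm 'I_n} -> rel (X n)).
Arguments iso {n}.

Definition automorphisms (n : nat) (G : X n) : {set {perm 'I_n}} :=
  [set s | iso s G G].

Definition isomorphic (n : nat) : rel (X n) :=
  fun G H => [exists s : {perm 'I_n}, iso s G H].

Definition representatives (n : nat) (K : {set X n}) : {set X n} :=
  transversal (equivalence_partition (@isomorphic n) K) K.

(* A structure with n vertices only contributes monomials of weight n, so the
   coefficient of m in the sum over the whole class comes from the structures
   with weight m vertices. *)
Definition cycle_index_sum (K : forall n, {set X n}) : series := fun m =>
  \sum_(G in representatives (K (weight m))) (cycle_index (automorphisms G))@_m.

End CycleIndexSum.

(** * Graphs *)

Section Graphs.

Variable T : finType.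

Definition simple (E : {set T * T}) : bool :=
  [forall x, (x, x) \notin E] &&
  [forall x, forall y, ((x, y) \in E) == ((y, x) \in E)].

(* [arcs] contains both (x, y) and (y, x) for every edge xy. *)
Record graph : predArgType := Graph { arcs :> {set T * T}; _ : simple arcs }.

HB.instance Definition _ := [isSub for arcs].
HB.instance Definition _ := [Finite of graph by <:].

Definition rooted_graph : finType := (graph * T)%type.

Implicit Type G : graph.

Definition adj G : rel T := fun x y => (x, y) \in arcs G.

Definition graph_iso (s : {perm T}) : rel graph := fun G H =>
  [forall x, forall y, adj H (s x) (s y) == adj G x y].

Definition rooted_iso (s : {perm T}) : rel rooted_graph :=
  fun G H : graph * T =>
  graph_iso s G.1 H.1 && (s G.2 == H.2).

Definition connected G : bool :=
  (0 < #|T|)%N && [forall x, forall y, connect (adj G) x y].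

Definition two_connected G : bool :=
  [&& (2 < #|T|)%N, connected G &
      [forall v, forall x, forall y, (x != v) ==> (y != v) ==>
         connect [rel a b | [&& adj G a b, a != v & b != v]] x y]].

(* Embeddings are described combinatorially.  An embedding of G in an oriented
   surface is given by a rotation system: a permutation r of the arcs that maps
   each arc to the next arc leaving the same vertex, in counterclockwise order.
   The values of r on pairs that are not arcs are irrelevant. *)
Definition rotation_system G (r : {perm T * T}) : bool :=
  [forall d in arcs G, porbit r d == [set d' in arcs G | d'.1 == d.1]].

(* Walking along the boundary of a face: after the arc from x to y comes the
   arc that follows (y, x) around y. *)
Definition face_step (r : {perm T * T}) (d : T * T) : T * T := r (d.2, d.1).

Definition faces G (r : {perm T * T}) : {set {set T * T}} :=
  [set [set d' | fconnect (face_step r) d d'] | d in arcs G].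

Definition non_isolated G : {set T} := [set x | [exists y, adj G x y]].

(* Every component with at least one edge is embedded in a sphere, by Euler's
   formula V - E + F = 2 (in general V - E + F <= 2 in each component). *)
Definition planar_rotation G (r : {perm T * T}) : bool :=
  rotation_system G r &&
  (#|non_isolated G| + #|faces G r| ==
     #|arcs G|./2 + 2 * n_comp (adj G) (non_isolated G))%N.

(* G has an embedding in the plane with all vertices on the outer face: any
   face of an embedding in the sphere can be taken as outer face, so that this
   amounts to an embedding of each component in the sphere with a face whose
   boundary visits all the vertices of that component. *)
Definition outerplanar G : bool :=
  [exists r : {perm T * T}, planar_rotation G r &&
     [forall x in non_isolated G, exists F in faces G r,
        forall y, connect (adj G) x y ==> [exists d in F, d.1 == y]]].

Definition dissection G : bool :=
  [&& (2 < #|T|)%N, two_connected G & outerplanar G].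

Definition single_edge G : bool :=
  (#|T| == 2)%N && [forall x, forall y, adj G x y == (x != y)].

End Graphs.

(** * The classes *)

Definition classC (n : nat) : {set graph 'I_n} :=
  [set G | connected G && outerplanar G].

Definition classChat (n : nat) : {set rooted_graph 'I_n} :=
  [set G | G.1 \in classC n].

Definition classD (n : nat) : {set graph 'I_n} :=
  [set G | dissection G || single_edge G].

Definition classV (n : nat) : {set rooted_graph 'I_n} :=
  [set G | G.1 \in classD n].

Definition Z (K : forall n, {set graph 'I_n}) : series :=
  cycle_index_sum (fun n => @graph_iso 'I_n) K.

Definition Zrooted (K : forall n, {set rooted_graph 'I_n}) : series :=
  cycle_index_sum (fun n => @rooted_iso 'I_n) K.

(* Main.v *)
(* By Burnside's lemma each cycle index sum is a sum over pairs (a, G) of a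
   permutation a of the n vertices and a labelled graph G fixed by a, divided
   by n!.  For such a pair with G connected, the dissymmetry theorem
     fixed vertices + fixed blocks - incidences between them = 1
   is the Lefschetz trace formula on the block tree, obtained here from the
   projections of G onto its blocks.  It remains to see that substituting the
   rooted graphs in Z(D) and Z(V) counts triples (a, G, B) with B a fixed block:
   cutting G along B leaves a forest rooted at the vertices of B, and over a
   cycle of length i of a on B the trees of the forest are copies of one tree,
   on which a^i acts; this gives the dilation s_k -> s_(ik).
   Outerplanarity passes to subgraphs and to unions glued along a vertex; both
   follow from the genus inequality for a pair of permutations, a rotation
   system being treated as the permutation that turns around the vertices. *)

Require Import Defs.
From HB Require Import structures.
From mathcomp Require Import all_boot all_order all_algebra all_fingroup.
From mathcomp Require Import finmap zify.
From mathcomp.multinomials Require Import monalg.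

Set Implicit Arguments.
Unset Strict Implicit.
Unset Printing Implicit Defensive.

Import GRing.Theory.

(** Two devices carry the details. Counting is always done with labels: a block or a tree is given a
    labelling by a standard set, the enlarged data are put in bijection, and the number of
    labellings is divided out. The factorials that arise are those of the exponential form of the
    cycle index sums, in which a product of series corresponds to a splitting of the vertex set.
    Plane embeddings are handled by surgery: deleting an edge, dropping a dart and joining two
    components each multiply one permutation by a transposition. The numbers of vertices, edges and
    faces then change by at most one each, so equality in the genus inequality survives for purely
    numerical reasons, and only the face that visits all vertices has to be followed. To let graphs
    on the same vertices share one carrier, all permutations act on [T * T] and fix the pairs that
    are not arcs. *)

Local Notation croot := fingraph.root.

(** * Counting the components of a relation *)

Section Connectivity.

Variable T : finType.
Implicit Types R : rel T.

Lemma connect_invariant (U : Type) R (f : T -> U) :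
    (forall a b, R a b -> f a = f b) ->
  forall a b, connect R a b -> f a = f b.
Proof.
move=> fR a _ /connectP[p pth ->].
by elim: p a pth => //= b p IH a /andP[/fR-> /IH].
Qed.

Lemma connect_homo (U : finType) (R' : rel U) R (f : T -> U) :
    (forall a b, R a b -> connect R' (f a) (f b)) ->
  forall a b, connect R a b -> connect R' (f a) (f b).
Proof.
move=> fR a _ /connectP[p pth ->].
elim: p a pth => [a _|b p IH a] /=; first exact: connect0.
by case/andP=> /fR Rab /IH; apply: connect_trans.
Qed.

(** Every [R2] step stays in a component of [R1] or crosses the single link [xy], and one link joins
    at most two components. *)
Lemma n_comp_link R1 R2 x y :
    connect_sym R1 -> connect_sym R2 ->
    (forall a b, R2 a b -> [|| connect R1 a b, connect R1 a x && connect R1 y b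
                             | connect R1 a y && connect R1 x b]) ->
  n_comp R1 T <= n_comp R2 T + ~~ connect R1 x y.
Proof.
move=> sym1 sym2 R2_link; 
(* [k] names the [R1] component of [a], with that of [y] renamed to that of [x]; it is therefore
   constant on the components of [R2]. *)
pose k a := if connect R1 a y then croot R1 x else croot R1 a.
have kP a b : connect R2 a b -> k a = k b.
  apply: connect_invariant => {}a {}b /R2_link /or3P[ab|/andP[ax yb]|/andP[ay xb]].
  - by rewrite /k (same_connect sym1 ab) (fingraph.rootP sym1 ab).
  - rewrite /k [connect R1 b y]sym1 yb; case: ifP => // _.
    exact/(fingraph.rootP sym1).
  - rewrite /k ay; case: ifP => // _; exact/(fingraph.rootP sym1).
pose A := [set a | roots R1 a && (connect R1 x y || (a != croot R1 y))].
have kA : {in A, forall a, k a = a}.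
  move=> a; rewrite inE /k => /andP[/eqP ra].
  case: ifP => [ay|//]; rewrite ?ra //.
  have [xy _|_ /=] := boolP (connect R1 x y).
    by rewrite (fingraph.rootP sym1 xy) -ra; apply/esym/(fingraph.rootP sym1).
  by case/eqP; rewrite -ra; apply/(fingraph.rootP sym1).
have injA : {in A &, injective (croot R2)}.
  move=> a b aA bA rab; rewrite -(kA a aA) -(kA b bA).
  rewrite (kP _ _ (connect_root R2 a)) [croot R2 a]rab.
  by rewrite -(kP _ _ (connect_root R2 b)).
apply: (@leq_trans (#|A| + ~~ connect R1 x y)); last first.
  rewrite leq_add2r -(card_in_imset injA); apply/subset_leq_card/subsetP.
  by move=> _ /imsetP[a _ ->]; rewrite !inE andbT; apply: roots_root.
rewrite /n_comp_mem; have [xy|nxy] := boolP (connect R1 x y).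
  rewrite addn0; apply/subset_leq_card/subsetP=> a.
  by rewrite !inE xy /= andbT => ->.
rewrite addn1; apply: (@leq_trans #|croot R1 y |: A|).
  apply/subset_leq_card/subsetP=> a; rewrite !inE (negPf nxy) /= andbT.
  by case: eqVneq => //= _; rewrite andbT.
by rewrite cardsU1; case: (_ \notin _) => /=; rewrite ?add1n ?add0n.
Qed.

Lemma n_comp_merge R1 R2 x y :
    connect_sym R1 -> connect_sym R2 -> subrel R1 (connect R2) ->
    connect R2 x y -> ~~ connect R1 x y ->
  n_comp R2 T < n_comp R1 T.
Proof.
move=> sym1 sym2 sub12 xy2 nxy1; 
have sub a b : connect R1 a b -> connect R2 a b by apply: connect_sub.
pose A := [set a | roots R1 a & a != croot R1 y].
have lA : n_comp R2 T <= #|croot R2 @: A|.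
  apply/subset_leq_card/subsetP=> r; rewrite !inE andbT => /eqP r2.
  apply/imsetP; have [ry|nry] := eqVneq (croot R1 r) (croot R1 y).
    exists (croot R1 x).
      by rewrite inE (roots_root sym1) /= (root_connect sym1).
    rewrite -[LHS]r2; apply/(fingraph.rootP sym2).
    apply: connect_trans (sub _ _ (connect_root R1 x)).
    apply: connect_trans (sub _ _ (connect_root R1 r)) _.
    rewrite sym2; apply: connect_trans xy2 _.
    rewrite [croot R1 r]ry; apply: sub; exact: connect_root.
  exists (croot R1 r); first by rewrite inE nry (roots_root sym1).
  by rewrite -[LHS]r2; apply/(fingraph.rootP sym2)/sub/connect_root.
apply: leq_ltn_trans lA _; apply: leq_ltn_trans (leq_imset_card _ _) _.
apply: proper_card; apply/properP; split.
  by apply/subsetP=> a; rewrite !inE andbT => /andP[].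
by exists (croot R1 y); rewrite !inE ?eqxx ?andbF // (roots_root sym1).
Qed.

Lemma connect_restrict R1 R2 (A : {pred T}) :
    (forall a b, a \in A -> R1 a b = R2 a b) ->
    (forall a b, a \in A -> R1 a b -> b \in A) ->
  forall a, a \in A -> connect R1 a =1 connect R2 a.
Proof.
move=> R12 RA a aA b; apply/connectP/connectP=> -[p pth ->{b}]; exists p => //.
  by elim: p a aA pth => //= c p IH a aA /andP[/[dup] ac]; rewrite -R12 // => -> /IH -> //; apply: RA ac.
elim: p a aA pth => //= c p IH a aA /andP[]; rewrite -R12 // => /[dup] ac -> /IH -> //.
exact: RA ac.
Qed.

(** [R1] and [R2] are the two halves of [R]. On its idle half each of them has one component per
    point, and these points add up to [#|T|]. *)
Lemma n_comp_disjoint R R1 R2 (A : {pred T}) :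
    (forall a b, a \in A -> R a b = R1 a b) ->
    (forall a b, a \notin A -> R a b = R2 a b) ->
    (forall a b, R a b -> (a \in A) = (b \in A)) ->
    (forall a b, a \notin A -> R1 a b -> b = a) ->
    (forall a b, a \in A -> R2 a b -> b = a) ->
  n_comp R T + #|T| = n_comp R1 T + n_comp R2 T.
Proof.
move=> RR1 RR2 RA R1A R2A.
have triv R' (B : {pred T}) : (forall a b, a \in B -> R' a b -> b = a) ->
    n_comp R' B = #|B|.
  move=> R'B; apply: eq_card => a; rewrite !inE.
  case aB: (a \in B); rewrite ?andbF ?andbT //.
  rewrite /roots /fingraph.root; case: pickP => [b|] /=; last by rewrite eqxx.
  case/connectP=> p; elim: p a aB => /= [a _ _ ->|c p IH a aB /andP[ac]]; first exact: eqxx.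
  by have -> := R'B _ _ aB ac; apply: IH.
have same R' (B : {pred T}) : (forall a b, a \in B -> R a b = R' a b) ->
    (forall a b, a \in B -> R a b -> b \in B) -> n_comp R B = n_comp R' B.
  move=> RR' RB; apply: eq_card => a; rewrite !inE.
  case aB: (a \in B); rewrite ?andbF ?andbT //.
  by rewrite /roots /fingraph.root (eq_pick (connect_restrict RR' RB aB)).
rewrite !(n_compC A) (same R1) // => [|a b aA /RA <- //].
rewrite (same R2 [predC A]) => [|a b|a b]; rewrite ?inE; first last.
- by move=> aA /RA <-.
- exact: RR2.
rewrite (triv R1 [predC A]) // (triv R2 A) // -(cardC A).
by rewrite addnACA [RHS]addnACA; congr (_ + _); apply: addnC.
Qed.

End Connectivity.

(** * The genus of a pair of permutations *)

Section Genus.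

Variable D : finType.
Implicit Types (s e : {perm D}) (x y d : D).

(** The classes are the orbits of the group generated by [s] and [e]. For a rotation system and the
    flip of arcs they are the components of the graph. *)
Definition joint_rel s e : rel D := relU (frel s) (frel e).
Definition joint s e : rel D := connect (joint_rel s e).

Lemma joint_sym s e : connect_sym (joint_rel s e).
Proof. by apply: relU_sym => x y; apply/fconnect_sym/perm_inj. Qed.

Lemma joint_s s e x : joint s e x (s x).
Proof. by apply: connect1; rewrite /joint_rel /= eqxx. Qed.

Lemma joint_e s e x : joint s e x (e x).
Proof. by apply: connect1; rewrite /joint_rel /= eqxx orbT. Qed.

Lemma jointC s e x y : joint s e x y = joint s e y x.
Proof. exact: joint_sym. Qed.

Lemma joint_eV s e x : joint s e (e^-1 x)%g x.
Proof. by rewrite -{2}(permKV e x) joint_e. Qed.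

Lemma joint_trans s e : transitive (joint s e).
Proof. exact: connect_trans. Qed.

Lemma porbit_next s x : s x \in porbit s x.
Proof. exact: (mem_porbit s 1). Qed.

Lemma porbit_sub s (R : rel D) :
    reflexive R -> transitive R -> (forall z, R z (s z)) ->
  forall x y, y \in porbit s x -> R x y.
Proof.
move=> Rxx Rtr Rs x y /porbitP[i ->].
elim: i => [|i IH]; first by rewrite perm1.
by rewrite expgSr permM; apply: Rtr IH _.
Qed.

Lemma porbit_connect s x y : (y \in porbit s x) = fconnect s x y.
Proof.
apply/idP/idP; first by apply: porbit_sub; [apply: connect0 | apply: connect_trans | apply: fconnect1].
move=> xy; rewrite (@connect_invariant _ _ (frel s) (porbit s) _ x y xy).
  exact: porbit_id.
by move=> a b /eqP <-; apply/eqP; rewrite eq_porbit_mem porbit_sym porbit_next.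
Qed.

Lemma joint_porbit_s s e x y : y \in porbit s x -> joint s e x y.
Proof. by apply: porbit_sub; [apply: connect0 | apply: connect_trans | apply: joint_s]. Qed.

Lemma joint_porbit_e s e x y : y \in porbit e x -> joint s e x y.
Proof. by apply: porbit_sub; [apply: connect0 | apply: connect_trans | apply: joint_e]. Qed.

Lemma joint_porbit_f s e x y : y \in porbit (e * s) x -> joint s e x y.
Proof.
apply: porbit_sub; [exact: connect0 | exact: connect_trans |] => z.
by rewrite permM; apply: joint_trans (joint_e _ _ _) (joint_s _ _ _).
Qed.

Lemma porbit_step s x : porbit s (s x) = porbit s x.
Proof. exact: (porbit_perm s 1). Qed.

Lemma porbit_eq s x y : y \in porbit s x -> porbit s y = porbit s x.
Proof. by rewrite -eq_porbit_mem => /eqP. Qed.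

Lemma mul_tperm_conj e x y :
  (e * tperm x y = tperm (e^-1 x) (e^-1 y) * e)%g.
Proof. by rewrite -tpermJ conjgE invgK -!mulgA mulVg mulg1. Qed.

(** When [a] and [b] share a cycle after the transposition, cycles have only been merged, never
    cut. *)
Lemma porbit_merge s a b z t :
    a \in porbit (tperm a b * s) b -> t \in porbit s z ->
  t \in porbit (tperm a b * s) z.
Proof.
move=> ab.
apply: (@porbit_sub s (fun c1 c2 => c2 \in porbit (tperm a b * s) c1)).
- by move=> c; apply: porbit_id.
- by move=> c1 c2 c3 h1; rewrite -(porbit_eq h1).
move=> c; have -> : s c = (tperm a b * s)%g (tperm a b c) by rewrite permM tpermK.
rewrite -eq_porbit_mem porbit_step; apply/eqP; case: tpermP => // ->.
  exact/esym/porbit_eq.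
exact/porbit_eq.
Qed.

Definition joint_orbits s e := n_comp (joint_rel s e) D.

Lemma joint_tperm_e s e x y a b : joint_rel s (tperm x y * e) a b ->
  [|| joint s e a b, joint s e a x && joint s e y b
    | joint s e a y && joint s e x b].
Proof.
case/orP=> /eqP<-; first by rewrite joint_s.
rewrite permM; case: tpermP => [->|->|_ _].
- by rewrite /joint connect0 -/(joint s e) joint_e orbT.
- by rewrite /joint connect0 -/(joint s e) joint_e !orbT.
- by rewrite joint_e.
Qed.

Lemma joint_tperm_s s e x y a b : joint_rel (tperm x y * s) e a b ->
  [|| joint s e a b, joint s e a x && joint s e y b
    | joint s e a y && joint s e x b].
Proof.
case/orP=> /eqP<-; last by rewrite joint_e.
rewrite permM; case: tpermP => [->|->|_ _].
- by rewrite /joint connect0 -/(joint s e) joint_s orbT.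
- by rewrite /joint connect0 -/(joint s e) joint_s !orbT.
- by rewrite joint_s.
Qed.

(** Vertices, edges and faces are added instead of alternated. If [e] is an involution without fixed
    points then |D| = 2E, and V + E + F <= |D| + 2c reads V - E + F <= 2c; the sum form makes sense
    for any two permutations, fixed points included. *)
Definition euler s e := #|porbits s| + #|porbits e| + #|porbits (e * s)|.

Lemma porbits_split s x y : x != y ->
  #|porbits (tperm x y * s)| =
    if x \in porbit s y then #|porbits s|.+1 else #|porbits s|.-1.
Proof.
move=> xy; have := porbits_mul_tperm s x y; rewrite xy /=.
case: (x \in _) => /=; rewrite /double /=; lia.
Qed.

(** Multiplying twice by the transposition gives back [s], so the changes in the two cycle counts
    cancel: one of them is a split and the other a merge. *)
Lemma porbit_split s x y : x != y ->
  (x \in porbit (tperm x y * s) y) = (x \notin porbit s y).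
Proof.
move=> xy; have := porbits_mul_tperm s x y; rewrite xy /=.
have := porbits_mul_tperm (tperm x y * s) x y; rewrite xy /= tpermKg.
by do 2 case: (x \in _) => //=; rewrite /double /=; lia.
Qed.

Lemma joint_orbits_split s e e' x y :
    x != y -> y \in porbit e x -> e' = (tperm x y * e)%g ->
  joint_orbits s e' <= joint_orbits s e + ~~ joint s e' x y.
Proof.
move=> xy yx e'E; apply: n_comp_link; try exact: joint_sym.
move=> a b; rewrite -{1}(tpermKg x y e) -e'E; exact: joint_tperm_e.
Qed.

(** The cut adds one cycle to [e] and changes the faces by one. The only way to gain a component is
    to separate [x] from [y]; these then lie on different faces afterwards, so a face has been split
    as well, and the total gain of two pays for the component. *)
Lemma euler_split s e e' x y :
    x != y -> y \in porbit e x -> e' = (tperm x y * e)%g ->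
  euler s e + 2 * joint_orbits s e' <= euler s e' + 2 * joint_orbits s e.
Proof.
move=> xy yx e'E; rewrite /euler.
have -> : #|porbits e'| = #|porbits e|.+1.
  by rewrite e'E porbits_split // porbit_sym yx.
have fE : (e' * s = tperm x y * (e * s))%g by rewrite e'E mulgA.
have := joint_orbits_split s xy yx e'E; rewrite fE.
have := porbits_mul_tperm (e * s) x y; rewrite /= xy.
have [_|njoint] := boolP (joint s e' x y).
  case: (x \in _) => /=; rewrite /double /=; lia.
have : x \notin porbit (tperm x y * (e * s)) y.
  apply: contra njoint; rewrite -fE porbit_sym; exact: joint_porbit_f.
by rewrite porbit_split // negbK => -> /=; rewrite /double /=; lia.
Qed.

(* Euler's inequality [V - E + F <= 2c]. *)
Lemma euler_le s e : euler s e <= #|D| + 2 * joint_orbits s e.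
Proof.
have [n] := ubnP (#|D| - #|porbits e|); elim: n e => // n IH e le_n.
have card_le (u : {perm D}) : #|porbits u| <= #|D| by rewrite leq_imset_card.
(* The point [e x] is split off as a fixed point, until [e] is the identity. The faces are then the
   cycles of [s], and so are the components. *)
case: (pickP (fun x => e x != x)) => [x ex|e1].
  pose e' := (tperm x (e x) * e)%g.
  have xex : x != e x by rewrite eq_sym.
  have := euler_split s xex (porbit_next e x) (erefl e').
  suff : euler s e' <= #|D| + 2 * joint_orbits s e' by lia.
  apply: IH; have : #|porbits e'| = #|porbits e|.+1.
    by rewrite porbits_split // porbit_sym porbit_next.
  by have := card_le e'; lia.
have {e1} -> : e = 1%g by apply/permP=> x; rewrite perm1; apply/eqP/negbFE/e1.
rewrite /euler mul1g.
have : #|porbits s| <= joint_orbits s 1%g.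
  apply: (@leq_trans #|[set porbit s x | x in roots (joint_rel s 1%g)]|).
    apply/subset_leq_card/subsetP=> _ /imsetP[x _ ->].
    apply/imsetP; exists (croot (joint_rel s 1%g) x).
      by apply: roots_root; apply: joint_sym.
    apply: connect_invariant (connect_root _ x) => a b /orP[]/eqP<-.
      apply/eqP; rewrite eq_porbit_mem porbit_sym; exact: porbit_next.
    by rewrite perm1.
  apply: leq_trans (leq_imset_card _ _) _.
  by apply/subset_leq_card/subsetP=> a; rewrite !inE andbT.
by have := card_le 1%g; lia.
Qed.

(** Same balance as in [euler_split]. In the face permutation the transposition now stands between
    [e] and [s]; moved across [e], it exchanges the [e]-preimages of [x] and [y]. *)
Lemma euler_split_s s s' e x y :
    x != y -> y \in porbit s x -> s' = (tperm x y * s)%g ->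
  euler s e + 2 * joint_orbits s' e <= euler s' e + 2 * joint_orbits s e.
Proof.
move=> xy yx s'E; rewrite /euler.
have -> : #|porbits s'| = #|porbits s|.+1.
  by rewrite s'E porbits_split // porbit_sym yx.
have : joint_orbits s' e <= joint_orbits s e + ~~ joint s' e x y.
  apply: n_comp_link; try exact: joint_sym.
  by move=> a b; rewrite -{1}(tpermKg x y s) -s'E; exact: joint_tperm_s.
have fE : (e * s' = tperm (e^-1 x) (e^-1 y) * (e * s))%g.
  by rewrite s'E mulgA mul_tperm_conj mulgA.
have xy' : (e^-1)%g x != (e^-1)%g y by rewrite (inj_eq perm_inj).
rewrite fE; have := porbits_mul_tperm (e * s) ((e^-1)%g x) ((e^-1)%g y).
rewrite /= xy' -fE; have [_|njoint] := boolP (joint s' e x y).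
  case: (_ \in _) => /=; rewrite /double /=; lia.
have : (e^-1)%g x \notin porbit (e * s') ((e^-1)%g y).
  apply: contra njoint => /(joint_porbit_f); rewrite jointC.
  move=> h; apply: joint_trans (joint_trans h (joint_eV _ _ _)).
  by rewrite jointC joint_eV.
by rewrite {1}fE porbit_split // negbK => -> /=; rewrite /double /=; lia.
Qed.

Lemma porbits_n_comp s : #|porbits s| = n_comp (frel s) D.
Proof.
have sym : connect_sym (frel s) by move=> x y; apply/fconnect_sym/perm_inj.
have -> : porbits s = porbit s @: [set x | roots (frel s) x].
  apply/setP=> c; apply/imsetP/imsetP=> -[x _ ->]; last by exists x.
  exists (croot (frel s) x); first by rewrite inE (roots_root sym).
  apply/eqP; rewrite eq_porbit_mem porbit_sym porbit_connect.
  exact: connect_root.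
rewrite card_in_imset => [|x y].
  by apply: eq_card => x; rewrite !inE andbT.
rewrite !inE => /eqP <- /eqP <- /eqP.
rewrite eq_porbit_mem porbit_connect sym => /(fingraph.rootP sym).
by rewrite !(root_root sym).
Qed.

Lemma joint1 e : joint 1 e =2 fconnect e.
Proof.
move=> x y; apply/idP/idP.
  by apply: connect_sub => a b /orP[]/eqP<-; rewrite ?perm1 ?fconnect1 ?connect0.
by apply: connect_sub => a b /eqP <-; apply: joint_e.
Qed.

(* [s] turns around the vertices, [e] swaps the two ends of the edges and
   [e * s] follows the faces.  The surface is a union of spheres (Euler's
   formula), and each component has a face that visits all its vertices. *)
Definition outer s e :=
  euler s e = #|D| + 2 * joint_orbits s e /\
  forall x, exists f, forall z, joint s e x z ->
    exists2 w, w \in porbit s z & w \in porbit (e * s) f.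

(** For [s = 1] the faces, the cycles of [e] and the components all coincide. This is the start of
    every construction: graphs whose edges are pairwise disjoint. *)
Lemma outer1 e : outer 1 e.
Proof.
split=> [|x]; last first.
  exists x => z; rewrite joint1 -porbit_connect => zx; exists z => //.
    exact: porbit_id.
  by rewrite mulg1.
rewrite /euler /joint_orbits (eq_n_comp (joint1 e)) -porbits_n_comp mulg1.
suff -> : #|porbits (1 : {perm D})| = #|D| by lia.
rewrite card_imset // => x y /eqP; rewrite eq_porbit_mem => /porbitP[i ->].
by rewrite expg1n perm1.
Qed.

(** In its use, [x] and [y] are the two arcs of an edge to be deleted. Euler's equality persists
    because it is squeezed between [euler_split] and [euler_le]; the work lies in finding the
    covering face. *)
Lemma outer_delete s e e' x y :
    x != y -> y \in porbit e x -> e' = (tperm x y * e)%g ->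
  outer s e -> outer s e'.
Proof.
move=> xy yx e'E [eul cov].
have fE : (e' * s = tperm x y * (e * s))%g by rewrite e'E mulgA.
have split_le := euler_split s xy yx e'E.
have le' := euler_le s e'.
split; first lia.
have subj a b : joint s e' a b -> joint s e a b.
  apply: connect_sub => {}a {}b /orP[]/eqP<-; first exact: joint_s.
  rewrite e'E permM; case: tpermP => [->|->|_ _]; last exact: joint_e.
    apply: joint_trans (joint_e _ _ _); exact: joint_porbit_e.
  apply: joint_trans (joint_e _ _ _).
  by apply: joint_porbit_e; rewrite porbit_sym.
(* In genus zero an edge either separates two faces, which merge, or is a bridge: the same face on
   both sides without disconnection would push [euler] above its bound. *)
have dich : x \in porbit (e' * s) y \/ ~~ joint s e' x y.
  have [xfy|nxfy] := boolP (x \in porbit (e * s) y); last first.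
    by left; rewrite fE porbit_split.
  right.
  apply/negP=> jxy; have := joint_orbits_split s xy yx e'E; rewrite jxy.
  move: eul le' split_le; rewrite /euler fE porbits_split // xfy.
  by rewrite e'E porbits_split // porbit_sym yx; lia.
(* [k] is the new face of [a], with the faces of [x] and [y] identified; it is constant along the
   old faces. By [dich], the identification is vacuous within a new component. *)
pose k a := if a \in porbit (e' * s) y then porbit (e' * s) x else porbit (e' * s) a.
have kE a b : b \in porbit (e * s) a -> k a = k b.
  rewrite porbit_connect; apply: connect_invariant => {}a {}b /eqP <-.
  have -> : (e * s)%g a = (e' * s)%g (tperm x y a).
    by rewrite fE [RHS]permM tpermK.
  have kf c : k ((e' * s)%g c) = k c.
    rewrite /k -2!eq_porbit_mem.
    suff -> : porbit (e' * s) ((e' * s)%g c) = porbit (e' * s) c by [].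
    by rewrite porbit_step.
  rewrite kf; case: tpermP => // ->; rewrite /k porbit_id.
    by case: ifP => //; rewrite -eq_porbit_mem => /eqP->.
  by case: ifP.
move=> x0; have [f fP] := cov x0.
have [w0 w0x0 w0f] := fP x0 (connect0 _ _).
exists w0 => z x0z; have [w wz wf] := fP z (subj _ _ x0z).
exists w => //; have /kE : w \in porbit (e * s) w0.
  by rewrite -eq_porbit_mem in w0f; rewrite (eqP w0f).
have w0w : joint s e' w0 w.
  apply: joint_trans (joint_trans x0z (joint_porbit_s e' wz)).
  by rewrite jointC; apply: joint_porbit_s.
rewrite -eq_porbit_mem /k; case: ifP => [w0y|w0y]; case: ifP => [wy|wy].
- by move=> _; rewrite -eq_porbit_mem in wy; rewrite (eqP wy) eq_porbit_mem porbit_sym.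
- move/eqP; rewrite eq_porbit_mem => xw; case: dich => [xy'|/negP[]].
    move: wy; rewrite porbit_sym; rewrite -eq_porbit_mem in xy'.
    by rewrite -eq_porbit_mem -(eqP xy') eq_porbit_mem xw.
  rewrite jointC; apply: joint_trans (joint_porbit_f w0y) _.
  apply: joint_trans w0w _; exact: joint_porbit_f.
- move/esym/eqP; rewrite eq_porbit_mem => xw0; case: dich => [xy'|/negP[]].
    move: w0y; rewrite porbit_sym; rewrite -eq_porbit_mem in xy'.
    by rewrite -eq_porbit_mem -(eqP xy') eq_porbit_mem xw0.
  rewrite jointC; apply: joint_trans (joint_porbit_f wy) _.
  rewrite jointC in w0w; apply: joint_trans w0w _; exact: joint_porbit_f.
- by move=> ->.
Qed.

(** The product with the transposition is [s] with [x] cut out of its cycle and left fixed.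
    Replacing [x] by its successor carries old cycles to new ones. *)
Lemma porbit_skip s x a b : b \in porbit s a ->
  porbit (tperm (s^-1 x)%g x * s) (if a == x then s x else a) =
  porbit (tperm (s^-1 x)%g x * s) (if b == x then s x else b).
Proof.
set s' := (_ * s)%g; set p := (s^-1)%g x.
have [sx|sx] := eqVneq (s x) x.
  have -> : s' = s by rewrite /s' /p -{1}sx permK tperm1 mul1g.
  move=> ba; have g_id c : (if c == x then s x else c) = c.
    by case: eqP => // ->.
  by rewrite !g_id (porbit_eq ba).
have sp : s p = x by rewrite /p permKV.
rewrite porbit_connect; pose g w := if w == x then s x else w.
apply: (connect_invariant (f := fun c => porbit s' (g c))) => {}a {}b /eqP <-.
rewrite /g; have [->|ax] := eqVneq a x; first by rewrite (negPf sx).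
have [sax|sax] := eqVneq (s a) x.
  have ap : a = p by rewrite /p -sax permK.
  have -> : s x = s' a by rewrite /s' ap permM tpermL.
  by rewrite porbit_step.
suff -> : s a = s' a by rewrite porbit_step.
rewrite permM tpermD // eq_sym //; apply: contra sax => /eqP ->.
by rewrite sp.
Qed.

(** A fixed point [x] of [e] is a half-edge without partner. Cutting it out of the rotation at its
    vertex cuts it out of its face in the same way, so [porbit_skip] applies to both permutations,
    and [x] remains as a component of its own. *)
Lemma outer_dangling s s' e x :
    e x = x -> s' = (tperm (s^-1 x) x * s)%g -> outer s e -> outer s' e.
Proof.
move=> ex s'E [eul cov].
have [px|px] := eqVneq ((s^-1)%g x) x.
  by move: s'E; rewrite px tperm1 mul1g => ->.
have sx : s x != x by apply: contra px => /eqP {1}<-; rewrite permK.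
set p := (s^-1)%g x in px s'E; have sp : s p = x by rewrite /p permKV.
have xp : x \in porbit s p by rewrite -sp porbit_next.
have eVx : (e^-1)%g x = x by rewrite -{1}ex permK.
have fE : (e * s' = tperm (e^-1 p) x * (e * s))%g.
  by rewrite s'E mulgA mul_tperm_conj eVx mulgA.
have px' : (e^-1)%g p != x by rewrite -[X in _ != X]eVx (inj_eq perm_inj).
split.
  have := euler_split_s e px xp s'E; have := euler_le s' e.
  move: eul; rewrite /euler fE porbits_split // porbit_sym.
  have -> : x \in porbit (e * s) ((e^-1)%g p).
    by rewrite -{1}sp -{1}(permKV e p) -[s _]permM porbit_next.
  rewrite s'E porbits_split // porbit_sym xp; lia.
have subj a b : joint s' e a b -> joint s e a b.
  apply: connect_sub => {}a {}b /orP[]/eqP<-; last exact: joint_e.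
  rewrite s'E permM; case: tpermP => [->|->|_ _]; last exact: joint_s.
    by apply: joint_trans (joint_s _ _ _); rewrite -[X in joint _ _ _ X]sp; apply: joint_s.
  apply: joint_trans (joint_s _ _ _); rewrite jointC.
  by rewrite -[X in joint _ _ _ X]sp; apply: joint_s.
have s'x : s' x = x by rewrite s'E permM tpermR.
pose g w := if w == x then s x else w.
have gs a b : b \in porbit s a -> porbit s' (g a) = porbit s' (g b).
  by rewrite s'E; apply: porbit_skip.
have gf a b : b \in porbit (e * s) a -> porbit (e * s') (g a) = porbit (e * s') (g b).
  have fx : (e * s)%g x = s x by rewrite permM ex.
  have -> : (e * s' = tperm ((e * s)^-1 x) x * (e * s))%g by rewrite fE invMg permM.
  by rewrite /g -fx; apply: porbit_skip.
have invx : forall a b, joint s' e a b -> (a == x) = (b == x).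
  apply: (connect_invariant (f := fun c => c == x)) => a b /orP[]/eqP <-.
    by rewrite -{2}s'x (inj_eq perm_inj).
  by rewrite -{2}ex (inj_eq perm_inj).
move=> x0; have [f fP] := cov x0.
have [x0x|x0x] := eqVneq x0 x.
  exists x => z; rewrite x0x => xz; exists x; last exact: porbit_id.
  suff : true = (z == x) by move/esym/eqP->; exact: porbit_id.
  by rewrite -(invx x z xz) eqxx.
exists (g f) => z x0z.
have zx : z != x.
  by rewrite -(invx _ _ x0z).
have [w wz wf] := fP z (subj _ _ x0z); exists (g w).
  have := gs _ _ wz; rewrite {1}/g (negPf zx) => ->; exact: porbit_id.
by rewrite (gf _ _ wf) porbit_id.
Qed.

(** The two vertices are joined at corners that lie on the covering faces of their components. These
    two faces become one, which covers the union. *)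
Lemma outer_glue s e x y : outer s e -> ~~ joint s e x y ->
  exists x1 y1, [/\ x1 \in porbit s x, y1 \in porbit s y,
    x1 != y1 & outer (tperm x1 y1 * s) e].
Proof.
move=> [eul cov] nxy.
have [fx fxP] := cov x; have [fy fyP] := cov y.
have [wx wxx wxf] := fxP x (connect0 _ _); have [wy wyy wyf] := fyP y (connect0 _ _).
(* Predecessors are needed because the transposition acts before [s]: on faces it exchanges the
   [e]-preimages of [x1] and [y1], whose successors [wx] and [wy] lie on the covering faces. *)
pose x1 := (s^-1)%g wx; pose y1 := (s^-1)%g wy.
have x1x : x1 \in porbit s x.
  rewrite porbit_sym; rewrite -eq_porbit_mem in wxx; rewrite -eq_porbit_mem -(eqP wxx).
  by rewrite eq_porbit_mem -{1}(permKV s wx) porbit_next.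
have y1y : y1 \in porbit s y.
  rewrite porbit_sym; rewrite -eq_porbit_mem in wyy; rewrite -eq_porbit_mem -(eqP wyy).
  by rewrite eq_porbit_mem -{1}(permKV s wy) porbit_next.
have jx := joint_porbit_s e x1x; have jy := joint_porbit_s e y1y.
have nxy1 : ~~ joint s e x1 y1.
  apply: contra nxy => h; apply: joint_trans jx (joint_trans h _).
  by rewrite jointC.
have xy1 : x1 != y1 by apply: contra nxy1 => /eqP->; apply: connect0.
have ns : x1 \notin porbit s y1.
  by apply: contra nxy1; rewrite porbit_sym; apply: joint_porbit_s.
exists x1, y1; split=> //; set s' := (tperm x1 y1 * s)%g.
pose x2 := (e^-1)%g x1; pose y2 := (e^-1)%g y1.
have fE : (e * s' = tperm x2 y2 * (e * s))%g.
  by rewrite mulgA mul_tperm_conj mulgA.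
have xy2 : x2 != y2 by rewrite (inj_eq perm_inj).
have fx2 : (e * s)%g x2 = wx by rewrite permM permKV permKV.
have fy2 : (e * s)%g y2 = wy by rewrite permM permKV permKV.
have nf : x2 \notin porbit (e * s) y2.
  apply: contra nxy1; rewrite porbit_sym => /joint_porbit_f h.
  apply: joint_trans (joint_trans _ h) (joint_eV _ _ _).
  by rewrite jointC joint_eV.
have x1y1' : x1 \in porbit s' y1 by rewrite porbit_split.
have x2y2' : x2 \in porbit (e * s') y2 by rewrite fE porbit_split.
have subj : subrel (joint_rel s e) (joint s' e).
  move=> a b /orP[]/eqP<-; last exact: joint_e.
  have -> : s a = s' (tperm x1 y1 a) by rewrite permM tpermK.
  apply: joint_trans (joint_s _ _ _); apply: joint_porbit_s.
  by case: tpermP => [->|->|_ _]; rewrite ?porbit_id // porbit_sym.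
have lt_c : joint_orbits s' e < joint_orbits s e.
  apply: (n_comp_merge (joint_sym s e) (joint_sym s' e) subj _ nxy1).
  by apply: joint_porbit_s; rewrite porbit_sym.
split.
  have := euler_le s' e; move: eul; rewrite /euler fE !porbits_split //.
  have pos (u : {perm D}) : 0 < #|porbits u|.
    by rewrite card_gt0; apply/set0Pn; exists (porbit u x); rewrite imset_f.
  rewrite (negPf ns) (negPf nf); move: (pos s) (pos (e * s)%g) lt_c; clear.
  move: #|porbits s| #|porbits e| #|porbits (e * s)| #|D| (joint_orbits _ _).
  move: (joint_orbits _ _); clear => c' n1 n2 n3 n4 c; lia.
have sub_s z t : t \in porbit s z -> t \in porbit s' z by apply: porbit_merge.
have sub_f z t : t \in porbit (e * s) z -> t \in porbit (e * s') z.
  by rewrite fE; apply: porbit_merge; rewrite -fE.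
have fxy : fx \in porbit (e * s') fy.
  have h1 : wx \in porbit (e * s') fx by apply: sub_f.
  have h2 : wy \in porbit (e * s') fy by apply: sub_f.
  have h3 : wx \in porbit (e * s') x2 by apply: sub_f; rewrite -fx2 porbit_next.
  have h4 : wy \in porbit (e * s') y2 by apply: sub_f; rewrite -fy2 porbit_next.
  rewrite -eq_porbit_mem -(porbit_eq h1) -(porbit_eq h2).
  by rewrite (porbit_eq h3) (porbit_eq h4) (porbit_eq x2y2').
pose k a := if joint s e a y1 then croot (joint_rel s e) x1
            else croot (joint_rel s e) a.
have sym := joint_sym s e.
have kE a b : joint s' e a b -> k a = k b.
  apply: connect_invariant => {}a {}b /joint_tperm_s /or3P[ab|/andP[ax yb]|/andP[ay xb]].
  - by rewrite /k /joint (same_connect sym ab) (fingraph.rootP sym ab).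
  - rewrite /k (jointC s e b) yb; case: ifP => // _; exact/(fingraph.rootP sym).
  - rewrite /k ay; case: ifP => // _; exact/(fingraph.rootP sym).
have near_x z : joint s e z x1 -> exists2 w, w \in porbit s' z & w \in porbit (e * s') fx.
  move=> zx1; have [|w wz wf] := fxP z.
    by apply: joint_trans jx _; rewrite jointC.
  by exists w; [apply: sub_s|apply: sub_f].
have near_y z : joint s e z y1 -> exists2 w, w \in porbit s' z & w \in porbit (e * s') fx.
  move=> zy1; have [|w wz wf] := fyP z.
    by apply: joint_trans jy _; rewrite jointC.
  exists w; first exact: sub_s.
  by rewrite (porbit_eq fxy); apply: sub_f.
move=> x0; have [x0y|nx0y] := boolP (joint s e x0 y1).
  exists fx => z /kE; rewrite /k x0y; case: ifP => [zy _|_]; first exact: near_y.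
  by move/(fingraph.rootP sym); rewrite sym; apply: near_x.
have [x0x|nx0x] := boolP (joint s e x0 x1).
  exists fx => z /kE; rewrite /k (negPf nx0y).
  case: ifP => [zy _|_ /(fingraph.rootP sym)]; first exact: near_y.
  rewrite sym => zx0; apply: near_x; exact: joint_trans zx0 x0x.
have [f fP] := cov x0; exists f => z /kE.
rewrite /k (negPf nx0y); case: ifP => [_|_] /(fingraph.rootP sym) x0z.
  by case/negP: nx0x.
by have [w wz wf] := fP z x0z; exists w; [apply: sub_s|apply: sub_f].
Qed.

(** The pairs act on complementary halves. Each of the four counts, cycles of [s], of [e], of
    [e * s] and joint orbits, satisfies the same additivity with an excess of [#|D|], and the three
    excesses in [euler] match those on the other side. *)
Lemma outer_mul s1 s2 e1 e2 (A : {set D}) :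
    (forall d, d \notin A -> s1 d = d /\ e1 d = d) ->
    (forall d, d \in A -> s2 d = d /\ e2 d = d) ->
  outer s1 e1 -> outer s2 e2 -> outer (s1 * s2) (e1 * e2).
Proof.
move=> fix1 fix2 [eul1 cov1] [eul2 cov2].
have stab (u : {perm D}) : (forall d, d \notin A -> u d = d) \/ (forall d, d \in A -> u d = d) ->
    forall d, (u d \in A) = (d \in A).
  move=> fixu d; apply/idP/idP => dA; last first.
    apply/negPn/negP=> udA; case: fixu => h; last by rewrite h ?dA in udA.
    by move: (h _ udA) => /perm_inj ud; rewrite ud dA in udA.
  apply/negPn/negP=> udA; case: fixu => h; first by rewrite h ?(negPf udA) in dA.
  by move: (h _ dA) => /perm_inj ud; rewrite ud (negPf udA) in dA.
have s1A := stab s1 (or_introl (fun d h => (fix1 d h).1)).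
have e1A := stab e1 (or_introl (fun d h => (fix1 d h).2)).
have s2A := stab s2 (or_intror (fun d h => (fix2 d h).1)).
have e2A := stab e2 (or_intror (fun d h => (fix2 d h).2)).
have sI d : d \in A -> (s1 * s2)%g d = s1 d.
  by move=> dA; rewrite permM; apply: (fix2 _ _).1; rewrite s1A.
have sO d : d \notin A -> (s1 * s2)%g d = s2 d.
  by move=> dA; rewrite permM (fix1 d dA).1.
have eI d : d \in A -> (e1 * e2)%g d = e1 d.
  by move=> dA; rewrite permM; apply: (fix2 _ _).2; rewrite e1A.
have eO d : d \notin A -> (e1 * e2)%g d = e2 d.
  by move=> dA; rewrite permM (fix1 d dA).2.
have fI d : d \in A -> (e1 * e2 * (s1 * s2))%g d = (e1 * s1)%g d.
  by move=> dA; rewrite permM eI // sI ?e1A // permM.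
have fO d : d \notin A -> (e1 * e2 * (s1 * s2))%g d = (e2 * s2)%g d.
  by move=> dA; rewrite permM eO // sO ?e2A // permM.
have porbits_mul (u u1 u2 : {perm D}) :
    (forall d, d \in A -> u d = u1 d) -> (forall d, d \notin A -> u d = u2 d) ->
    (forall d, d \notin A -> u1 d = d) -> (forall d, d \in A -> u2 d = d) ->
    #|porbits u| + #|D| = #|porbits u1| + #|porbits u2|.
  move=> uI uO u1O u2I; rewrite !porbits_n_comp; apply: (n_comp_disjoint (A := A)).
  - by move=> a b aA /=; rewrite uI.
  - by move=> a b aA /=; rewrite uO.
  - move=> a b /eqP <-; case aA: (a \in A).
      by rewrite uI // (stab u1 (or_introl u1O)).
    by rewrite uO ?aA // (stab u2 (or_intror u2I)) aA.
  - by move=> a b aA /eqP <-; apply: u1O.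
  - by move=> a b aA /eqP <-; apply: u2I.
have sE := porbits_mul _ _ _ sI sO (fun d h => (fix1 d h).1) (fun d h => (fix2 d h).1).
have eE := porbits_mul _ _ _ eI eO (fun d h => (fix1 d h).2) (fun d h => (fix2 d h).2).
have fE : #|porbits (e1 * e2 * (s1 * s2))| + #|D| =
    #|porbits (e1 * s1)| + #|porbits (e2 * s2)|.
  apply: porbits_mul => // d dA; rewrite permM.
    by rewrite (fix1 d dA).2 (fix1 d dA).1.
  by rewrite (fix2 d dA).2 (fix2 d dA).1.
have RI a b : a \in A -> joint_rel (s1 * s2) (e1 * e2) a b = joint_rel s1 e1 a b.
  by move=> aA; rewrite /joint_rel /= sI // eI.
have RO a b : a \notin A -> joint_rel (s1 * s2) (e1 * e2) a b = joint_rel s2 e2 a b.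
  by move=> aA; rewrite /joint_rel /= sO // eO.
have RA a b : joint_rel (s1 * s2) (e1 * e2) a b -> (a \in A) = (b \in A).
  by case/orP=> /eqP <-; rewrite permM ?s2A ?s1A ?e2A ?e1A.
have cE : joint_orbits (s1 * s2) (e1 * e2) + #|D| =
    joint_orbits s1 e1 + joint_orbits s2 e2.
  apply: (n_comp_disjoint (A := A)) => //.
    by move=> a b aA /orP[]/eqP <-; have [] := fix1 a aA.
  by move=> a b aA /orP[]/eqP <-; have [] := fix2 a aA.
split; first by move: eul1 eul2; rewrite /euler; lia.
have porbit_agree (u u1 : {perm D}) (B : {pred D}) : (forall d, d \in B -> u d = u1 d) ->
    (forall d, d \in B -> u1 d \in B) -> forall d, d \in B -> porbit u d = porbit u1 d.
  move=> uB u1B d dB; apply/setP=> z; rewrite !porbit_connect.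
  apply: (@connect_restrict _ _ _ B) => // a b aB /=; first by rewrite uB.
  by move=> /eqP<-; rewrite uB // u1B.
have invA1 a b : joint s1 e1 a b -> (a \in A) = (b \in A).
  by apply: (connect_invariant (f := fun c => c \in A)) => {}a {}b /orP[]/eqP <-; rewrite ?s1A ?e1A.
have invA a b : joint s2 e2 a b -> (a \in A) = (b \in A).
  by apply: (connect_invariant (f := fun c => c \in A)) => {}a {}b /orP[]/eqP <-; rewrite ?s2A ?e2A.
move=> x; case xA: (x \in A).
  have [f fP] := cov1 x; exists f => z.
  have -> : joint (s1 * s2) (e1 * e2) x z = joint s1 e1 x z.
    by apply: (connect_restrict RI) => // a b aA /RA <-.
  move=> xz; have zA : z \in A by rewrite -(invA1 _ _ xz).
  have [w wz wf] := fP z xz; exists w.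
    by rewrite (porbit_agree _ s1 (mem A)) // => d dA; rewrite s1A.
  have fA : f \in A.
    by rewrite (invA1 _ _ (joint_porbit_f wf)) -(invA1 _ _ (joint_porbit_s e1 wz)).
  by rewrite (porbit_agree _ (e1 * s1)%g (mem A)) // => d dA; rewrite permM s1A e1A.
have [f fP] := cov2 x; exists f => z.
have -> : joint (s1 * s2) (e1 * e2) x z = joint s2 e2 x z.
  apply: (@connect_restrict _ _ _ [predC A]) => //= [a b aA /RA|]; last by rewrite inE xA.
  by rewrite !inE => <-.
move=> xz; have zA : z \notin A by rewrite -(invA _ _ xz) xA.
have [w wz wf] := fP z xz; exists w.
  by rewrite (porbit_agree _ s2 [predC A]) // => d dA; rewrite inE s2A.
have fA : f \notin A by rewrite (invA _ _ (joint_porbit_f wf)) -(invA _ _ (joint_porbit_s e2 wz)).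
by rewrite (porbit_agree _ (e2 * s2)%g [predC A]) // => d dA; rewrite inE permM s2A e2A.
Qed.

End Genus.

(** * Rotation systems *)

Section GraphBasics.

Variable T : finType.
Implicit Types (G H : graph T).

Lemma adjC G x y : adj G x y = adj G y x.
Proof. by have /andP[_ /forallP/(_ x)/forallP/(_ y)/eqP] := valP G. Qed.

Lemma adj_irr G x : adj G x x = false.
Proof. by have /andP[/forallP/(_ x)/negPf] := valP G. Qed.

Lemma adj_sym G : connect_sym (adj G).
Proof. by apply: sym_connect_sym => x y; apply: adjC. Qed.

Lemma graphP G H : adj G =2 adj H -> G = H.
Proof. by move=> GH; apply/val_inj/setP=> -[x y]; apply: GH. Qed.

Lemma simple_rel (e : rel T) : symmetric e -> irreflexive e ->
  simple [set d | e d.1 d.2].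
Proof.
move=> esym eirr; apply/andP; split.
  by apply/forallP=> x; rewrite inE /= eirr.
by apply/forallP=> x; apply/forallP=> y; rewrite !inE /= esym.
Qed.

(* The empty graph when [e] is not symmetric and irreflexive. *)
Definition graph_of (e : rel T) : graph T :=
  insubd (Graph (simple_rel (e := fun _ _ => false) (fun _ _ => erefl) (fun _ => erefl)))
    [set d : T * T | e d.1 d.2].

Lemma adj_graph_of (e : rel T) : symmetric e -> irreflexive e ->
  adj (graph_of e) =2 e.
Proof.
move=> esym eirr x y; rewrite /adj /graph_of.
by rewrite (insubdK _ (simple_rel esym eirr)) inE.
Qed.

End GraphBasics.

Section Rotation.

Variable T : finType.
Implicit Types (G H : graph T) (d : T * T) (s : {perm T * T}).

Definition flip G d := if d \in arcs G then (d.2, d.1) else d.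

Lemma flip_arcs G d : (flip G d \in arcs G) = (d \in arcs G).
Proof.
rewrite /flip; case: ifP => // dG; rewrite -dG.
by case: d {dG} => x y; exact: (adjC G y x).
Qed.

Lemma flipK G : involutive (flip G).
Proof.
move=> d; rewrite {1}/flip flip_arcs /flip.
by case: ifP => dG; rewrite ?dG //=; case: d {dG}.
Qed.

Definition edge_perm G : {perm T * T} := perm (can_inj (flipK G)).

Lemma edge_permE G d : d \in arcs G -> edge_perm G d = (d.2, d.1).
Proof. by rewrite permE /flip => ->. Qed.

Lemma edge_perm_id G d : d \notin arcs G -> edge_perm G d = d.
Proof. by rewrite permE /flip => /negPf->. Qed.

(** A rotation system in normal form: the values on pairs that are not arcs, arbitrary in
    [rotation_system], are set to the identity. *)
Definition rotates s G :=
  (forall d, d \notin arcs G -> s d = d) /\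
  (forall d, d \in arcs G -> porbit s d = [set d' in arcs G | d'.1 == d.1]).

Section Counts.

Variables (G : graph T) (s : {perm T * T}).
Hypothesis rot : rotates s G.
Let e := edge_perm G.

Lemma rotates_arcs d : (s d \in arcs G) = (d \in arcs G).
Proof.
apply/idP/idP => dG.
  apply/negPn/negP=> ndG; move: ndG (ndG) => /rot.1 sd.
  by rewrite -{1}sd dG.
have := porbit_next s d; rewrite rot.2 // inE; by case/andP.
Qed.

Lemma rotates_source d : (s d).1 = d.1.
Proof.
case dG: (d \in arcs G); last by rewrite rot.1 ?dG.
by have := porbit_next s d; rewrite rot.2 // inE => /andP[_ /eqP].
Qed.

Lemma edge_perm_arcs d : (e d \in arcs G) = (d \in arcs G).
Proof. by rewrite permE flip_arcs. Qed.

Lemma joint_arcs d d' : joint s e d d' -> (d \in arcs G) = (d' \in arcs G).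
Proof.
apply: (connect_invariant (f := fun c => c \in arcs G)) => a b.
by case/orP=> /eqP<-; rewrite ?rotates_arcs ?edge_perm_arcs.
Qed.

Lemma joint_fixed d d' : d \notin arcs G -> joint s e d d' -> d' = d.
Proof.
move=> dG /connectP[p]; elim: p d dG => /= [d _ _ -> //|a p IH d dG].
case/andP=> da; suff {1 2}-> : a = d by apply: IH.
by case/orP: da => /eqP <-; [apply: rot.1 | apply: edge_perm_id].
Qed.

Lemma joint_adj d d' : d \in arcs G -> d' \in arcs G ->
  joint s e d d' = connect (adj G) d.1 d'.1.
Proof.
move=> dG d'G; apply/idP/idP.
  apply: (connect_homo (f := fst)) => a b /orP[]/eqP<-.
    by rewrite rotates_source connect0.
  case aG: (a \in arcs G); last by rewrite edge_perm_id ?aG ?connect0.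
  by rewrite edge_permE //; apply: connect1; case: a aG.
have same a b : a \in arcs G -> b \in arcs G -> a.1 = b.1 -> joint s e a b.
  by move=> aG bG ab; apply: joint_porbit_s; rewrite rot.2 // inE bG ab /=.
move=> /connectP[p]; elim: p d dG => /= [d dG _ d'd|y p IH d dG].
  by apply: same; rewrite // d'd.
case/andP=> dy pth last_p.
apply: joint_trans (same d (d.1, y) dG dy _) _ => //.
apply: joint_trans (joint_e s e _) _; rewrite /e edge_permE //=.
by apply: IH => //=; rewrite -[_ \in _]/(adj G y d.1) adjC.
Qed.

Lemma card_porbits_fixed (u : {perm T * T}) :
    (forall d, d \notin arcs G -> u d = d) ->
  #|porbits u| = #|porbit u @: arcs G| + #|~: arcs G|.
Proof.
move=> fixu; have uA d : (u d \in arcs G) = (d \in arcs G).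
  apply/idP/idP=> dA; apply/negPn/negP=> ndA.
    by rewrite fixu // (negPf ndA) in dA.
  by move: (fixu _ ndA) => /perm_inj ud; rewrite ud dA in ndA.
have inA d d' : d' \in porbit u d -> (d' \in arcs G) = (d \in arcs G).
  rewrite porbit_connect => /(connect_invariant (f := fun c => c \in arcs G)) ->//.
  by move=> a b /eqP<-.
have -> : porbits u = porbit u @: arcs G :|: porbit u @: ~: arcs G.
  rewrite -imsetU setUCr; apply/setP=> c.
  by apply/imsetP/imsetP=> -[d _ ->]; exists d.
rewrite cardsU -[RHS]subn0; congr (_ + _ - _).
  rewrite card_in_imset // => d d'; rewrite inE => dA _ /eqP.
  rewrite eq_porbit_mem porbit_sym => /porbitP[i ->].
  by elim: i => [|i IH]; rewrite ?perm1 // expgSr permM -IH fixu.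
apply/eqP; rewrite cards_eq0; apply/eqP/setP=> c; rewrite !inE.
apply/andP=> -[/imsetP[d dA ->] /imsetP[d' d'A dd']].
by move: d'A; rewrite inE (inA d) ?dA // dd' porbit_id.
Qed.

Lemma card_porbits_rotation : #|porbits s| = #|non_isolated G| + #|~: arcs G|.
Proof.
rewrite (card_porbits_fixed rot.1); congr (_ + _).
have -> : porbit s @: arcs G = (fun x => [set d in arcs G | d.1 == x]) @: non_isolated G.
  apply/setP=> c; apply/imsetP/imsetP=> -[x xG ->].
    exists x.1; last exact: rot.2.
    by rewrite inE; apply/existsP; exists x.2; case: x xG.
  have := xG; rewrite inE => /existsP[y xy]; exists (x, y) => //.
  by rewrite rot.2.
apply: card_in_imset => x y; rewrite !inE => /existsP[z xz] _ /setP/(_ (x, z)).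
by rewrite !inE /= eqxx [_ \in _]xz /= => /esym/eqP.
Qed.

Lemma card_porbits_edges :
  #|arcs G| = #|arcs G|./2.*2 /\ #|porbits e| = #|arcs G|./2 + #|~: arcs G|.
Proof.
rewrite (card_porbits_fixed (@edge_perm_id G)).
have porb d : d \in arcs G -> porbit e d = [set d; (d.2, d.1)].
  move=> dG; apply/setP=> d'; rewrite !inE; apply/idP/idP; last first.
    by case/orP=> /eqP ->; rewrite ?porbit_id // -(edge_permE dG) porbit_next.
  case/porbitP=> i ->; elim: i => [|i]; first by rewrite perm1 eqxx.
  case/orP=> /eqP h; rewrite expgSr permM h.
    by rewrite edge_permE // eqxx orbT.
  by rewrite -(edge_permE dG) !permE flipK eqxx.
have part : partition (porbit e @: arcs G) (arcs G).
  apply/and3P; split.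
  - apply/eqP/setP=> d; apply/bigcupP/idP.
      case=> _ /imsetP[d' d'G ->]; rewrite porb // !inE => /orP[]/eqP-> //.
      by rewrite -(edge_permE d'G) edge_perm_arcs.
    by move=> dG; exists (porbit e d); rewrite ?imset_f ?porbit_id.
  - apply/trivIsetP=> _ _ /imsetP[d _ ->] /imsetP[d' _ ->] dd'.
    rewrite -setI_eq0; apply: contraR dd' => /set0Pn[d0]; rewrite inE.
    by case/andP=> /porbit_eq <- /porbit_eq <-.
  apply/imsetP=> -[d _ /setP/(_ d)]; by rewrite inE porbit_id.
rewrite (card_uniform_partition (n := 2) _ part); first by rewrite muln2 doubleK.
move=> _ /imsetP[d dG ->]; rewrite porb // cards2; case: eqP => // dd.
by have := adj_irr G d.1; rewrite /adj {2}dd /=; case: d dG {dd} => x y /= -> .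
Qed.

Lemma card_porbits_faces (r : {perm T * T}) :
    (forall d, d \in arcs G -> r d = s d) ->
  #|porbits (e * s)| = #|faces G r| + #|~: arcs G|.
Proof.
move=> rs; rewrite (card_porbits_fixed (u := e * s)); last first.
  by move=> d dG; rewrite permM /e edge_perm_id // rot.1.
suff -> : porbit (e * s) @: arcs G = faces G r by [].
apply: eq_in_imset => d dG.
apply/setP=> d'; rewrite porbit_connect inE.
apply: (@connect_restrict _ _ _ (mem (arcs G))) => // a b aG.
  by rewrite /= permM /face_step -(edge_permE aG) rs // edge_perm_arcs.
by move=> /eqP <-; rewrite permM /= rotates_arcs edge_perm_arcs.
Qed.

Lemma joint_orbits_rotation :
  joint_orbits s e = n_comp (adj G) (non_isolated G) + #|~: arcs G|.
Proof.
rewrite /joint_orbits (n_compC (mem (arcs G))); congr (_ + _); last first.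
  apply: eq_card => d; rewrite !inE.
  case dG: (d \in arcs G); rewrite ?andbF ?andbT //.
  rewrite /roots /fingraph.root; case: pickP => [d'|] /=; last by rewrite eqxx.
  by move=> dd'; rewrite (joint_fixed (negbT dG) dd') eqxx.
(* [h] selects an arc leaving [x], and a pair that is never an arc when [x] is isolated. With the
   source map it forms an adjunction, which equates the components among arcs with those among
   vertices. *)
pose h x := if [pick y | adj G x y] is Some y then (x, y) else (x, x).
have hG x : (h x \in arcs G) = (x \in non_isolated G).
  rewrite inE /h; case: pickP => [y xy|none].
    by rewrite [LHS]xy; apply/esym/existsP; exists y.
  rewrite [LHS]adj_irr; apply/esym/existsP=> -[y]; by rewrite none.
have h1 x : (h x).1 = x by rewrite /h; case: pickP.
have cl : closed (joint_rel s e) (mem (arcs G)).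
  by move=> d d' dd'; apply: joint_arcs; apply: connect1.
rewrite (@adjunction_n_comp _ _ h _ _ (joint_sym s e) (@adj_sym T G) _ cl).
  by apply: eq_n_comp_r => x; rewrite !inE hG inE.
split=> [d dG|x y xG].
  exists d.1; rewrite -/(joint s e) joint_adj // ?h1 // hG inE.
  by apply/existsP; exists d.2; case: d dG.
have [yG|nyG] := boolP (h y \in arcs G).
  by rewrite -/(joint s e) joint_adj // !h1.
transitivity false; last first.
  by apply/esym; apply: contraNF nyG => /joint_arcs <-.
apply/negP=> xy; move: nyG; rewrite !hG => /negP[].
suff <- : (x \in non_isolated G) = (y \in non_isolated G) by rewrite -hG.
apply: (connect_invariant (f := fun c => c \in non_isolated G)) xy => a b ab.
rewrite !inE; apply/idP/idP=> _; apply/existsP; first by exists a; rewrite adjC.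
by exists b.
Qed.

(** The pairs that are not arcs cancel: they count three times in [euler], once in the size of
    [T * T] and twice through [joint_orbits]. Doubled edges make up the arcs. *)
Lemma euler_rotation (r : {perm T * T}) :
    (forall d, d \in arcs G -> r d = s d) ->
  (euler s e == #|{: T * T}| + 2 * joint_orbits s e) =
  (#|non_isolated G| + #|faces G r| ==
     #|arcs G|./2 + 2 * n_comp (adj G) (non_isolated G)).
Proof.
move=> rs; have [even edges] := card_porbits_edges.
rewrite /euler card_porbits_rotation edges.
rewrite (card_porbits_faces rs) joint_orbits_rotation -(cardsC (arcs G)).
move: even; move: #|arcs G| #|~: arcs G| #|non_isolated G| #|faces G r|.
move: (n_comp _ _) => c a n v f; rewrite -mul2n.
by move=> even; apply/eqP/eqP; lia.
Qed.

End Counts.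
End Rotation.

(** * Outerplanar graphs *)

Section Outerplanar.

Variable T : finType.
Implicit Types (G H : graph T) (d : T * T) (s r : {perm T * T}).

Lemma non_isolated_connect G x y : connect (adj G) x y ->
  (x \in non_isolated G) = (y \in non_isolated G).
Proof.
apply: (connect_invariant (f := fun c => c \in non_isolated G)) => a b ab.
rewrite !inE; apply/idP/idP=> _; apply/existsP; first by exists a; rewrite adjC.
by exists b.
Qed.

Lemma rotation_systemP G r : rotation_system G r ->
  exists2 s, rotates s G & forall d, d \in arcs G -> r d = s d.
Proof.
move=> /forall_inP rot; pose f d := if d \in arcs G then r d else d.
have rG d : d \in arcs G -> r d \in arcs G.
  move=> dG; have := porbit_next r d; rewrite (eqP (rot d dG)) inE.
  by case/andP.
have rNG d : r d \in arcs G -> d \in arcs G.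
  move=> rdG; have := porbit_id r d; rewrite -porbit_step (eqP (rot _ rdG)) inE.
  by case/andP.
have f_inj : injective f.
  move=> a b; rewrite /f; case: ifP => aG; case: ifP => bG //.
  - exact: perm_inj.
  - by move=> ab; rewrite -ab rG in bG.
  - by move=> ab; rewrite ab rG in aG.
pose s := perm f_inj; have rs d : d \in arcs G -> r d = s d.
  by move=> dG; rewrite permE /f dG.
exists s => //; split=> [d /negPf dG|d dG]; first by rewrite permE /f dG.
rewrite -(eqP (rot d dG)); apply/setP=> d'; rewrite !porbit_connect.
apply: (@connect_restrict _ _ _ (mem (arcs G))) => // a b aG /=.
  by rewrite -rs.
by move/eqP<-; rewrite -rs // rG.
Qed.

Lemma outerplanarP G :
  reflect (exists2 s, rotates s G & outer s (edge_perm G)) (outerplanar G).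
Proof.
apply: (iffP existsP) => [[r /andP[/andP[/rotation_systemP[s rot rs] eul]]]|[s rot [eul cov]]].
  move=> /forall_inP cov; exists s => //; split.
    by apply/eqP; rewrite (euler_rotation rot rs).
  move=> d0; have [d0G|d0G] := boolP (d0 \in arcs G); last first.
    by exists d0 => z /(joint_fixed rot d0G) ->; exists d0; rewrite porbit_id.
  have d0n : d0.1 \in non_isolated G.
    by rewrite inE; apply/existsP; exists d0.2; case: (d0) d0G.
  have /exists_inP[_ /imsetP[f fG ->] /forallP covF] := cov _ d0n.
  exists f => z d0z; have zG : z \in arcs G by rewrite -(joint_arcs rot d0z).
  move: d0z (covF z.1); rewrite (joint_adj rot) // => -> /exists_inP[w].
  rewrite inE => fw /eqP wz.
  have RE a b : a \in arcs G -> frel (face_step r) a b = frel (edge_perm G * s)%g a b.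
    by move=> aG /=; rewrite permM /face_step -(edge_permE aG) rs // edge_perm_arcs.
  have RC a b : a \in arcs G -> frel (face_step r) a b -> b \in arcs G.
    move=> aG; rewrite RE // => /eqP <-.
    by rewrite permM (rotates_arcs rot) edge_perm_arcs.
  have fw' : w \in porbit (edge_perm G * s) f.
    by rewrite porbit_connect -(connect_restrict RE RC).
  exists w => //; rewrite (rot.2 _ zG) inE wz eqxx andbT.
  by rewrite -(joint_arcs rot (joint_porbit_f fw')).
exists s; rewrite /planar_rotation -!andbA; apply/and3P; split.
- by apply/forall_inP=> d dG; rewrite rot.2.
- by rewrite -(euler_rotation rot) // eul.
apply/forall_inP=> x xG; have := xG; rewrite inE => /existsP[y xy].
have [f fP] := cov (x, y).
have RE a b : a \in arcs G -> frel (face_step s) a b = frel (edge_perm G * s)%g a b.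
  by move=> aG /=; rewrite permM /face_step -(edge_permE aG).
have RC a b : a \in arcs G -> frel (face_step s) a b -> b \in arcs G.
  move=> aG; rewrite RE // => /eqP <-.
  by rewrite permM (rotates_arcs rot) edge_perm_arcs.
have fG : f \in arcs G.
  have [w wxy wf] := fP _ (connect0 _ _).
  by rewrite (joint_arcs rot (joint_porbit_f wf)) -(joint_arcs rot (joint_porbit_s _ wxy)).
apply/exists_inP; exists [set d' | fconnect (face_step s) f d'].
  by apply/imsetP; exists f.
apply/forallP=> z; apply/implyP=> xz.
have := xG; rewrite (non_isolated_connect xz) inE => /existsP[z' zz'].
have [|w wz wf] := fP (z, z'); first by rewrite (joint_adj rot).
apply/exists_inP; exists w.
  by rewrite inE (connect_restrict RE RC) // -porbit_connect.
by move: wz; rewrite (rot.2 _ zz') inE => /andP[].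
Qed.

Lemma rotates_intro s G :
    (forall d, d \notin arcs G -> s d = d) ->
    (forall d, (s d).1 = d.1) ->
    (forall d d', d \in arcs G -> d' \in arcs G -> d.1 = d'.1 ->
       d' \in porbit s d) ->
  rotates s G.
Proof.
move=> fixs src full; split=> // d dG; apply/setP=> d'; rewrite inE.
apply/idP/andP=> [d'd|[d'G /eqP d'd]]; last exact: full.
have sG a : a \in arcs G -> s a \in arcs G.
  move=> aG; apply/negPn/negP=> /[dup] nG /fixs /perm_inj sa.
  by rewrite sa aG in nG.
move: d'd; rewrite porbit_connect => /connectP[p]; elim: p d dG => /= [d dG _ -> //|c p IH d dG].
by case/andP=> /eqP <- pth last_p; have [] := IH _ (sG _ dG) pth last_p; rewrite src.
Qed.

(* Induction on the darts of [A] that are not arcs, which are cut out of [s]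
   one at a time. *)
Lemma outer_restrict s G (A : {set T * T}) :
    arcs G \subset A ->
    (forall d, d \notin A -> s d = d) ->
    (forall d, (s d).1 = d.1) ->
    (forall d d', d \in A -> d' \in A -> d.1 = d'.1 -> d' \in porbit s d) ->
  outer s (edge_perm G) -> outerplanar G.
Proof.
have [n] := ubnP #|A :\: arcs G|; elim: n A s => // n IH A s le_n GA fixs src full out.
have [AG|/set0Pn[x]] := eqVneq (A :\: arcs G) set0.
  have AE : A = arcs G by apply/eqP; rewrite eqEsubset GA andbT -setD_eq0 AG.
  by apply/outerplanarP; exists s => //; apply: rotates_intro; rewrite -?AE.
rewrite inE => /andP[xG xA]; pose s' := (tperm (s^-1 x) x * s)%g.
have s'x : s' x = x by rewrite permM tpermR permKV.
apply: (IH (A :\ x) s').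
- move: le_n; rewrite (cardsD1 x) !inE xA xG /= add1n ltnS.
  apply: leq_trans; rewrite ltnS; apply/subset_leq_card/subsetP=> d.
  by rewrite !inE andbCA.
- apply/subsetP=> d dG; rewrite !inE (subsetP GA) // andbT.
  by apply: contra xG => /eqP<-.
- move=> d; rewrite !inE negb_and negbK => /orP[/eqP-> //|dA].
  have px : (s^-1)%g x != d.
    apply/eqP=> dE; move: (fixs _ dA); rewrite -{1}dE permKV => xd.
    by rewrite -xd xA in dA.
  by rewrite permM tpermD ?fixs //; apply: contraNneq dA => <-.
- move=> d; rewrite permM src; case: tpermP => [->|->|//].
    by rewrite -[RHS]src permKV.
  by rewrite -[LHS]src permKV.
- move=> d d'; rewrite !inE => /andP[dx dA] /andP[d'x d'A] dd'.
  have := porbit_skip x (full d d' dA d'A dd').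
  by rewrite (negPf dx) (negPf d'x) -/s' => ->; rewrite porbit_id.
- exact: outer_dangling (edge_perm_id xG) (erefl s') out.
Qed.

Lemma edge_perm_remove G H x y : adj G x y ->
    (forall a b, adj H a b = adj G a b && ((a, b) != (x, y)) && ((a, b) != (y, x))) ->
  edge_perm H = (tperm (x, y) (y, x) * edge_perm G)%g.
Proof.
move=> xy HG; apply/permP=> -[a b]; rewrite permM.
have yx : adj G y x by rewrite adjC.
case: tpermP => [->|->|/eqP nxy /eqP nyx].
- by rewrite (@edge_permE _ G (y, x)) // edge_perm_id // -[_ \in _]/(adj H x y) HG eqxx andbF.
- by rewrite (@edge_permE _ G (x, y)) // edge_perm_id // -[_ \in _]/(adj H y x) HG eqxx andbF.
have HGab : ((a, b) \in arcs H) = ((a, b) \in arcs G).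
  by rewrite -[LHS]/(adj H a b) HG nxy nyx !andbT.
case abG: ((a, b) \in arcs G); first by rewrite !edge_permE ?HGab.
by rewrite !edge_perm_id ?HGab ?abG.
Qed.

(** Two stages. The missing edges are deleted from the flip one by one while [s] stays the same,
    which leaves their arcs behind as dangling darts; [outer_restrict] then removes those darts from
    [s]. *)
Lemma outerplanar_sub G H : arcs H \subset arcs G ->
  outerplanar G -> outerplanar H.
Proof.
move=> HG /outerplanarP[s rot out].
suff : outer s (edge_perm H).
  apply: (outer_restrict HG rot.1); first exact: rotates_source rot.
  by move=> d d' dG d'G dd'; rewrite rot.2 // inE d'G dd' /=.
have [n] := ubnP #|arcs G :\: arcs H|; elim: n G HG out {rot} => // n IH G HG out le_n.
have [GH|/set0Pn[[x y]]] := eqVneq (arcs G :\: arcs H) set0.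
  suff -> : H = G by [].
  by apply/val_inj/eqP; rewrite eqEsubset HG -setD_eq0 GH eqxx.
rewrite inE => /andP[xyH xyG].
pose e a b := adj G a b && ((a, b) != (x, y)) && ((a, b) != (y, x)).
have esym : symmetric e.
  move=> a b; rewrite /e (adjC G a b) -!andbA; congr (_ && _).
  by rewrite andbC !xpair_eqE ![(a == _) && _]andbC.
have eirr : irreflexive e by move=> a; rewrite /e adj_irr.
pose G' := graph_of e; have G'E := adj_graph_of esym eirr.
apply: (IH G').
- apply/subsetP=> -[a b] abH; rewrite -[_ \in _]/(adj G' a b) G'E /e.
  rewrite -[adj G a b]/((a, b) \in arcs G) (subsetP HG) //=.
  apply/andP; split; apply: contra xyH => /eqP[<- <-] //.
  by rewrite -[_ \in _]/(adj H b a) adjC.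
- have xy : (x, y) != (y, x).
    apply/eqP=> -[xy _]; have := adj_irr G x; by rewrite {2}xy [adj G x y]xyG.
  apply: (outer_delete xy _ _ out); last exact: edge_perm_remove.
  by rewrite -(@edge_permE _ G (x, y)) // porbit_next.
move: le_n; rewrite (cardsD1 (x, y)) inE xyH xyG /= add1n ltnS; apply: leq_trans.
rewrite ltnS; apply/subset_leq_card/subsetP=> -[a b]; rewrite !inE => /andP[->].
by rewrite -[_ \in arcs G']/(adj G' a b) G'E => /andP[/andP[abG ->] _].
Qed.

(** The product [s1 * s2] describes a disjoint union in which [v] occurs as two vertices;
    [outer_glue] then merges the two rotations at [v]. *)
Lemma outerplanar_glue G G1 G2 v :
    (forall a b, adj G a b = adj G1 a b || adj G2 a b) ->
    (forall a, a \in non_isolated G1 -> a \in non_isolated G2 -> a = v) ->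
  outerplanar G1 -> outerplanar G2 -> outerplanar G.
Proof.
move=> GE share /outerplanarP[s1 rot1 out1] /outerplanarP[s2 rot2 out2].
have disj d : d \in arcs G1 -> d \notin arcs G2.
  case: d => a b ab1; apply/negP=> ab2.
  have av : a = v by apply: share; rewrite inE; apply/existsP; exists b.
  have bv : b = v by apply: share; rewrite inE; apply/existsP; exists a; rewrite adjC.
  by have := adj_irr G1 a; rewrite {2}av -bv [adj _ _ _]ab1.
have GA d : (d \in arcs G) = (d \in arcs G1) || (d \in arcs G2).
  by case: d => a b; apply: GE.
have eE : edge_perm G = (edge_perm G1 * edge_perm G2)%g.
  apply/permP=> d; rewrite permM; case d1: (d \in arcs G1).
    rewrite (edge_permE d1) edge_permE ?GA ?d1 // edge_perm_id //.
    by apply: disj; rewrite -(edge_permE d1) edge_perm_arcs.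
  rewrite (edge_perm_id (negbT d1)); case d2: (d \in arcs G2).
    by rewrite !edge_permE ?GA ?d1 ?d2.
  by rewrite !edge_perm_id ?GA ?d1 ?d2.
have out : outer (s1 * s2) (edge_perm G).
  rewrite eE; apply: (outer_mul (A := arcs G1)) => // d dG.
    by rewrite rot1.1 // edge_perm_id.
  by rewrite rot2.1 ?disj // edge_perm_id ?disj.
have s1E d : d \in arcs G1 -> (s1 * s2)%g d = s1 d.
  by move=> dG; rewrite permM rot2.1 // disj // (rotates_arcs rot1).
have s2E d : d \notin arcs G1 -> (s1 * s2)%g d = s2 d.
  by move=> dG; rewrite permM rot1.1.
have fixs d : d \notin arcs G -> (s1 * s2)%g d = d.
  by rewrite GA negb_or => /andP[d1 d2]; rewrite s2E // rot2.1.
have src d : ((s1 * s2)%g d).1 = d.1.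
  by rewrite permM (rotates_source rot2) (rotates_source rot1).
have porb1 d d' : d \in arcs G1 -> d' \in porbit s1 d -> d' \in porbit (s1 * s2) d.
  move=> dG; rewrite !porbit_connect.
  rewrite -(@connect_restrict _ (frel (s1 * s2)%g) _ (mem (arcs G1))) //.
    by move=> a b aG /=; rewrite s1E.
  by move=> a b aG /= /eqP <-; rewrite s1E // (rotates_arcs rot1).
have porb2 d d' : d \in arcs G2 -> d' \in porbit s2 d -> d' \in porbit (s1 * s2) d.
  move=> dG; rewrite !porbit_connect.
  have n1 a : a \in arcs G2 -> a \notin arcs G1 by apply: contraL; apply: disj.
  rewrite -(@connect_restrict _ (frel (s1 * s2)%g) _ (mem (arcs G2))) //.
    by move=> a b aG /=; rewrite s2E // n1.
  by move=> a b aG /= /eqP <-; rewrite s2E ?n1 // (rotates_arcs rot2).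
have same1 d d' : d \in arcs G1 -> d' \in arcs G1 -> d.1 = d'.1 -> d' \in porbit (s1 * s2) d.
  by move=> dG d'G dd'; apply: porb1; rewrite // rot1.2 // inE d'G dd' /=.
have same2 d d' : d \in arcs G2 -> d' \in arcs G2 -> d.1 = d'.1 -> d' \in porbit (s1 * s2) d.
  by move=> dG d'G dd'; apply: porb2; rewrite // rot2.2 // inE d'G dd' /=.
have src_share d d' : d \in arcs G1 -> d' \in arcs G2 -> d.1 = d'.1 -> d.1 = v.
  case: d d' => a b [a' c] /= ab ac aa'; apply: share; rewrite inE; apply/existsP.
    by exists b.
  by exists c; rewrite aa'.
(* Pairs of arcs leaving [v], one in each graph. If there is none, [s1 * s2] already turns around
   every vertex and no merging takes place. *)
pose sep := [pred p : (T * T) * (T * T) | [&& p.1 \in arcs G1, p.2 \in arcs G2, p.1.1 == v & p.2.1 == v]].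
case: (pickP sep) => [[x y] /and4P[/= xG yG /eqP xv /eqP yv]|none]; last first.
  apply/outerplanarP; exists (s1 * s2)%g => //; apply: rotates_intro => // d d'.
  rewrite !GA => /orP[d1|d2] /orP[d'1|d'2] dd'; first exact: same1.
  - have dv := src_share d d' d1 d'2 dd'.
    by have := none (d, d'); rewrite /= d1 d'2 -dd' dv eqxx.
  - have dv := src_share d' d d'1 d2 (esym dd').
    by have := none (d', d); rewrite /= d'1 d2 dd' dv eqxx.
  exact: same2.
have nxy : ~~ joint (s1 * s2) (edge_perm G) x y.
  apply/negP=> /(connect_invariant (f := fun c => c \in arcs G1)) h.
  suff : x \in arcs G1 = (y \in arcs G1).
    by rewrite xG => /esym /disj; rewrite yG.
  apply: h => a b /orP[]/eqP <-.
    case a1: (a \in arcs G1); first by rewrite s1E // (rotates_arcs rot1).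
    rewrite s2E ?a1 //; apply/esym/negP.
    case a2: (a \in arcs G2); first by move/disj; rewrite (rotates_arcs rot2) a2.
    by rewrite rot2.1 ?a2 // a1.
  rewrite eE permM; case a1: (a \in arcs G1).
    have e1 : edge_perm G1 a \in arcs G1 by rewrite edge_perm_arcs.
    by rewrite [edge_perm G2 _]edge_perm_id ?disj.
  rewrite (edge_perm_id (negbT a1)); apply/esym/negP.
  case a2: (a \in arcs G2); first by move/disj; rewrite edge_perm_arcs a2.
  by rewrite edge_perm_id ?a2 // a1.
have [x1 [y1 [x1x y1y xy1 out']]] := outer_glue out nxy.
have srcP d d' : d' \in porbit (s1 * s2) d -> d'.1 = d.1.
  by rewrite porbit_connect => /(connect_invariant (f := fst)) <- // a b /eqP<-.
have x1v : x1.1 = v by rewrite (srcP _ _ x1x).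
have y1v : y1.1 = v by rewrite (srcP _ _ y1y).
have arcsP d d' : d' \in porbit (s1 * s2) d -> d \in arcs G -> d' \in arcs G.
  rewrite porbit_connect => /connectP[p]; elim: p d => /= [d _ -> //|c p IH d].
  case/andP=> /eqP<- pth l dG; apply: IH pth l _.
  apply/negPn/negP=> /[dup] nG /fixs /perm_inj sd; by rewrite sd dG in nG.
have x1y1 : x1 \in porbit (tperm x1 y1 * (s1 * s2)) y1.
  rewrite porbit_split //; apply: contra nxy => h.
  rewrite jointC; apply: joint_porbit_s.
  by rewrite -(porbit_eq y1y) -(porbit_eq h) porbit_sym.
apply/outerplanarP; exists (tperm x1 y1 * (s1 * s2))%g => //.
apply: rotates_intro => [d dG|d|d d'].
- rewrite permM tpermD ?fixs //; apply: contraNneq dG => <-.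
    by apply: arcsP x1x _; rewrite GA xG.
  by apply: arcsP y1y _; rewrite GA yG orbT.
- by rewrite permM src; case: tpermP => [->|->|]; rewrite ?x1v ?y1v.
have merge d1 d2 : d2 \in porbit (s1 * s2) d1 ->
    d2 \in porbit (tperm x1 y1 * (s1 * s2)) d1 by apply: porbit_merge.
have cross d1 d2 : d1 \in arcs G1 -> d2 \in arcs G2 -> d1.1 = d2.1 ->
    porbit (tperm x1 y1 * (s1 * s2)) d1 = porbit (tperm x1 y1 * (s1 * s2)) d2.
  move=> d1G d2G d12; have d1v := src_share _ _ d1G d2G d12.
  have h1 : x \in porbit (s1 * s2) d1 by apply: same1; rewrite // d1v xv.
  have h2 : y \in porbit (s1 * s2) d2 by apply: same2; rewrite // -d12 d1v yv.
  rewrite -(porbit_eq (merge _ _ h1)) -(porbit_eq (merge _ _ h2)).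
  by rewrite -(porbit_eq (merge _ _ x1x)) -(porbit_eq (merge _ _ y1y)) (porbit_eq x1y1).
rewrite !GA => /orP[d1|d2] /orP[d'1|d'2] dd'.
- exact/merge/same1.
- by rewrite (cross d d') // porbit_id.
- by rewrite -(cross d' d) // porbit_id.
- exact/merge/same2.
Qed.

(** All degrees are at most one, so the identity is a rotation system. *)
Lemma outerplanar_matching G :
  (forall x y z, adj G x y -> adj G x z -> y = z) -> outerplanar G.
Proof.
move=> matching; apply/outerplanarP; exists 1%g; last exact: outer1.
apply: rotates_intro => [d|d|[x y] [x' z]]; rewrite ?perm1 //.
move=> xy xz /= xx'; rewrite -xx' in xz *.
by rewrite (matching x y z) // porbit_id.
Qed.

Definition graph_union G1 G2 : graph T := graph_of [rel x y | adj G1 x y || adj G2 x y].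

Lemma adj_union G1 G2 x y : adj (graph_union G1 G2) x y = adj G1 x y || adj G2 x y.
Proof.
rewrite adj_graph_of // => [u v|u] /=; last by rewrite !adj_irr.
by rewrite !(adjC _ u).
Qed.

(** The pieces are pairwise disjoint, so the piece [F i] meets whatever has been assembled before it
    in [v i] at most, and [outerplanar_glue] adds one piece at a time. *)
Lemma outerplanar_glue_family (I : finType) G G0 (F : I -> graph T) (v : I -> T) :
    (forall x y, adj G x y = adj G0 x y || [exists i, adj (F i) x y]) ->
    (forall i x, x \in non_isolated G0 -> x \in non_isolated (F i) -> x = v i) ->
    (forall i j x, x \in non_isolated (F i) -> x \in non_isolated (F j) -> i = j) ->
  outerplanar G0 -> (forall i, outerplanar (F i)) -> outerplanar G.
Proof.
move=> GE share disj out0 outF.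
pose e (X : {set I}) := [rel x y | adj G0 x y || [exists i in X, adj (F i) x y]].
have eE X : adj (graph_of (e X)) =2 e X.
  apply: adj_graph_of => [x y|x] /=.
    rewrite adjC; congr (_ || _); apply: eq_existsb => i; by rewrite adjC.
  by rewrite adj_irr; apply/exists_inP=> -[i _]; rewrite adj_irr.
have -> : G = graph_of (e setT).
  apply: graphP => x y; rewrite eE GE /=; congr (_ || _).
  by apply: eq_existsb => i; rewrite inE.
have [n] := ubnP #|[set: I]|; elim: n [set: I] => // n IH X le_n.
have [->|[i iX]] := set_0Vmem X.
  suff -> : graph_of (e set0) = G0 by [].
  apply: graphP => x y; rewrite eE /= orb_idr // => /exists_inP[i]; by rewrite inE.
have outX : outerplanar (graph_of (e (X :\ i))).
  by apply: IH; move: le_n; rewrite (cardsD1 i) iX.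
apply: (outerplanar_glue (v := v i) _ _ outX (outF i)).
  move=> x y; rewrite !eE /= -orbA; congr (_ || _).
  apply/exists_inP/orP=> [[j jX xy]|[/exists_inP[j]|xy]]; last by exists i.
    have [<-|ji] := eqVneq j i; first by right.
    by left; apply/exists_inP; exists j; rewrite // !inE ji.
  by rewrite !inE => /andP[_ jX] xy; exists j.
move=> x; rewrite inE => /existsP[y]; rewrite eE /= => /orP[xy|].
  by apply: share; rewrite inE; apply/existsP; exists y.
case/exists_inP=> j; rewrite in_setD1 => /andP[ji _] xy xFi.
by case/eqP: ji; apply: (disj j i x) => //; rewrite inE; apply/existsP; exists y.
Qed.

End Outerplanar.

(** * Transport of permutations along an injection *)

Section Transport.

Variables (S T : finType) (f : S -> T).
Implicit Types (s : {perm S}) (t : {perm T}).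

(** Defined for every [f], with the identity as junk value, because it is applied to maps that are
    summation variables and are injective only on the terms of interest. *)
Definition push_perm s : {perm T} :=
  odflt 1%g [pick t : {perm T} | [forall a, t (f a) == f (s a)] &&
                      [forall y, (y \notin codom f) ==> (t y == y)]].

Definition pull_perm t : {perm S} :=
  odflt 1%g [pick s : {perm S} | [forall a, t (f a) == f (s a)]].

Hypothesis f_inj : injective f.

Lemma push_permP s :
  (forall a, push_perm s (f a) = f (s a)) /\
  (forall y, y \notin codom f -> push_perm s y = y).
Proof.
rewrite /push_perm; case: pickP => [t /andP[/forallP h1 /forallP h2]|none] /=.
  by split=> [a|y yf]; apply/eqP; [apply: h1 | apply: implyP (h2 y) yf].
pose g y := if [pick a | f a == y] is Some a then f (s a) else y.
have gf a : g (f a) = f (s a).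
  by rewrite /g; case: pickP => [b /eqP/f_inj->|/(_ a)]; rewrite ?eqxx.
have gN y : y \notin codom f -> g y = y.
  by rewrite /g; case: pickP => // a /eqP<-; rewrite codom_f.
have g_inj : injective g.
  move=> x y; have [/codomP[a ->]|xf] := boolP (x \in codom f);
    have [/codomP[b ->]|yf] := boolP (y \in codom f); rewrite ?gf ?gN //.
  - by move/f_inj/perm_inj->.
  - by move=> h; rewrite -h codom_f in yf.
  - by move=> h; rewrite h codom_f in xf.
have /andP[] := none (perm g_inj); split.
  by apply/forallP=> a; rewrite permE gf.
by apply/forallP=> y; apply/implyP=> yf; rewrite permE gN.
Qed.

Lemma push_permE s a : push_perm s (f a) = f (s a).
Proof. exact: (push_permP s).1. Qed.

Lemma push_perm_out s y : y \notin codom f -> push_perm s y = y.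
Proof. exact: (push_permP s).2. Qed.

Lemma pull_permE t : (forall a, t (f a) \in codom f) ->
  forall a, f (pull_perm t a) = t (f a).
Proof.
move=> tf a; rewrite /pull_perm; case: pickP => [s /forallP/(_ a)/eqP|none] //=.
pose g a := iinv (tf a).
have gE b : f (g b) = t (f b) by rewrite /g f_iinv.
have g_inj : injective g.
  by move=> b c bc; apply/f_inj/(@perm_inj _ t); rewrite -!gE bc.
by have /negP[] := none (perm g_inj); apply/forallP=> b; rewrite permE gE.
Qed.

Lemma connect_push (R : rel S) (R' : rel T) :
    (forall a b, R' (f a) (f b) = R a b) ->
    (forall a y, R' (f a) y -> y \in codom f) ->
  forall a b, connect R' (f a) (f b) = connect R a b.
Proof.
move=> RR' R'f a b; apply/idP/idP; last first.
  by apply: connect_homo => {}a {}b ab; apply: connect1; rewrite RR'.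
case/connectP=> p; elim: p a => /= [a _ /f_inj->|y p IH a]; first exact: connect0.
case/andP=> /[dup] ay /R'f/codomP[c yE]; rewrite yE in ay *.
move=> pth last_p; apply: connect_trans (IH c pth last_p).
by apply: connect1; rewrite -RR'.
Qed.

(** Each point off the image of [f] is a component by itself; the sizes stand on opposite sides to
    avoid a subtraction. *)
Lemma n_comp_push (R : rel S) (R' : rel T) :
    connect_sym R -> connect_sym R' ->
    (forall a b, R' (f a) (f b) = R a b) ->
    (forall a y, R' (f a) y -> y \in codom f) ->
    (forall x y, x \notin codom f -> R' x y -> y = x) ->
  n_comp R' T + #|S| = n_comp R S + #|T|.
Proof.
move=> symR symR' RR' R'f R'N.
have cl : closed R' (mem (codom f)).
  apply: intro_closed => // x y xy /codomP[a xE]; apply: (R'f a); by rewrite -xE.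
have -> : n_comp R S = n_comp R' (mem (codom f)).
  rewrite (@adjunction_n_comp _ _ f _ _ symR' symR _ cl).
    by apply: eq_n_comp_r => a; rewrite !inE codom_f.
  exact: strict_adjunction.
rewrite (n_compC (mem (codom f))) -(card_codom f_inj) -addnA.
congr (_ + _); rewrite addnC -(cardC (mem (codom f))); congr (_ + _).
apply: eq_card => y; rewrite !inE; case yf: (y \in codom f); rewrite ?andbF ?andbT //.
rewrite /roots /fingraph.root; case: pickP => [y'|] /=; last by rewrite eqxx.
case/connectP=> p; elim: p y yf => /= [y _ _ ->|z p IH y yf /andP[yz]]; first exact: eqxx.
by have -> := R'N _ _ (negbT yf) yz; apply: IH.
Qed.

Lemma porbit_push (s : {perm S}) (t : {perm T}) :
  (forall a, t (f a) = f (s a)) -> forall a b, (f b \in porbit t (f a)) = (b \in porbit s a).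
Proof.
move=> tf a b; rewrite !porbit_connect; apply: connect_push => [c d|c y] /=.
  by rewrite tf (inj_eq f_inj).
by rewrite tf => /eqP <-; rewrite codom_f.
Qed.

Lemma outer_push (s e : {perm S}) (s' e' : {perm T}) :
    (forall a, s' (f a) = f (s a)) -> (forall a, e' (f a) = f (e a)) ->
    (forall y, y \notin codom f -> s' y = y) ->
    (forall y, y \notin codom f -> e' y = y) ->
  outer s e <-> outer s' e'.
Proof.
move=> sE eE sN eN.
have porbits_push (u : {perm S}) (u' : {perm T}) :
    (forall a, u' (f a) = f (u a)) -> (forall y, y \notin codom f -> u' y = y) ->
    #|porbits u'| + #|S| = #|porbits u| + #|T|.
  move=> uE uN; rewrite !porbits_n_comp; apply: n_comp_push.
  - by move=> x y; apply/fconnect_sym/perm_inj.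
  - by move=> x y; apply/fconnect_sym/perm_inj.
  - by move=> a b /=; rewrite uE (inj_eq f_inj).
  - by move=> a y /=; rewrite uE => /eqP<-; rewrite codom_f.
  - by move=> x y xf /eqP<-; rewrite uN.
have fE a : (e' * s')%g (f a) = f ((e * s)%g a) by rewrite !permM eE sE.
have fN y : y \notin codom f -> (e' * s')%g y = y.
  by move=> yf; rewrite permM eN // sN.
have RE a b : joint_rel s' e' (f a) (f b) = joint_rel s e a b.
  by rewrite /joint_rel /= sE eE !(inj_eq f_inj).
have RC a y : joint_rel s' e' (f a) y -> y \in codom f.
  by case/orP=> /eqP<-; rewrite ?sE ?eE codom_f.
have RN x y : x \notin codom f -> joint_rel s' e' x y -> y = x.
  by move=> xf /orP[]/eqP<-; rewrite ?sN ?eN.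
have cE : joint_orbits s' e' + #|S| = joint_orbits s e + #|T|.
  by apply: n_comp_push; try exact: joint_sym.
have jE a b : joint s' e' (f a) (f b) = joint s e a b by apply: connect_push.
have jN x y : x \notin codom f -> joint s' e' x y -> y = x.
  move=> xf /connectP[p]; elim: p x xf => /= [x _ _ -> //|z p IH x xf /andP[xz]].
  by have -> := RN _ _ xf xz; apply: IH.
have jC a y : joint s' e' (f a) y -> exists b, y = f b.
  move=> ay; have [/codomP[b ->]|yf] := boolP (y \in codom f); first by exists b.
  by rewrite jointC in ay; move: (yf); rewrite -(jN _ _ yf ay) codom_f.
have eulE : euler s' e' + 3 * #|S| = euler s e + 3 * #|T|.
  have := porbits_push _ _ sE sN; have := porbits_push _ _ eE eN.
  have := porbits_push _ _ fE fN; rewrite /euler; lia.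
split=> -[eul cov]; split.
- move: eul eulE cE; move: (euler _ _) (euler _ _) (joint_orbits _ _) (joint_orbits _ _) #|S| #|T|.
  by clear; lia.
- move=> x; have [/codomP[a ->]|xf] := boolP (x \in codom f); last first.
    by exists x => z /(jN _ _ xf)->; exists x; rewrite porbit_id.
  have [c cP] := cov a; exists (f c) => z /[dup] /jC[b ->]; rewrite jE => /cP[w wb wc].
  by exists (f w); rewrite (porbit_push sE, porbit_push fE).
- move: eul eulE cE; move: (euler _ _) (euler _ _) (joint_orbits _ _) (joint_orbits _ _) #|S| #|T|.
  by clear; lia.
move=> a; have [y yP] := cov (f a).
have [w0 w0a w0y] := yP _ (connect0 _ _).
have /jC[c w0E] := joint_porbit_s e' w0a.
exists c => b; rewrite -jE => /yP[w wb wy].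
have /jC[d wE] := joint_porbit_s e' wb.
exists d; first by rewrite -(porbit_push sE) -wE.
by rewrite -(porbit_push fE) -wE -w0E (porbit_eq w0y).
Qed.

End Transport.

(** * Transport of graphs along an injection *)

Section GraphTransport.

Variables (S T : finType) (f : S -> T).
Implicit Types (G : graph S) (H : graph T).

Definition push_graph G : graph T :=
  graph_of [rel x y | [exists a, exists b, [&& f a == x, f b == y & adj G a b]]].

Definition pull_graph H : graph S := graph_of [rel a b | adj H (f a) (f b)].

Lemma adj_pull H a b : adj (pull_graph H) a b = adj H (f a) (f b).
Proof.
by rewrite adj_graph_of // => [c d|c] /=; rewrite ?adj_irr // adjC.
Qed.

Hypothesis f_inj : injective f.

Lemma adj_pushP G x y :
  reflect (exists a b, [/\ f a = x, f b = y & adj G a b]) (adj (push_graph G) x y).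
Proof.
rewrite adj_graph_of => [|{}x {}y|{}x] /=.
- apply: (iffP existsP) => [[a /existsP[b /and3P[/eqP ? /eqP ? ab]]]|[a [b [<- <- ab]]]].
    by exists a, b.
  by exists a; apply/existsP; exists b; rewrite !eqxx.
- apply/existsP/existsP=> -[a /existsP[b /and3P[ax bY ab]]].
    by exists b; apply/existsP; exists a; rewrite ax bY adjC.
  by exists b; apply/existsP; exists a; rewrite ax bY adjC.
apply/existsP=> -[a /existsP[b /and3P[/eqP <- /eqP/f_inj-> ab]]].
by rewrite adj_irr in ab.
Qed.

Lemma adj_push G a b : adj (push_graph G) (f a) (f b) = adj G a b.
Proof.
apply/adj_pushP/idP=> [[a' [b' [/f_inj-> /f_inj-> //]]]|ab].
by exists a, b.
Qed.

Lemma adj_push_codom G x y : adj (push_graph G) x y -> (x \in codom f) && (y \in codom f).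
Proof. by case/adj_pushP=> a [b [<- <- _]]; rewrite !codom_f. Qed.

Lemma pull_pushG G : pull_graph (push_graph G) = G.
Proof. by apply: graphP => a b; rewrite adj_pull adj_push. Qed.

(** Vertices off the image are isolated and carry no arc, so rotation systems do not see them. *)
Lemma outerplanar_push G : outerplanar (push_graph G) = outerplanar G.
Proof.
pose g (d : S * S) := (f d.1, f d.2).
have g_inj : injective g by move=> [a b] [c d] [/f_inj-> /f_inj->].
have gG d : (g d \in arcs (push_graph G)) = (d \in arcs G).
  by case: d => a b; apply: adj_push.
have arc_codom d : d \in arcs (push_graph G) -> d \in codom g.
  case: d => x y xy; have := @adj_push_codom G x y xy.
  by case/andP=> /codomP[a ->] /codomP[b ->]; apply: (codom_f g (a, b)).
have eE d : edge_perm (push_graph G) (g d) = g (edge_perm G d).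
  by case dG: (d \in arcs G); [rewrite !edge_permE ?gG | rewrite !edge_perm_id ?gG ?dG].
have eN y : y \notin codom g -> edge_perm (push_graph G) y = y.
  by move=> yg; rewrite edge_perm_id //; apply: contra yg; apply: arc_codom.
apply/outerplanarP/outerplanarP=> -[s rot out].
  have sN y : y \notin codom g -> s y = y.
    by move=> yg; apply: rot.1; apply: contra yg; apply: arc_codom.
  have sg d : s (g d) \in codom g.
    case dG: (d \in arcs G); last by rewrite rot.1 ?codom_f // gG dG.
    by apply: arc_codom; rewrite (rotates_arcs rot) gG.
  have sE d := esym (pull_permE g_inj sg d).
  exists (pull_perm g s); last by apply/(outer_push g_inj sE eE sN eN).
  apply: rotates_intro => [d dG|d|d d' dG d'G dd'].
  - by apply: g_inj; rewrite -sE rot.1 // gG.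
  - by apply: f_inj; have := rotates_source rot (g d); rewrite sE.
  - by rewrite -(porbit_push g_inj sE) rot.2 ?gG // inE gG d'G /= dd'.
have sE := push_permE g_inj s; have sN := push_perm_out g_inj s.
exists (push_perm g s); last by apply/(outer_push g_inj sE eE sN eN).
apply: rotates_intro => [d dG|d|d d' dG d'G dd'].
- have [/codomP[c dE]|dg] := boolP (d \in codom g); last exact: sN.
  by rewrite dE sE rot.1 // -gG -dE.
- have [/codomP[c dE]|dg] := boolP (d \in codom g); last by rewrite sN.
  by rewrite dE sE /= (rotates_source rot).
have /codomP[c dE] := arc_codom _ dG; have /codomP[c' d'E] := arc_codom _ d'G.
move: dG d'G dd'; rewrite dE d'E !gG => cG c'G /f_inj cc'.
by rewrite (porbit_push g_inj sE) rot.2 // inE c'G /= cc'.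
Qed.

End GraphTransport.

(** * Blocks *)

Section Blocks.

Variable T : finType.
Implicit Types (G H : graph T) (B C : {set T}).

Definition inside G B : graph T :=
  graph_of [rel x y | [&& adj G x y, x \in B & y \in B]].

Definition outside G B : graph T :=
  graph_of [rel x y | adj G x y && ~~ ((x \in B) && (y \in B))].

Lemma adj_inside G B x y : adj (inside G B) x y = [&& adj G x y, x \in B & y \in B].
Proof.
rewrite adj_graph_of // => [a b|a] /=; last by rewrite adj_irr.
by rewrite adjC [(a \in B) && _]andbC.
Qed.

Lemma adj_outside G B x y :
  adj (outside G B) x y = adj G x y && ~~ ((x \in B) && (y \in B)).
Proof.
rewrite adj_graph_of // => [a b|a] /=; last by rewrite adj_irr.
by rewrite adjC [(a \in B) && _]andbC.
Qed.

(** This stands in for the maximality in the usual definition of a block: once the edges inside [B]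
    are removed, every branch hangs from at most one vertex of [B]. It is what makes the projection
    onto [B] well defined. *)
Definition separated G B :=
  [forall x in B, forall y in B, connect (adj (outside G B)) x y ==> (x == y)].

Definition nonseparable G B :=
  [&& 1 < #|B|, [forall x in B, forall y in B, connect (adj (inside G B)) x y]
    & [forall v, forall x in B, forall y in B, (x != v) ==> (y != v) ==>
         connect [rel a b | [&& adj (inside G B) a b, a != v & b != v]] x y]].

Definition block G B := nonseparable G B && separated G B.

Lemma separatedP G B :
  reflect {in B &, forall x y, connect (adj (outside G B)) x y -> x = y}
          (separated G B).
Proof.
apply: (iffP forall_inP) => [h x y xB yB xy|h x xB].
  by have /forall_inP/(_ _ yB)/implyP/(_ xy)/eqP := h x xB.
by apply/forall_inP=> y yB; apply/implyP=> xy; apply/eqP/h.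
Qed.

Lemma nonseparableP G B :
  reflect [/\ 1 < #|B|, {in B &, forall x y, connect (adj (inside G B)) x y}
            & forall v, {in B &, forall x y, x != v -> y != v ->
                connect [rel a b | [&& adj (inside G B) a b, a != v & b != v]] x y}]
          (nonseparable G B).
Proof.
apply: (iffP and3P) => -[h1 h2 h3]; split=> //.
- by move=> x y xB yB; have /forall_inP/(_ x xB)/forall_inP/(_ y yB) := h2.
- move=> v x y xB yB xv yv; move/forallP/(_ v)/forall_inP/(_ x xB): h3.
  by move/forall_inP/(_ y yB); rewrite xv yv.
- by apply/forall_inP=> x xB; apply/forall_inP=> y yB; apply: h2.
apply/forallP=> v; apply/forall_inP=> x xB; apply/forall_inP=> y yB.
by apply/implyP=> xv; apply/implyP=> yv; apply: h3.
Qed.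

(** The vertex of [B] from which the branch of [x] hangs. In a connected graph, with [B] nonempty,
    the default value is never taken. *)
Definition proj G B x :=
  odflt x [pick y in B | connect (adj (outside G B)) x y].

Section Connected.

Variable G : graph T.
Hypothesis connG : forall x y, connect (adj G) x y.

Section Projection.

Variable B : {set T}.
Hypotheses (sepB : separated G B) (B_neq0 : B != set0).

Lemma projP x : proj G B x \in B /\ connect (adj (outside G B)) x (proj G B x).
Proof.
rewrite /proj; case: pickP => [y /andP[yB xy]|none] //=.
have [b bB] := set0Pn _ B_neq0.
pose near z := [exists y in B, connect (adj (outside G B)) z y].
have near_edge z w : adj G z w -> near z -> near w.
  move=> zw /exists_inP[y yB zy].
  have [/andP[zB wB]|out] := boolP ((z \in B) && (w \in B)).
    by apply/exists_inP; exists w; rewrite // connect0.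
  apply/exists_inP; exists y => //; apply: connect_trans zy.
  by apply: connect1; rewrite adj_outside adjC zw /= andbC.
have : near x.
  rewrite -(connect_invariant (f := near) _ (connG b x)).
    by apply/exists_inP; exists b; rewrite // connect0.
  by move=> z w zw; apply/idP/idP; apply: near_edge; rewrite // adjC.
by case/exists_inP=> y yB xy; have := none y; rewrite yB xy.
Qed.

Lemma proj_in x : proj G B x \in B.
Proof. exact: (projP x).1. Qed.

Lemma proj_connect x y : y \in B ->
  connect (adj (outside G B)) x y -> proj G B x = y.
Proof.
move=> yB xy; have [pB xp] := projP x.
apply: (separatedP _ _ sepB) => //; apply: connect_trans xy.
by rewrite (adj_sym (outside G B)).
Qed.

Lemma proj_id x : x \in B -> proj G B x = x.
Proof. by move=> xB; apply: proj_connect. Qed.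

Lemma proj_edge x y : adj G x y -> ~~ ((x \in B) && (y \in B)) ->
  proj G B x = proj G B y.
Proof.
move=> xy out; have [pB yp] := projP y; apply: proj_connect => //.
by apply: connect_trans yp; apply: connect1; rewrite adj_outside xy.
Qed.

End Projection.

Lemma nonseparable_neq0 B : nonseparable G B -> B != set0.
Proof.
by case/nonseparableP=> B1 _ _; rewrite -card_gt0; apply: leq_trans B1.
Qed.

(** If [w] in [C] lay outside [B], its projection [c] would be a cut vertex of [C]: a path avoiding
    [c] cannot change whether the projection equals [c], yet [w] projects to [c] and some other
    vertex of [C] does not. *)
Lemma nonseparable_subset B C x y :
    separated G B -> nonseparable G C -> x != y ->
    x \in B -> y \in B -> x \in C -> y \in C -> C \subset B.
Proof.
move=> sepB nsC xy xB yB xC yC; apply/subsetP=> w wC.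
have B0 : B != set0 by apply/set0Pn; exists x.
apply/negPn/negP=> wB; pose c := proj G B w.
have cB : c \in B by apply: proj_in.
have [z [zB zC zc]] : exists z, [/\ z \in B, z \in C & z != c].
  have [xc|xc] := eqVneq x c; last by exists x.
  by exists y; rewrite -xc eq_sym.
have wc : w != c by apply: contraNneq wB => ->.
have [_ _ /(_ c w z wC zC wc zc)] := nonseparableP _ _ nsC.
move/(connect_invariant (f := fun a => proj G B a == c)).
rewrite eqxx proj_id // (negPf zc) => /(_ _)/esym h; suff: false by []; rewrite h //.
move=> a b /and3P[]; rewrite adj_inside => /and3P[ab _ _] ac bc.
have [/andP[aB bB]|out] := boolP ((a \in B) && (b \in B)).
  by rewrite !proj_id // (negPf ac) (negPf bc).
by rewrite (proj_edge _ _ ab).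
Qed.

Lemma block_unique B C x y :
    block G B -> block G C -> x != y ->
    x \in B -> y \in B -> x \in C -> y \in C -> B = C.
Proof.
move=> /andP[nsB sepB] /andP[nsC sepC] xy xB yB xC yC; apply/eqP.
by rewrite eqEsubset (nonseparable_subset sepC nsB xy) // (nonseparable_subset sepB nsC xy).
Qed.

(* A smallest separated set that contains the edge and induces a connected
   subgraph is a block: a cut vertex would allow to shrink it. *)
Lemma edge_block x y : adj G x y -> exists B, [/\ block G B, x \in B & y \in B].
Proof.
move=> xy; have xNy : x != y by apply: contraTneq xy => ->; rewrite adj_irr.
pose F B := [&& x \in B, y \in B,
  [forall a in B, forall b in B, connect (adj (inside G B)) a b] & separated G B].
have FT : F setT.
  rewrite /F !inE /=; apply/andP; split.
    apply/forall_inP=> a _; apply/forall_inP=> b _.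
    rewrite (eq_connect (e' := adj G)) ?connG // => c d.
    by rewrite adj_inside !inE !andbT.
  apply/separatedP=> a b _ _ /connectP[[|c p]] /=; first by move=> _ ->.
  by rewrite adj_outside !inE andbF.
case: (arg_minnP (fun B => #|B|) FT) => B /and4P[xB yB /forall_inP connB sepB] minB.
have {}connB a b : a \in B -> b \in B -> connect (adj (inside G B)) a b.
  by move=> aB; apply/forall_inP/connB.
exists B; split=> //; rewrite /block sepB andbT; apply/nonseparableP; split.
- by apply/card_gt1P; exists x, y.
- by move=> a b; apply: connB.
move=> v a b aB bB av bv.
set R := [rel a b | _]; apply/negPn/negP=> nab.
have B0 : B != set0 by apply/set0Pn; exists x.
have vB : v \in B.
  apply: contraR nab => vB.
  rewrite (eq_connect (e' := adj (inside G B))) ?connB // => c d.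
  rewrite /R /= adj_inside.
  by apply/andb_idr => /and3P[_ cB dB]; rewrite !(contraNneq _ vB) // => <-.
have R_sym : connect_sym R.
  by apply: sym_connect_sym => c d; rewrite /R /= adjC; congr (_ && _); rewrite andbC.
(* An end of the given edge that differs from the cut vertex [v]; the smaller set is built around it
   so as to keep the edge. *)
have [z [zB zv z_xy]] : exists z, [/\ z \in B, z != v & z = x \/ z = y].
  have [xv|xv] := eqVneq x v; last by exists x; split=> //; left.
  by exists y; split=> //; [rewrite -xv eq_sym|right].
(* [C] is the component of [z] in [B] without [v]. It misses [a] or [b], so [B1] is strictly smaller
   than [B] and contradicts minimality once it is shown to satisfy [F]. *)
pose C := [set c in B | (c != v) && connect R z c]; pose B1 := v |: C.
have zC : z \in C by rewrite inE zB zv connect0.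
have CB c : c \in C -> c \in B by rewrite inE => /and3P[].
have Cv c : c \in C -> c != v by rewrite inE => /and3P[].
have C_edge c d : c \in C -> d \in B -> d != v -> adj G c d -> d \in C.
  rewrite !inE => /and3P[cB cv zc] dB dv cd; rewrite dB dv /=.
  by apply: connect_trans zc _; apply: connect1; rewrite /R /= adj_inside cd cB dB cv.
have [c0 c0C c0v] : exists2 c0, c0 \in C & adj G c0 v.
  suff : ~~ [forall c in C, ~~ adj G c v].
    by rewrite negb_forall_in => /exists_inP[c cC]; rewrite negbK; exists c.
  apply/negP=> /forall_inP none.
  have step c d : adj (inside G B) c d -> c \in C -> d \in C.
    rewrite adj_inside => /and3P[cd _ dB] cC; apply: (C_edge c) => //.
    by apply: contraTneq cd => ->; apply: none.
  have /(connect_invariant (f := fun c => c \in C)) := connB z v zB vB.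
  rewrite zC => /(_ _)/esym h; have /Cv : v \in C.
    apply: h => c d cd; apply/idP/idP; apply: step => //.
    by rewrite (adjC (inside G B)).
  by rewrite eqxx.
have ltB1 : #|B1| < #|B|.
  apply: proper_card; apply/properP; split.
    by apply/subsetP=> c; rewrite !inE => /predU1P[->//|/andP[]].
  have [aC|naC] := boolP (a \in C); last by exists a; rewrite // in_setU1 (negPf av).
  have [bC|nbC] := boolP (b \in C); last by exists b; rewrite // in_setU1 (negPf bv).
  case/negP: nab; move: aC bC; rewrite !inE => /and3P[_ _ za] /and3P[_ _ zb].
  by apply: connect_trans zb; rewrite R_sym.
suff /minB : F B1 by rewrite leqNgt ltB1.
have xyB1 c : c \in B -> adj G z c -> c \in B1.
  move=> cB zc; rewrite in_setU1; have [//|cv] := eqVneq c v.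
  by apply: (C_edge z).
have in_C_conn c : c \in C -> connect (adj (inside G B1)) z c.
  move=> cC; pose R1 := [rel a b | [&& adj G a b, a \in C & b \in C]].
  have : connect R1 z c.
    rewrite -(@connect_restrict _ R R1 (mem C)) //.
    - by move: cC; rewrite inE => /and3P[].
    - move=> d e dC; rewrite /R /R1 /= adj_inside dC /=.
      apply/andP/andP=> [[/and3P[de _ eB] /andP[_ ev]]|[de eC]].
        by split=> //; apply: (C_edge d).
      by rewrite de !CB // !Cv.
    - move=> d e dC; rewrite /R /= adj_inside => /andP[/and3P[de _ eB] /andP[_ ev]].
      by apply: (C_edge d).
  apply: connect_sub => d e /and3P[de dC eC].
  by apply: connect1; rewrite adj_inside de !in_setU1 dC eC !orbT.
have conn_z c : c \in B1 -> connect (adj (inside G B1)) z c.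
  rewrite in_setU1 => /predU1P[->|]; last exact: in_C_conn.
  apply: connect_trans (in_C_conn _ c0C) _; apply: connect1.
  by rewrite adj_inside c0v !in_setU1 c0C eqxx orbT.
apply/and4P; split.
- case: z_xy => zE; first by rewrite -zE in_setU1 zC orbT.
  by apply: xyB1; rewrite // zE adjC.
- case: z_xy => zE; last by rewrite -zE in_setU1 zC orbT.
  by apply: xyB1; rewrite // zE.
- apply/forall_inP=> c cB1; apply/forall_inP=> d dB1.
  by apply: connect_trans (conn_z d dB1); rewrite (adj_sym (inside G B1)) conn_z.
(* A projection onto [B1]: first onto [B], then all of [B] outside [C] is collapsed to [v]. It is
   constant along the edges outside [B1], which proves that [B1] is separated. *)
pose k u := if proj G B u \in C then proj G B u else v.
have k_id c : c \in B1 -> k c = c.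
  rewrite in_setU1 /k => /predU1P[->|cC]; last by rewrite proj_id ?cC ?CB.
  by rewrite proj_id //; case: ifP.
apply/separatedP=> c d cB1 dB1 /(connect_invariant (f := k)).
rewrite !k_id //; apply=> {cB1 dB1}c {}d; rewrite adj_outside => /andP[cd out].
have [/andP[cB dB]|outB] := boolP ((c \in B) && (d \in B)); last first.
  by rewrite /k (proj_edge _ _ cd).
rewrite /k !proj_id //; case: ifP => cC; case: ifP => dC //.
- by rewrite !in_setU1 cC dC !orbT in out.
- move: out; rewrite !in_setU1 cC dC orbT orbF /= => dv.
  by move: dC; rewrite (C_edge c d).
- move: out; rewrite !in_setU1 cC dC orbT orbF andbT => cv.
  by move: cC; rewrite (C_edge d c) // adjC.
Qed.

(** [C] is connected by edges of its own, and none of them has both ends in [B], since two blocks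
    sharing an edge are equal. *)
Lemma proj_const B C x y : block G B -> block G C -> B != C ->
  x \in C -> y \in C -> proj G B x = proj G B y.
Proof.
move=> blB blC BC xC yC; have /andP[/nonseparable_neq0 B0 sepB] := blB.
have /andP[/nonseparableP[_ connC _] _] := blC.
apply: connect_invariant (connC x y xC yC) => a b.
rewrite adj_inside => /and3P[ab aC bC]; apply: proj_edge => //.
apply: contra BC => /andP[aB bB]; apply/eqP.
apply: (block_unique blB blC _ aB bB) => //.
by apply: contraTneq ab => ->; rewrite adj_irr.
Qed.

End Connected.

Lemma connect_iso (R R' : rel T) (a : {perm T}) :
  (forall x y, R' (a x) (a y) = R x y) ->
  forall x y, connect R' (a x) (a y) = connect R x y.
Proof.
move=> RR' x y; apply: connect_push => //; first exact: perm_inj.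
by move=> c d _; rewrite -(permKV a d) codom_f.
Qed.

Lemma graph_isoP (a : {perm T}) G H :
  reflect (forall x y, adj H (a x) (a y) = adj G x y) (graph_iso a G H).
Proof.
apply: (iffP forallP) => [h x y|h x]; first by apply/eqP; move/forallP: (h x).
by apply/forallP=> y; rewrite h.
Qed.

Lemma mem_imset_perm (a : {perm T}) B x : (a x \in a @: B) = (x \in B).
Proof. exact/mem_imset/perm_inj. Qed.

Lemma block_iso (a : {perm T}) G H B :
  graph_iso a G H -> block G B -> block H (a @: B).
Proof.
move=> /graph_isoP aGH /andP[/nonseparableP[B1 connB cutB] /separatedP sepB].
have insE x y : adj (inside H (a @: B)) (a x) (a y) = adj (inside G B) x y.
  by rewrite !adj_inside aGH !mem_imset_perm.
have outE x y : adj (outside H (a @: B)) (a x) (a y) = adj (outside G B) x y.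
  by rewrite !adj_outside aGH !mem_imset_perm.
apply/andP; split.
  apply/nonseparableP; split.
  - by rewrite card_imset //; apply: perm_inj.
  - move=> _ _ /imsetP[x xB ->] /imsetP[y yB ->].
    by rewrite (connect_iso insE) connB.
  - move=> v _ _ /imsetP[x xB ->] /imsetP[y yB ->]; rewrite -(permKV a v).
    rewrite !(inj_eq perm_inj) => xv yv.
    rewrite (connect_iso (R := [rel c d | [&& adj (inside G B) c d, c != (a^-1)%g v & d != (a^-1)%g v]])).
      exact: cutB.
    by move=> c d /=; rewrite insE !(inj_eq perm_inj).
apply/separatedP=> _ _ /imsetP[x xB ->] /imsetP[y yB ->].
by rewrite (connect_iso outE) => /sepB ->.
Qed.

(* The trace of the automorphism on the block tree, computed as in the
   Lefschetz fixed point theorem: [u - r] is the sum over the blocks [B]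
   of the differences of the projections of [u] and [r] on [B]. *)
Lemma dissymmetry G (a : {perm T}) (r : T) :
    (forall x y, connect (adj G) x y) -> graph_iso a G G ->
  #|[set x | a x == x]| + #|[set B | block G B && (a @: B == B)]| =
  1 + \sum_(B : {set T} | block G B && (a @: B == B)) #|[set x in B | a x == x]|.
Proof.
move=> connG autG; have aG := graph_isoP _ _ _ autG.
(* The identity from the block tree: [k u] does not depend on [u]. Comparing [u = a x] with a fixed
   [r] and summing over [x] gives the trace formula. *)
pose k u x : int :=
  ((u == x)%:Z - \sum_(B : {set T} | block G B) (proj G B u == x)%:Z)%R.
(* Along an edge only the projection onto the block of that edge changes, and it changes exactly as
   the vertex itself does. *)
have k_edge u w x : adj G u w -> k u x = k w x.
  move=> uw; have uNw : u != w by apply: contraTneq uw => ->; rewrite adj_irr.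
  have [B0 [blB0 uB0 wB0]] := edge_block connG uw.
  have /andP[ns0 sep0] := blB0; have B0n := nonseparable_neq0 ns0.
  rewrite /k !(bigD1 B0 blB0) /= !proj_id // !opprD !addrA !subrr.
  congr (_ - _)%R; apply: eq_bigr => B /andP[blB BB0].
  by rewrite (proj_const connG blB blB0 BB0 uB0 wB0).
have kE u w x : k u x = k w x.
  by apply: (connect_invariant (f := k^~ x)) (connG u w) => ? ?; apply: k_edge.
have sum_bool (P : pred T) : (\sum_x (P x)%:Z = #|[set x | P x]|%:Z)%R.
  rewrite -sum1dep_card (big_morph Posz PoszD (erefl : Posz 0 = 0%R)).
  by rewrite [RHS]big_mkcond; apply: eq_bigr => x _; case: (P x).
have card1 (u : T) : #|[set x | u == x]| = 1.
  by rewrite -(cards1 u); apply: eq_card => x; rewrite !inE eq_sym.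
have kS (u : T -> T) : (\sum_x k (u x) x = #|[set x | u x == x]|%:Z -
    \sum_(B : {set T} | block G B) #|[set x | proj G B (u x) == x]|%:Z)%R.
  rewrite /k sumrB sum_bool exchange_big /=; congr (_ - _)%R.
  by apply: eq_bigr => B _; rewrite sum_bool.
have : (\sum_x k (a x) x = \sum_x k r x)%R by apply: eq_bigr => x _; apply: kE.
rewrite !kS card1 (bigID (fun B => a @: B == B)) /=.
rewrite [X in (_ = _ - X)%R -> _](bigID (fun B => a @: B == B)) /=.
under [X in (_ = _ - (X + _))%R -> _]eq_bigr => B _ do rewrite card1.
under [X in (_ = _ - (_ + X))%R -> _]eq_bigr => B _ do rewrite card1.
(* A block moved by [a] counts one on both sides and cancels: [a @: B] projects to a single vertex
   [c] of [B], and [c] is the only solution of [proj G B (a x) = x]. *)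
have -> : (\sum_(B : {set T} | block G B && (a @: B != B)) #|[set x | proj G B (a x) == x]|%:Z
   = \sum_(B : {set T} | block G B && (a @: B != B)) 1%:Z)%R.
  apply: eq_bigr => B /andP[blB aBB].
  have blaB := block_iso autG blB.
  have /andP[nsB sepB] := blB; have B0 := nonseparable_neq0 nsB.
  have [b bB] := set0Pn _ B0; pose c := proj G B (a b).
  have pc y : y \in a @: B -> proj G B y = c.
    by move=> yB; apply: (proj_const connG blB blaB); rewrite 1?eq_sym ?mem_imset_perm.
  rewrite -(card1 c); congr (Posz _); apply: eq_card => x; rewrite !inE.
  apply/eqP/eqP=> [xE|<-].
    rewrite -xE pc //; rewrite mem_imset_perm -xE; exact: proj_in.
  by rewrite pc // mem_imset_perm; apply: proj_in.
(* For a block that [a] preserves, a solution lies in [B], hence so does [a x], which is then its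
   own projection: the solutions are the fixed vertices of [B]. *)
have -> : (\sum_(B : {set T} | block G B && (a @: B == B)) #|[set x | proj G B (a x) == x]|%:Z
   = (\sum_(B : {set T} | block G B && (a @: B == B)) #|[set x in B | a x == x]|)%:Z)%R.
  rewrite (big_morph Posz PoszD (erefl : Posz 0 = 0%R)); apply: eq_bigr => B /andP[blB /eqP aB].
  have /andP[nsB sepB] := blB; have B0 := nonseparable_neq0 nsB.
  congr (Posz _); apply: eq_card => x; rewrite !inE.
  have [xB|xB] := boolP (x \in B).
    have axB : a x \in B by rewrite -aB mem_imset_perm.
    by rewrite proj_id.
  by apply: contraNF xB => /eqP <-; apply: proj_in.
have -> : (\sum_(B : {set T} | block G B && (a @: B == B)) 1%:Z =
    #|[set B | block G B && (a @: B == B)]|%:Z)%R.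
  rewrite cardsE -sum1_card (big_morph Posz PoszD (erefl : Posz 0 = 0%R)).
  by apply: eq_bigl => B; rewrite unfold_in.
move: (\sum_(B : {set T} | block G B && (a @: B != B)) 1%:Z)%R => N.
move: (\sum_(_ | _) _) #|_| #|_|; clear => S F M; lia.
Qed.

End Blocks.

(** * Cycle index sums *)

Local Open Scope ring_scope.

Section CycleType.

Lemma malgUM (u v : monomial) : << u >> * << v >> = << mmul u v >> :> cpoly.
Proof. by rewrite malgM_def fgmulUU mulr1. Qed.

Lemma malgU_prod (I : Type) (r : seq I) (P : pred I) (F : I -> monomial) :
  \prod_(i <- r | P i) << F i >> = << \big[mmul/mone]_(i <- r | P i) F i >> :> cpoly.
Proof.
apply/esym; apply: (big_morph (fun u : monomial => << u >> : cpoly)) => //.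
by move=> u v; rewrite malgUM.
Qed.

Variable T : finType.
Implicit Types (a : {perm T}) (U : {set T}).

Definition ctype a U : monomial :=
  \big[mmul/mone]_(c in porbit a @: U) ucm #|c|.-1.

Lemma prod_var_cycles a :
  \prod_(1 <= k < #|T|.+1) var k ^+ num_cycles k a = << ctype a setT >> :> cpoly.
Proof.
have porbE : porbits a = porbit a @: setT.
  by apply/setP=> c; apply/imsetP/imsetP=> -[x _ ->]; exists x.
rewrite /ctype -malgU_prod -porbE.
transitivity (\prod_(1 <= k < #|T|.+1) \prod_(c in porbits a | #|c| == k) (<< ucm #|c|.-1 >> : cpoly)).
  apply: eq_bigr => k _; rewrite /num_cycles -prodr_const.
  apply: eq_big => [c|c cP]; first by rewrite inE.
  by move: cP; rewrite /var inE => /andP[_ /eqP->].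
rewrite (exchange_big_dep (fun c => c \in porbits a)) //=; last by move=> k c _ /andP[].
apply: eq_bigr => c cP; have [x _ cE] := imsetP cP.
rewrite (eq_bigl (fun k => k == #|c|)) => [|k]; last by rewrite cP eq_sym.
rewrite big_nat1_eq ltnS max_card andbT ifT //.
by rewrite lt0n cE card_porbit_neq0.
Qed.

End CycleType.

Lemma ctype_push (S T : finType) (f : S -> T) (s : {perm S}) (t : {perm T}) (U : {set S}) :
  injective f -> (forall x, t (f x) = f (s x)) -> ctype t (f @: U) = ctype s U.
Proof.
move=> f_inj tf; have porbE x : porbit t (f x) = f @: porbit s x.
  apply/setP=> y; apply/idP/imsetP=> [yx|[z zx ->]]; last first.
    by rewrite (porbit_push f_inj tf).
  have /codomP[z yE] : y \in codom f.
    move: yx; rewrite porbit_connect => /(connect_invariant (f := fun c => c \in codom f)) <-.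
      exact: codom_f.
    move=> a b /eqP <-; apply/idP/idP.
      by case/codomP=> c ->; rewrite tf codom_f.
    case/codomP=> c; rewrite -{1}(permKV s c) -tf => /perm_inj ->; exact: codom_f.
  by exists z; rewrite // -(porbit_push f_inj tf) -yE.
rewrite /ctype -imset_comp.
have -> : [set (porbit t \o f) x | x in U] = (fun c : {set S} => f @: c) @: (porbit s @: U).
  by rewrite -imset_comp; apply: eq_imset => x /=; apply: porbE.
rewrite big_imset /=; last by move=> c d _ _; apply: imset_inj.
by apply: eq_bigr => c _; rewrite card_imset.
Qed.

Lemma ctype_conj (T : finType) (a s : {perm T}) : ctype (a ^ s) setT = ctype a setT.
Proof.
have sT : s @: [set: T] = setT.
  apply/setP=> x; rewrite inE; apply/imsetP; exists ((s^-1)%g x) => //.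
  by rewrite permKV.
by rewrite -{1}sT; apply: ctype_push => [|x]; [apply: perm_inj | rewrite permJ].
Qed.

(** * Sums over isomorphism classes as sums over permutations *)

Section Representatives.

Variables (n : nat) (X : nat -> finType) (iso : forall n, {perm 'I_n} -> rel (X n)).
Variables (act : X n -> {perm 'I_n} -> X n) (K : {set X n}).
Hypotheses (act1 : forall G, act G 1%g = G)
  (actM : forall G s t, act G (s * t)%g = act (act G s) t)
  (isoE : forall s G H, iso s G H = (act G s == H))
  (K_act : forall G s, (act G s \in K) = (G \in K)).

Let to := TotalAction act1 actM.

Let isomorphic_orbit G H : isomorphic iso G H = (H \in orbit to setT G).
Proof.
apply/existsP/orbitP=> [[s]|[s _ <-]]; first by rewrite isoE => /eqP <-; exists s.
by exists s; rewrite isoE.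
Qed.

(** The number [f G] of automorphisms of cycle type [m] is constant on an isomorphism class. A class
    has n! / |Aut| members, so the 1 / |Aut| of its representative becomes 1 / n! once all its
    members are summed. *)
Lemma sum_representatives m :
  \sum_(G in representatives iso K) (cycle_index (automorphisms iso G))@_m =
  (n`!%:R)^-1 * \sum_(a : {perm 'I_n} | ctype a setT == m) #|[set G in K | iso a G G]|%:R.
Proof.
pose w (a : {perm 'I_n}) : rat := (ctype a setT == m)%:R.
pose f G : rat := \sum_(a | iso a G G) w a.
have -> : \sum_(a : {perm 'I_n} | ctype a setT == m) #|[set G in K | iso a G G]|%:R
    = \sum_(G in K) f G :> rat.
  transitivity (\sum_(a : {perm 'I_n} | ctype a setT == m)
      \sum_(G in K | iso a G G) (1 : rat)).
    apply: eq_bigr => a _; rewrite -sum1_card natr_sum.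
    by apply: eq_bigl => G; rewrite inE.
  rewrite (exchange_big_dep (fun G => G \in K)) /=; last by move=> a G _ /andP[].
  apply: eq_bigr => G GK; rewrite /f big_mkcond [RHS]big_mkcond /=.
  by apply: eq_bigr => a _; rewrite /w GK; case: (iso a G G); case: (_ == m).
have f_act G s : f (act G s) = f G.
  rewrite /f (reindex_inj (conjg_inj s)) /=; apply: eq_big => [a|a _].
    rewrite !isoE -actM conjgE !mulgA mulgV mul1g.
    by rewrite actM (inj_eq (act_inj to s)).
  by rewrite /w ctype_conj.
have equiv : {in K & &, equivalence_rel (@isomorphic X iso n)}.
  move=> G H L _ _ _; rewrite !isomorphic_orbit orbit_refl; split=> // GH.
  by move/orbit_eqP: GH => ->.
have part := equivalence_partitionP equiv; have tr := transversalP part.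
rewrite /representatives (set_partition_big _ part) /=; move: tr.
set X0 := transversal _ _; move: X0 => X0 tr.
rewrite -{1}(pblock_transversal tr) big_imset /=; last exact: (pblock_inj tr).
rewrite mulr_sumr; apply: eq_bigr => R RX.
have RK : R \in K := subsetP (transversal_sub tr) R RX.
have -> : pblock (equivalence_partition (@isomorphic X iso n) K) R = orbit to setT R.
  apply/setP=> G; have [GK|GK] := boolP (G \in K).
    by rewrite (pblock_equivalence_partition equiv) // isomorphic_orbit.
  apply/idP/idP=> [GR|/orbitP[s _ GE]]; last by rewrite -GE K_act RK in GK.
  case/and3P: part => /eqP cov _ _; rewrite -cov in GK; case/bigcupP: GK.
  by exists (pblock (equivalence_partition (@isomorphic X iso n) K) R); rewrite ?pblock_mem ?cov.
rewrite (eq_bigr (fun=> f R)); last by move=> _ /orbitP[s _ <-]; apply: f_act.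
have stabE : 'C[R | to]%g = automorphisms iso R.
  by apply/setP=> a; rewrite [RHS]inE isoE; apply/astab1P/eqP.
have := card_orbit_stab to setT R; rewrite setTI stabE cardsT card_Sn => orb.
rewrite sumr_const -orb natrM -[f R *+ _]mulr_natr invfM.
rewrite /cycle_index mcoeffZ raddf_sum /=.
have -> : \sum_(a in automorphisms iso R) (\prod_(1 <= k < #|'I_n|.+1) var k ^+ num_cycles k a)@_m = f R.
  apply: eq_big => [a|a _]; first by rewrite inE.
  by rewrite prod_var_cycles mcoeffU1.
have orb0 : #|orbit to setT R|%:R != 0 :> rat.
  rewrite Num.Theory.pnatr_eq0 -lt0n card_gt0; apply/set0Pn; exists R; exact: orbit_refl.
by rewrite [_^-1 * _^-1]mulrC -mulrA; congr (_ * _); rewrite mulrCA mulVf ?mulr1.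
Qed.

End Representatives.

(** * Weights, truncations and homogeneous parts *)

Section Weight.

Implicit Types (u m : monomial) (N : nat).

Lemma weightEw m (d : {fset nat}) : (finsupp m `<=` d)%fset ->
  weight m = (\sum_(i <- d) i.+1 * m i)%N.
Proof.
move=> le; rewrite /weight (big_fset_incl _ le) // => i _.
by rewrite -cmE_neq0 negbK => /eqP->; rewrite muln0.
Qed.

Lemma weightM u m : weight (mmul u m) = (weight u + weight m)%N.
Proof.
rewrite (@weightEw u (finsupp u `|` finsupp m)%fset) ?fsubsetUl //.
rewrite (@weightEw m (finsupp u `|` finsupp m)%fset) ?fsubsetUr //.
rewrite (@weightEw (mmul u m) (finsupp u `|` finsupp m)%fset) ?mdomD //.
by rewrite -big_split; apply: eq_bigr => i _; rewrite cmM mulnDr.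
Qed.

Lemma weight1 : weight mone = 0%N.
Proof. by rewrite /weight mdom1 big_seq_fset0. Qed.

Lemma weightU i : weight (ucm i) = i.+1.
Proof. by rewrite /weight mdomU big_seq_fset1 cmUU muln1. Qed.

Lemma weight_prod (I : Type) (r : seq I) (P : pred I) (F : I -> monomial) :
  weight (\big[mmul/mone]_(i <- r | P i) F i) = (\sum_(i <- r | P i) weight (F i))%N.
Proof. exact: (big_morph weight weightM weight1). Qed.

Lemma cm_prod (I : Type) (r : seq I) (P : pred I) (F : I -> monomial) k :
  (\big[mmul/mone]_(i <- r | P i) F i) k = (\sum_(i <- r | P i) F i k)%N.
Proof. apply: (big_morph (fun m : monomial => m k)) => [u m|]; [exact: cmM|exact: cm1]. Qed.

Lemma expcmnE u k i : (expcmn u k) i = (k * u i)%N.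
Proof.
rewrite /expcmn; elim: k => [|[|k] IH]; first by rewrite cm1 mul0n.
  by rewrite mul1n.
by rewrite [iterop _ _ _ _]/= mulcmE IH mulSn.
Qed.

Lemma monomial_of_exponentsE N (f : {ffun 'I_N -> 'I_N.+1}) (i : 'I_N) :
  monomial_of_exponents f i = f i.
Proof.
rewrite /monomial_of_exponents cm_prod (bigD1 i) //= expcmnE cmUU muln1.
rewrite big1 ?addn0 // => j ji; rewrite expcmnE cmU (_ : (_ == _) = false) ?muln0 //.
exact: negPf.
Qed.

Lemma monomial_of_exponents_out N (f : {ffun 'I_N -> 'I_N.+1}) i :
  (N <= i)%N -> monomial_of_exponents f i = 0%N.
Proof.
move=> Ni; rewrite /monomial_of_exponents cm_prod big1 // => j _.
rewrite expcmnE cmU (_ : (_ == _) = false) ?muln0 //.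
by apply: ltn_eqF; apply: leq_trans (ltn_ord j) Ni.
Qed.

Lemma weight_ge m i : (i.+1 * m i <= weight m)%N.
Proof.
rewrite /weight; have [im|] := boolP (i \in finsupp m).
  by rewrite (big_fsetD1 i) //= leq_addr.
by rewrite -cmE_neq0 negbK => /eqP->; rewrite muln0.
Qed.

Lemma mem_monomials_upto N m : (m \in monomials_upto N) = (weight m <= N)%N.
Proof.
rewrite mem_filter; apply/andb_idr => mN; apply/imageP.
exists [ffun i : 'I_N => inord (m i)] => //; apply/eqP/cmP=> i.
have [iN|Ni] := ltnP i N.
  rewrite (monomial_of_exponentsE _ (Ordinal iN)) ffunE inordK // ltnS.
  by apply: leq_trans mN; apply: leq_trans (weight_ge m i); rewrite mulSn leq_addr.
rewrite monomial_of_exponents_out //; apply/eqP; rewrite -leqn0 leqNgt.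
apply/negP=> mi; have h := leq_trans (weight_ge m i) mN.
suff : (i.+1 <= i.+1 * m i)%N by move=> /leq_trans/(_ h); rewrite ltnNge Ni.
by rewrite leq_pmulr.
Qed.

Lemma monomials_upto_uniq N : uniq (monomials_upto N).
Proof.
rewrite filter_uniq // map_inj_uniq ?enum_uniq // => f g fg.
apply/ffunP=> i; apply/val_inj; by rewrite /= -!monomial_of_exponentsE fg.
Qed.

Lemma truncateE N (F : series) m :
  (truncate N F)@_m = if (weight m <= N)%N then F m else 0.
Proof.
rewrite /truncate raddf_sum /= (eq_bigr (fun u => F u *+ (u == m))); last first.
  by move=> u _; rewrite mcoeffU.
case: ifP => mN.
  rewrite (bigD1_seq m) ?mem_monomials_upto ?monomials_upto_uniq //= eqxx.
  by rewrite big1 ?addr0 // => u /negPf->.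
rewrite big1_seq // => u; rewrite mem_monomials_upto /= => uN.
by case: eqVneq => // um; rewrite -um uN in mN.
Qed.

Lemma weight_ctype (T : finType) (a : {perm T}) : weight (ctype a setT) = #|T|.
Proof.
rewrite /ctype weight_prod.
have part : partition (porbit a @: setT) [set: T].
  apply/and3P; split.
  - apply/eqP/setP=> x; rewrite inE; apply/bigcupP; exists (porbit a x).
      exact: imset_f.
    exact: porbit_id.
  - apply/trivIsetP=> _ _ /imsetP[x _ ->] /imsetP[y _ ->] xy.
    rewrite -setI_eq0; apply: contraR xy => /set0Pn[z]; rewrite inE.
    by case/andP=> /porbit_eq <- /porbit_eq <-.
  by apply/imsetP=> -[x _ /setP/(_ x)]; rewrite inE porbit_id.
rewrite -cardsT (card_partition part); apply: eq_bigr => c /imsetP[x _ ->].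
by rewrite weightU prednK // lt0n card_porbit_neq0.
Qed.

(* [hom] is locked because conversion on polynomials does not terminate in
   practice. *)
Fact hom_key : unit. Proof. by []. Qed.

Definition hom l (p : cpoly) : cpoly :=
  locked_with hom_key
    (\sum_(u <- msupp p) << p@_u *+ (weight u == l) *g u >>).

Lemma homE l p m : (hom l p)@_m = if weight m == l then p@_m else 0.
Proof.
rewrite /hom unlock raddf_sum /= (eq_bigr (fun u => p@_u *+ (weight u == l) *+ (u == m))); last first.
  by move=> u _; rewrite mcoeffU.
have [mp|mp] := boolP (m \in msupp p); last first.
  rewrite (mcoeff_outdom mp) if_same big1_seq // => u /= up.
  by have [um|_] := eqVneq u m; [rewrite -um up in mp | rewrite mulr0n].
rewrite (bigD1_seq m) ?fset_uniq //= eqxx big1 ?addr0; last by move=> u /negPf->.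
by case: (_ == l).
Qed.

Lemma cpolyP (p q : cpoly) : (forall m, p@_m = q@_m) -> p = q.
Proof. exact: (malgP p q).1. Qed.

Lemma mcoeff_sum m (I : Type) (r : seq I) (P : pred I) (F : I -> cpoly) :
  (\sum_(i <- r | P i) F i)@_m = \sum_(i <- r | P i) (F i)@_m.
Proof. exact: raddf_sum. Qed.

Lemma cmcoeffZ (c : rat) (p : cpoly) m : (c *: p)@_m = c * p@_m.
Proof. exact: mcoeffZ. Qed.

Lemma homU l u : hom l << u >> = if weight u == l then << u >> else 0.
Proof.
apply: cpolyP => m; rewrite homE mcoeffU1; have [->|um] := eqVneq u m.
  by case: ifP => _; rewrite ?mcoeffU1 ?eqxx // mcoeff0.
by case: ifP => _; case: ifP => _; rewrite ?mcoeffU1 ?(negPf um) ?mcoeff0.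
Qed.

Lemma msupp_hom l p : (msupp (hom l p) `<=` msupp p)%fset.
Proof.
apply/fsubsetP=> u; rewrite -!mcoeff_neq0 homE.
by case: ifP => // _; rewrite eqxx.
Qed.

Lemma homM l p q : hom l (p * q) = \sum_(j < l.+1) hom j p * hom (l - j)%N q.
Proof.
apply: cpolyP => m; rewrite [LHS]homE [RHS]mcoeff_sum.
pose t (u v : monomial) : rat := (p@_u * q@_v) *+ (mmul u v == m).
transitivity (\sum_(j < l.+1) \sum_(u <- msupp p) \sum_(v <- msupp q)
    t u v *+ ((weight u == j) && (weight v == l - j)%N)); last first.
  apply: eq_bigr => j _.
  rewrite (mcoeffMlw _ (msupp_hom j p) (msupp_hom (l - j)%N q)).
  apply: eq_bigr => u _; apply: eq_bigr => v _; rewrite !homE /t.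
  by case: (weight u == j); case: (weight v == (l - j)%N); rewrite /= ?mul0r ?mulr0 ?mul0rn ?mulr0n ?mulr1n.
rewrite exchange_big /=; under [RHS]eq_bigr => u _ do rewrite exchange_big /=.
have sum_j u v : \sum_(j < l.+1) t u v *+ ((weight u == j) && (weight v == l - j)%N) =
    if weight m == l then t u v else 0.
  rewrite /t; have [<-|_] := eqVneq (mmul u v) m; last first.
    by rewrite !mulr0n if_same big1 // => j _; rewrite mul0rn.
  rewrite weightM; case: eqP => [wl|wl].
    have ul : (weight u < l.+1)%N by rewrite ltnS -wl leq_addr.
    rewrite (bigD1 (Ordinal ul)) //= eqxx.
    rewrite (_ : (l - weight u)%N = weight v) ?eqxx; last by rewrite -wl addKn.
    rewrite big1 ?addr0 // => j.
    by rewrite -val_eqE /= eq_sym => /negPf->.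
  rewrite big1 // => j _; case: eqP => // uj; case: eqP => // vj.
  by case: wl; rewrite uj vj subnKC // -ltnS.
under [RHS]eq_bigr => u _.
  under eq_bigr => v _ do rewrite sum_j.
  over.
case: ifP => _; first exact: mcoeffMl.
by rewrite big1 // => u _; rewrite big1.
Qed.

Lemma hom1 l : hom l 1 = (l == 0%N)%:R.
Proof. 
rewrite -[1]/(<< mone >>) homU weight1 eq_sym; by case: eqP.
Qed.

End Weight.

(** * Series given by functions on permutations, and substitution in them *)

Section PermSeries.

Variable c : forall k, {perm 'I_k} -> rat.
Arguments c {k}.

(** The series with 1 / k! times the sum, over the permutations [s] of k points, of [c s] times the
    monomial of [s]. By [sum_representatives] every cycle index sum has this form. *)
Definition perm_series : series := fun u =>
  ((weight u)`!%:R)^-1 * \sum_(s : {perm 'I_(weight u)} | ctype s setT == u) c s.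

Lemma sum_perm_series N (Q : monomial -> rat) :
  \sum_(u <- monomials_upto N) perm_series u * Q u =
  \sum_(k < N.+1) (k`!%:R)^-1 * \sum_(s : {perm 'I_k}) c s * Q (ctype s setT).
Proof.
transitivity (\sum_(u <- monomials_upto N) \sum_(k < N.+1)
    (k`!%:R)^-1 * \sum_(s : {perm 'I_k} | ctype s setT == u) c s * Q u).
  apply: eq_big_seq => u; rewrite mem_monomials_upto => uN.
  rewrite (bigD1 (Ordinal (uN : (weight u < N.+1)%N))) //= [X in _ = _ + X]big1 ?addr0 => [|k].
    by rewrite /perm_series -mulrA mulr_suml.
  rewrite -val_eqE /= => ku; rewrite big1 ?mulr0 // => s /eqP su.
  by move: ku; rewrite -su weight_ctype card_ord eqxx.
rewrite exchange_big /=; apply: eq_bigr => k _; rewrite -mulr_sumr; congr (_ * _).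
rewrite (exchange_big_dep predT) //=; apply: eq_bigr => s _.
rewrite big_mkcond (bigD1_seq (ctype s setT)) ?monomials_upto_uniq //=.
  by rewrite eqxx big1 ?addr0 // => u; rewrite eq_sym => /negPf->.
by rewrite mem_monomials_upto weight_ctype card_ord -ltnS.
Qed.

Lemma ctypeE (T : finType) (s : {perm T}) A i :
  ctype s A i = (\sum_(z in porbit s @: A) (#|z|.-1 == i))%N.
Proof. by rewrite /ctype cm_prod; apply: eq_bigr => z _; rewrite cmU. Qed.

Lemma prod_ctype (T : finType) (s : {perm T}) N (x : nat -> cpoly) :
    (#|T| <= N)%N ->
  \prod_(i < N) x i.+1 ^+ (ctype s setT (val i)) =
  \prod_(z in porbit s @: setT) x #|z|.
Proof.
move=> TN.
transitivity (\prod_(i < N) \prod_(z in porbit s @: setT) x i.+1 ^+ (#|z|.-1 == i)).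
  by apply: eq_bigr => i _; rewrite ctypeE expr_sum.
rewrite exchange_big /=; apply: eq_bigr => _ /imsetP[y _ ->].
have z_gt0 : (0 < #|porbit s y|)%N by rewrite lt0n card_porbit_neq0.
have zN : (#|porbit s y|.-1 < N)%N.
  by rewrite prednK //; apply: leq_trans TN; apply: max_card.
rewrite (bigD1 (Ordinal zN)) //= eqxx expr1 prednK // big1 ?mulr1 // => i.
by rewrite -val_eqE /= eq_sym => /negPf->.
Qed.

(** Regrouped by the cycles of [s], a substitution becomes a product over cycles, which is the shape
    of a count of forests whose roots are permuted by [s]. *)
Lemma subst_perm_series t m : let N := weight m in
  subst perm_series t m =
  \sum_(k < N.+1) (k`!%:R)^-1 *
    \sum_(s : {perm 'I_k}) c s * (\prod_(z in porbit s @: setT) truncate N (t #|z|))@_m.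
Proof.
move=> N; rewrite /subst mcoeff_sum.
transitivity (\sum_(u <- monomials_upto N) perm_series u *
    (\prod_(i < N) truncate N (t i.+1) ^+ u (val i))@_m).
  by apply: eq_bigr => u _; rewrite cmcoeffZ.
rewrite sum_perm_series; apply: eq_bigr => k _; congr (_ * _).
apply: eq_bigr => s _; congr (_ * mcoeff _ _).
by apply: (prod_ctype s (fun i => truncate N (t i))); rewrite card_ord -ltnS.
Qed.

(** The cycle type of the permutation [unroll i s] below, all cycle lengths being multiplied by
    [i]. *)
Definition dtype (T : finType) (i : nat) (s : {perm T}) : monomial :=
  \big[mmul/mone]_(z in porbit s @: setT) ucm (i * #|z|).-1.

Lemma weight_dtype (T : finType) i (s : {perm T}) : (0 < i)%N ->
  weight (dtype i s) = (i * #|T|)%N.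
Proof.
move=> i_gt0; have := weight_ctype s; rewrite /ctype /dtype !weight_prod => <-.
rewrite big_distrr /=; apply: eq_bigr => _ /imsetP[y _ ->].
have z_gt0 : (0 < #|porbit s y|)%N by rewrite lt0n card_porbit_neq0.
by rewrite !weightU !prednK // muln_gt0 i_gt0.
Qed.

Lemma dilate_perm_series i m : (0 < i)%N ->
  dilate i perm_series m =
  \sum_(k < (weight m).+1) (k`!%:R)^-1 *
    \sum_(s : {perm 'I_k}) c s * (dtype i s == m)%:R.
Proof.
move=> i_gt0; rewrite /dilate subst_perm_series; set N := weight m.
apply: eq_bigr => k _; congr (_ * _); apply: eq_bigr => s _; congr (_ * _).
pose t p := truncate N (series_of_poly (var p)).
have tE p : (p <= N)%N -> (0 < p)%N -> t p = << ucm p.-1 >>.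
  move=> pN p_gt0; apply: cpolyP => u; rewrite [LHS]truncateE /series_of_poly /var.
  case: leqP => // Nu; rewrite mcoeffU1; case: eqP => // uE.
  by move: Nu; rewrite -uE weightU prednK // ltnNge pN.
have t0 p : (N < p)%N -> t p = 0.
  move=> Np; apply: cpolyP => u; rewrite [LHS]truncateE /series_of_poly /var.
  rewrite mcoeff0; case: leqP => // uN; rewrite mcoeffU1; case: eqP => // uE.
  move: uN; rewrite -uE weightU leqNgt prednK ?Np //; exact: leq_ltn_trans Np.
have z_gt0 z : z \in porbit s @: setT -> (0 < i * #|z|)%N.
  by case/imsetP=> y _ ->; rewrite muln_gt0 i_gt0 lt0n card_porbit_neq0.
transitivity ((\prod_(z in porbit s @: setT) t (i * #|z|)%N)@_m); first by [].
(* A cycle too long for the truncation makes the product vanish; the other side vanishes as well,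
   because the weight of [dtype i s] would exceed that of [m]. *)
have [small|] := boolP [forall z in porbit s @: setT, (i * #|z| <= N)%N].
  rewrite (eq_bigr (fun z : {set 'I_k} => << ucm (i * #|z|).-1 >>)); last first.
    by move=> z zs; rewrite tE ?z_gt0 //; apply: (forall_inP small).
  by rewrite malgU_prod mcoeffU1.
rewrite negb_forall_in => /exists_inP[z zs]; rewrite -ltnNge => Nz.
rewrite (bigD1 z) //= t0 // mul0r mcoeff0; case: eqP => // sm.
suff : (i * #|z| <= N)%N by rewrite leqNgt Nz.
apply: (@leq_trans (weight (dtype i s))); last by rewrite sm.
by rewrite /dtype weight_prod (bigD1 z) //= weightU prednK ?z_gt0 // leq_addr.
Qed.

Lemma hom_dilate_perm_series i N l : (0 < i)%N -> (l <= N)%N ->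
  hom l (truncate N (dilate i perm_series)) =
  \sum_(k < l.+1 | (i * k == l)%N) (k`!%:R : rat)^-1 *:
    \sum_(s : {perm 'I_k}) c s *: << dtype i s >>.
Proof.
move=> i_gt0 lN; apply: cpolyP => m; rewrite [LHS]homE [RHS]mcoeff_sum.
transitivity (\sum_(k < l.+1 | (i * k == l)%N) (k`!%:R : rat)^-1 *
    \sum_(s : {perm 'I_k}) c s * (dtype i s == m)%:R); last first.
  apply: eq_bigr => k _; rewrite [RHS]cmcoeffZ [in RHS]mcoeff_sum; congr (_ * _).
  by apply: eq_bigr => s _; rewrite [RHS]cmcoeffZ mcoeffU1.
have dm k (s : {perm 'I_k}) : dtype i s == m -> weight m = (i * k)%N.
  by move=> /eqP <-; rewrite weight_dtype // card_ord.
have [wm|wm] := eqVneq (weight m) l; last first.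
  rewrite big1 // => k /eqP ik; rewrite big1 ?mulr0 // => s _.
  case: eqP => [/eqP/dm wE|_]; rewrite ?mulr0 //.
  by case/eqP: wm; rewrite wE.
rewrite [LHS]truncateE wm lN dilate_perm_series // wm.
rewrite [RHS]big_mkcond; apply: eq_bigr => k _; case: ifP => // ik.
rewrite big1 ?mulr0 // => s _; case: eqP => [/eqP/dm wE|_]; rewrite ?mulr0 //.
by rewrite -wE wm eqxx in ik.
Qed.

End PermSeries.

(** * Rooted forests and their automorphisms *)

Section PermRestriction.

Variable T : finType.
Implicit Types (a : {perm T}) (U : {set T}).

Lemma perm_stable a U : (forall x, x \in U -> a x \in U) ->
  forall x, (a x \in U) = (x \in U).
Proof.
move=> aU x; apply/idP/idP; last exact: aU.
have aE : a @: U = U.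
  apply/eqP; rewrite eqEcard card_imset ?leqnn ?andbT; last exact: perm_inj.
  by apply/subsetP=> _ /imsetP[y yU ->]; apply: aU.
by rewrite -{1}aE mem_imset_perm.
Qed.

Definition restrict_perm U a : {perm T} :=
  odflt 1%g [pick b : {perm T} | [forall x, b x == if x \in U then a x else x]].

Lemma restrict_permE U a : (forall x, (a x \in U) = (x \in U)) ->
  forall x, restrict_perm U a x = if x \in U then a x else x.
Proof.
move=> aU x; rewrite /restrict_perm; case: pickP => [b /forallP/(_ x)/eqP //|none] /=.
pose f y := if y \in U then a y else y.
have f_inj : injective f.
  move=> y z; rewrite /f; case: ifP => yU; case: ifP => zU //.
  - exact: perm_inj.
  - by move=> yz; rewrite -yz aU yU in zU.
  - by move=> yz; rewrite yz aU zU in yU.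
by have /negP[] := none (perm f_inj); apply/forallP=> y; rewrite permE.
Qed.

Lemma perm_on_stable a U x : perm_on U a -> (a x \in U) = (x \in U).
Proof. exact: perm_closed. Qed.

Lemma perm_on_out a U x : perm_on U a -> x \notin U -> a x = x.
Proof. exact: out_perm. Qed.

Lemma perm_on_intro a U : (forall x, x \notin U -> a x = x) -> perm_on U a.
Proof. by move=> aU; apply/subsetP=> x; apply: contraR => /aU/eqP. Qed.

Lemma restrict_perm_on a U : (forall x, (a x \in U) = (x \in U)) ->
  perm_on U (restrict_perm U a).
Proof.
by move=> aU; apply: perm_on_intro => x xU; rewrite restrict_permE // (negPf xU).
Qed.

Lemma porbit_agree a (b : {perm T}) U x : (forall y, y \in U -> a y = b y) ->
  (forall y, y \in U -> a y \in U) -> x \in U -> porbit a x = porbit b x.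
Proof.
move=> ab aU xU; apply/setP=> y; rewrite !porbit_connect.
apply: (@connect_restrict _ _ _ (mem U)) => // c d cU /=; first by rewrite ab.
by move/eqP<-; apply: aU.
Qed.

Lemma ctype_agree a (b : {perm T}) U : (forall y, y \in U -> a y = b y) ->
  (forall y, y \in U -> a y \in U) -> ctype a U = ctype b U.
Proof.
move=> ab aU; rewrite /ctype.
by rewrite (eq_in_imset (fun x => porbit_agree ab aU)).
Qed.

Lemma ctypeU a U1 U2 : (forall x, (a x \in U1) = (x \in U1)) -> [disjoint U1 & U2] ->
  ctype a (U1 :|: U2) = mmul (ctype a U1) (ctype a U2).
Proof.
move=> aU1 dis; rewrite /ctype imsetU.
rewrite (eq_bigl [in [predU porbit a @: U1 & porbit a @: U2]]) => [|c]; last by rewrite !inE.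
rewrite bigU //.
rewrite -setI_eq0; apply/eqP/setP=> c; rewrite !inE.
apply/negP=> /andP[/imsetP[x xU ->] /imsetP[y yU xy]].
have : y \in porbit a x by rewrite xy porbit_id.
rewrite porbit_connect => /(connect_invariant (f := fun z => z \in U1)).
rewrite xU (disjointFl dis yU) => h; suff : true = false by [].
by apply: h => z w /eqP <-.
Qed.

End PermRestriction.

(** * Forests over a set of roots, and their decomposition *)

Section Forests.

Variables (S T : finType) (sigma : {perm S}) (x0 : T).
Implicit Types (A B : {set S}) (U : {set T}) (a : {perm T}) (io : {ffun S -> T}).
Implicit Types (G : graph T).

(* What an automorphism [a] sees outside a block whose vertices it permutes as
   [sigma]: a family of rooted graphs indexed by [A].  The junk value [x0] off
   [A] makes [io] determined by the roots. *)
Record forest_spec A U a io G : Prop := ForestSpec {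
  forest_on : perm_on U a;
  forest_outer : outerplanar G;
  forest_supp : forall x y, adj G x y -> x \in U;
  forest_iso : forall x y, adj G (a x) (a y) = adj G x y;
  forest_root : forall j, j \in A -> io j \in U;
  forest_sigma : forall j, j \in A -> a (io j) = io (sigma j);
  forest_default : forall j, j \notin A -> io j = x0;
  forest_cover : forall x, x \in U -> exists2 j, j \in A & connect (adj G) x (io j);
  forest_unique : {in A &, forall i j, connect (adj G) (io i) (io j) -> i = j}
}.

Definition triple := ({perm T} * {ffun S -> T} * graph T)%type.

Definition forest A U (t : triple) : bool :=
  let: (a, io, G) := t in
  [&& perm_on U a, outerplanar G, [forall x, forall y, adj G x y ==> (x \in U)],
      graph_iso a G G, [forall j in A, io j \in U],
      [forall j in A, a (io j) == io (sigma j)],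
      [forall j, (j \notin A) ==> (io j == x0)],
      [forall x in U, exists j in A, connect (adj G) x (io j)] &
      [forall i in A, forall j in A, connect (adj G) (io i) (io j) ==> (i == j)]].

Lemma forestP A U a io G : reflect (forest_spec A U a io G) (forest A U (a, io, G)).
Proof.
apply: (iffP idP).
  case/and5P=> h1 h2 /forallP h3 /graph_isoP h4.
  case/and5P=> /forall_inP h5 /forall_inP h6 /forallP h7 /forall_inP h8 /forall_inP h9.
  split=> //.
  - by move=> x y xy; move/forallP/(_ y): (h3 x); rewrite xy.
  - by move=> j jA; apply/eqP/h6.
  - by move=> j jA; apply/eqP; move: (h7 j); rewrite jA.
  - by move=> x xU; have /exists_inP := h8 x xU.
  - by move=> i j iA jA ij; move/forall_inP/(_ j jA): (h9 i iA); rewrite ij => /eqP.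
case=> h1 h2 h3 h4 h5 h6 h7 h8 h9; apply/and5P; split=> //.
- by apply/forallP=> x; apply/forallP=> y; apply/implyP=> /h3.
- exact/graph_isoP.
apply/and5P; split.
- exact/forall_inP.
- by apply/forall_inP=> j jA; rewrite h6.
- by apply/forallP=> j; apply/implyP=> jA; rewrite h7.
- by apply/forall_inP=> x xU; apply/exists_inP/h8.
- by apply/forall_inP=> i iA; apply/forall_inP=> j jA; apply/implyP=> /h9 ->.
Qed.

Lemma forest_suppr A U a io G : forest_spec A U a io G ->
  forall x y, adj G x y -> y \in U.
Proof. by move=> F x y; rewrite adjC; apply: forest_supp F _ _. Qed.

(** Used with a subset of the roots of [t]: the union of the trees hanging from that subset. *)
Definition tree_part A U (t : triple) : {set T} :=
  [set x in U | [exists j in A, connect (adj t.2) x (t.1.2 j)]].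

Definition forest_restrict A U (t : triple) : triple :=
  (restrict_perm U t.1.1, [ffun j => if j \in A then t.1.2 j else x0], inside t.2 U).

Definition forest_merge A1 (t1 t2 : triple) : triple :=
  (t1.1.1 * t2.1.1, [ffun j => if j \in A1 then t1.1.2 j else t2.1.2 j],
   graph_union t1.2 t2.2)%g.

Lemma tree_partP A B U a io G : forest_spec A U a io G -> B \subset A ->
    (forall j, (sigma j \in B) = (j \in B)) ->
  [/\ forall x y, adj G x y -> (x \in tree_part B U (a, io, G)) = (y \in tree_part B U (a, io, G))
    & forall x, (a x \in tree_part B U (a, io, G)) = (x \in tree_part B U (a, io, G))].
Proof.
move=> F /subsetP BA sB.
have step x y : adj G x y -> x \in tree_part B U (a, io, G) -> y \in tree_part B U (a, io, G).
  move=> xy; rewrite !inE /= (forest_suppr F xy) => /andP[_ /exists_inP[j jB xj]].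
  by apply/exists_inP; exists j => //; apply: connect_trans xj; apply: connect1; rewrite adjC.
split=> [x y xy|]; first by apply/idP/idP; apply: step; rewrite // adjC.
apply: perm_stable => x; rewrite !inE /= (perm_on_stable x (forest_on F)).
case/andP=> -> /exists_inP[j jB xj]; apply/exists_inP; exists (sigma j); rewrite ?sB //.
by rewrite -(forest_sigma F) ?BA // (connect_iso (forest_iso F)).
Qed.

Lemma forest_restrictP A B U a io G : forest_spec A U a io G -> B \subset A ->
    (forall j, (sigma j \in B) = (j \in B)) ->
  forest B (tree_part B U (a, io, G)) (forest_restrict B (tree_part B U (a, io, G)) (a, io, G)).
Proof.
move=> F BA sB; have [closed_adj stable_a] := tree_partP F BA sB.
set V := tree_part _ _ _ in closed_adj stable_a *; move/subsetP: BA => BA.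
have VU x : x \in V -> x \in U by rewrite inE => /andP[].
have connV x y : x \in V -> connect (adj (inside G V)) x y = connect (adj G) x y.
  move=> xV; apply: (@connect_restrict _ _ _ (mem V)) => // u v uV.
    by rewrite adj_inside uV; apply/andb_idr => uv; rewrite -(closed_adj u v uv).
  by rewrite adj_inside => /and3P[].
have ioV j : j \in B -> io j \in V.
  move=> jB; rewrite inE /= (forest_root F) ?BA //.
  by apply/exists_inP; exists j; rewrite // connect0.
apply/forestP; split=> /=.
- exact: restrict_perm_on.
- apply: outerplanar_sub (forest_outer F).
  by apply/subsetP=> -[x y]; rewrite -![_ \in _]/(adj _ x y) adj_inside => /and3P[].
- by move=> x y; rewrite adj_inside => /and3P[].
- move=> x y; rewrite !adj_inside !restrict_permE //.
  case: ifP => xV; case: ifP => yV; rewrite ?stable_a ?xV ?yV ?andbF //.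
  by rewrite (forest_iso F).
- by move=> j jB; rewrite ffunE jB ioV.
- by move=> j jB; rewrite !ffunE sB jB restrict_permE // ioV // (forest_sigma F) ?BA.
- by move=> j /negPf jB; rewrite ffunE jB.
- move=> x xV; have := xV; rewrite inE /= => /andP[_ /exists_inP[j jB xj]].
  by exists j => //; rewrite ffunE jB connV.
move=> i j iB jB; rewrite !ffunE iB jB connV ?ioV //.
by apply: (forest_unique F); apply: BA.
Qed.

Lemma tree_partC A1 A2 U a io G : forest_spec (A1 :|: A2) U a io G -> [disjoint A1 & A2] ->
  tree_part A2 U (a, io, G) = U :\: tree_part A1 U (a, io, G).
Proof.
move=> F dis; apply/setP=> x; rewrite !inE /=; case xU: (x \in U) => //=.
rewrite andbT; apply/idP/idP.
  case/exists_inP=> j jA xj; apply/negP=> /exists_inP[i iA xi].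
  have ij : i = j.
    apply: (forest_unique F); rewrite ?inE ?iA ?jA ?orbT //.
    by apply: connect_trans xj; rewrite (adj_sym G).
  by rewrite ij (disjointFl dis jA) in iA.
move=> n1; have [j] := forest_cover F xU; rewrite inE => /orP[jA|jA] xj; last first.
  by apply/exists_inP; exists j.
by case/exists_inP: n1; exists j.
Qed.

Lemma forest_merge_restrict A1 A2 U U1 a io G : forest_spec (A1 :|: A2) U a io G ->
    [disjoint A1 & A2] ->
    (forall j, (sigma j \in A1) = (j \in A1)) -> (forall j, (sigma j \in A2) = (j \in A2)) ->
    tree_part A1 U (a, io, G) = U1 ->
  forest_merge A1 (forest_restrict A1 U1 (a, io, G))
    (forest_restrict A2 (U :\: U1) (a, io, G)) = (a, io, G).
Proof.
move=> F dis s1 s2 U1E.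
have [adj1 stab1] := tree_partP F (subsetUl A1 A2) s1.
have [adj2 stab2] := tree_partP F (subsetUr A1 A2) s2.
rewrite (tree_partC F dis) U1E in adj2 stab2; rewrite U1E in adj1 stab1.
have aU x : (a x \in U) = (x \in U) := perm_on_stable x (forest_on F).
have U1U x : x \in U1 -> x \in U by rewrite -U1E inE => /andP[].
rewrite /forest_merge /forest_restrict /=; congr (_, _, _).
- apply/permP=> x; rewrite permM !restrict_permE //; case xU1: (x \in U1).
    by rewrite in_setD stab1 xU1.
  rewrite in_setD xU1 /=; case: ifP => // xU.
  by rewrite (perm_on_out (forest_on F)) ?xU.
- apply/ffunP=> j; rewrite !ffunE; case j1: (j \in A1) => //; case j2: (j \in A2) => //.
  by rewrite (forest_default F) // in_setU j1 j2.
apply: graphP => x y; rewrite adj_union !adj_inside.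
case xy: (adj G x y) => //=; rewrite -(adj1 _ _ xy) -(adj2 _ _ xy) !andbb in_setD.
by rewrite (forest_supp F xy) andbT; case: (x \in U1).
Qed.

(** * Merging forests with disjoint roots and disjoint vertices *)

Section Merge.

Variables (A1 A2 : {set S}) (U1 U2 : {set T}) (a1 a2 : {perm T}) (io1 io2 : {ffun S -> T}).
Variables (G1 G2 : graph T).
Hypotheses (F1 : forest_spec A1 U1 a1 io1 G1) (F2 : forest_spec A2 U2 a2 io2 G2).
Hypotheses (disA : [disjoint A1 & A2]) (disU : [disjoint U1 & U2]).
Hypotheses (s1 : forall j, (sigma j \in A1) = (j \in A1))
  (s2 : forall j, (sigma j \in A2) = (j \in A2)).

Let t := forest_merge A1 (a1, io1, G1) (a2, io2, G2).
Let a := (a1 * a2)%g.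

Lemma merge_perm1 x : x \in U1 -> a x = a1 x.
Proof.
move=> x1; rewrite permM (perm_on_out (forest_on F2)) //.
by rewrite (disjointFr disU) // (perm_on_stable _ (forest_on F1)).
Qed.

Lemma merge_perm2 x : x \in U2 -> a x = a2 x.
Proof.
by move=> x2; rewrite permM (perm_on_out (forest_on F1)) // (disjointFl disU).
Qed.

Lemma merge_stable1 x : (a x \in U1) = (x \in U1).
Proof.
apply: perm_stable => {}x x1.
by rewrite merge_perm1 // (perm_on_stable _ (forest_on F1)).
Qed.

Lemma merge_stable2 x : (a x \in U2) = (x \in U2).
Proof.
apply: perm_stable => {}x x2.
by rewrite merge_perm2 // (perm_on_stable _ (forest_on F2)).
Qed.

Lemma merge_adj1 x y : x \in U1 -> adj t.2 x y = adj G1 x y.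
Proof.
move=> x1; rewrite adj_union orb_idr // => /(forest_supp F2).
by rewrite (disjointFr disU).
Qed.

Lemma merge_adj2 x y : x \in U2 -> adj t.2 x y = adj G2 x y.
Proof.
move=> x2; rewrite adj_union orb_idl // => /(forest_supp F1).
by rewrite (disjointFl disU).
Qed.

Lemma merge_connect1 x y : x \in U1 -> connect (adj t.2) x y = connect (adj G1) x y.
Proof.
move=> x1; apply: (@connect_restrict _ _ _ (mem U1)) => // u v u1; first exact: merge_adj1.
by rewrite merge_adj1 //; apply: (forest_suppr F1).
Qed.

Lemma merge_connect2 x y : x \in U2 -> connect (adj t.2) x y = connect (adj G2) x y.
Proof.
move=> x2; apply: (@connect_restrict _ _ _ (mem U2)) => // u v u2; first exact: merge_adj2.
by rewrite merge_adj2 //; apply: (forest_suppr F2).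
Qed.

Lemma connect_forest A U b io G x y : forest_spec A U b io G ->
  x \in U -> connect (adj G) x y -> y \in U.
Proof.
move=> F xU /(connect_invariant (f := fun z => z \in U)) <- // u v uv.
by rewrite (forest_supp F uv) (forest_suppr F uv).
Qed.

Lemma merge_io1 j : j \in A1 -> t.1.2 j = io1 j.
Proof. by rewrite /t /= ffunE => ->. Qed.

Lemma merge_io2 j : j \in A2 -> t.1.2 j = io2 j.
Proof. by move=> j2; rewrite /t /= ffunE (disjointFl disA). Qed.

Lemma forest_mergeP : forest (A1 :|: A2) (U1 :|: U2) t.
Proof.
apply/forestP; split=> /=.
- apply: perm_on_intro => x; rewrite inE negb_or => /andP[x1 x2].
  by rewrite permM (perm_on_out (forest_on F1)) // (perm_on_out (forest_on F2)).
(* The two graphs share no vertex of positive degree, so [x0] is only a formal place for the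
   gluing. *)
- apply: (outerplanar_glue (v := x0) _ _ (forest_outer F1) (forest_outer F2)).
    by move=> x y; rewrite adj_union.
  move=> x; rewrite !inE => /existsP[y /(forest_supp F1) x1] /existsP[z /(forest_supp F2)].
  by rewrite (disjointFr disU).
- by move=> x y; rewrite adj_union inE => /orP[/(forest_supp F1)|/(forest_supp F2)] ->; rewrite ?orbT.
- move=> x y; rewrite -/a; case x1: (x \in U1).
    rewrite -[LHS]/(adj t.2 _ _) -[RHS]/(adj t.2 _ _) !merge_adj1 ?merge_stable1 //.
    have [y1|y1] := boolP (y \in U1); first by rewrite !merge_perm1 // (forest_iso F1).
    transitivity false; last by apply/esym; apply: contraNF y1 => /(forest_suppr F1).
    by apply: contraNF y1 => /(forest_suppr F1); rewrite merge_stable1.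
  case x2: (x \in U2).
    rewrite -[LHS]/(adj t.2 _ _) -[RHS]/(adj t.2 _ _) !merge_adj2 ?merge_stable2 //.
    have [y2|y2] := boolP (y \in U2); first by rewrite !merge_perm2 // (forest_iso F2).
    transitivity false; last by apply/esym; apply: contraNF y2 => /(forest_suppr F2).
    by apply: contraNF y2 => /(forest_suppr F2); rewrite merge_stable2.
  have nadj u v : u \notin U1 -> u \notin U2 -> adj (graph_union G1 G2) u v = false.
    by move=> u1 u2; apply/negP; rewrite adj_union => /orP[/(forest_supp F1)|/(forest_supp F2)]; apply/negP.
  by rewrite !nadj ?merge_stable1 ?merge_stable2 ?x1 ?x2.
- move=> j; rewrite !inE => /orP[j1|j2]; first by rewrite -/(t.1.2 j) merge_io1 // (forest_root F1).
  by rewrite -/(t.1.2 j) merge_io2 // (forest_root F2) ?orbT.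
- move=> j; rewrite inE -/a => /orP[j1|j2].
    by rewrite (merge_io1 j1) (@merge_io1 (sigma j)) ?s1 // merge_perm1 ?(forest_root F1) // (forest_sigma F1).
  by rewrite (merge_io2 j2) (@merge_io2 (sigma j)) ?s2 // merge_perm2 ?(forest_root F2) // (forest_sigma F2).
- move=> j; rewrite inE negb_or => /andP[/negPf j1 j2]; rewrite ffunE j1.
  exact: (forest_default F2).
- move=> x; rewrite inE => /orP[x1|x2].
    have [j jA xj] := forest_cover F1 x1; exists j; first by rewrite inE jA.
    by rewrite (merge_io1 jA) merge_connect1.
  have [j jA xj] := forest_cover F2 x2; exists j; first by rewrite inE jA orbT.
  by rewrite (merge_io2 jA) merge_connect2.
move=> i j; rewrite !inE => /orP[i1|i2] /orP[j1|j2].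
- rewrite (merge_io1 i1) (merge_io1 j1) merge_connect1 ?(forest_root F1) //.
  exact: (forest_unique F1).
- rewrite (merge_io1 i1) (merge_io2 j2) merge_connect1 ?(forest_root F1) // => ij.
  have := connect_forest F1 (forest_root F1 i1) ij.
  by rewrite (disjointFl disU) // (forest_root F2).
- rewrite (merge_io2 i2) (merge_io1 j1) merge_connect2 ?(forest_root F2) // => ij.
  have := connect_forest F2 (forest_root F2 i2) ij.
  by rewrite (disjointFr disU) // (forest_root F1).
rewrite (merge_io2 i2) (merge_io2 j2) merge_connect2 ?(forest_root F2) //.
exact: (forest_unique F2).
Qed.

Lemma tree_part_merge : tree_part A1 (U1 :|: U2) t = U1.
Proof.
apply/setP=> x; rewrite inE in_setU; have [x1|x1] := boolP (x \in U1).
  rewrite /=; have [j jA xj] := forest_cover F1 x1; apply/exists_inP; exists j => //.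
  by rewrite (merge_io1 jA) merge_connect1.
apply/negP=> /andP[/= x2 /exists_inP[j j1]]; rewrite (merge_io1 j1) merge_connect2 // => xj.
have := connect_forest F2 x2 xj; by rewrite (disjointFr disU) // (forest_root F1).
Qed.

Lemma forest_restrict_merge1 : forest_restrict A1 U1 t = (a1, io1, G1).
Proof.
rewrite /forest_restrict /=; congr (_, _, _).
- apply/permP=> x; rewrite restrict_permE; last exact: merge_stable1.
  by case: ifP => x1; [rewrite merge_perm1 | rewrite (perm_on_out (forest_on F1)) ?x1].
- apply/ffunP=> j; rewrite !ffunE; case j1: (j \in A1) => //.
  by rewrite (forest_default F1) ?j1.
apply: graphP => x y; rewrite adj_inside; apply/and3P/idP=> [[xy x1 _]|xy].
  by rewrite -merge_adj1.
have x1 := forest_supp F1 xy; split=> //; last exact: (forest_suppr F1 xy).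
by rewrite (merge_adj1 _ x1).
Qed.

Lemma forest_restrict_merge2 : forest_restrict A2 U2 t = (a2, io2, G2).
Proof.
rewrite /forest_restrict /=; congr (_, _, _).
- apply/permP=> x; rewrite restrict_permE; last exact: merge_stable2.
  by case: ifP => x2; [rewrite merge_perm2 | rewrite (perm_on_out (forest_on F2)) ?x2].
- apply/ffunP=> j; rewrite !ffunE; case j2: (j \in A2).
    by rewrite (disjointFl disA).
  by rewrite (forest_default F2) ?j2.
apply: graphP => x y; rewrite adj_inside; apply/and3P/idP=> [[xy x2 _]|xy].
  by rewrite -merge_adj2.
have x2 := forest_supp F2 xy; split=> //; last exact: (forest_suppr F2 xy).
by rewrite (merge_adj2 _ x2).
Qed.

Lemma ctype_merge : ctype t.1.1 (U1 :|: U2) = mmul (ctype a1 U1) (ctype a2 U2).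
Proof.
rewrite ctypeU //; last exact: merge_stable1.
congr (mmul _ _); apply: ctype_agree => x xU.
- exact: merge_perm1.
- by rewrite merge_stable1.
- exact: merge_perm2.
by rewrite merge_stable2.
Qed.

End Merge.

Definition forest_sum A U : cpoly :=
  \sum_(t : triple | forest A U t) << ctype t.1.1 U >>.

(** A forest is determined by its trees over [A1] and those over [A2]. As [sigma] preserves both
    root sets, the automorphism preserves the vertex set [U1] of the first part and is the product
    of its restrictions, so the cycle types multiply. *)
Lemma forest_sum_split A1 A2 U :
    [disjoint A1 & A2] ->
    (forall j, (sigma j \in A1) = (j \in A1)) -> (forall j, (sigma j \in A2) = (j \in A2)) ->
  forest_sum (A1 :|: A2) U =
  \sum_(U1 in powerset U) forest_sum A1 U1 * forest_sum A2 (U :\: U1).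
Proof.
move=> disA s1 s2; rewrite /forest_sum.
rewrite [LHS](partition_big (tree_part A1 U) (fun U1 => U1 \in powerset U)); last first.
  by move=> t _; rewrite inE; apply/subsetP=> x; rewrite inE => /andP[].
apply: eq_bigr => U1; rewrite inE => U1U; set U2 := U :\: U1.
have UE : U1 :|: U2 = U by rewrite /U2 setDE setUIr setUCr setIT (setUidPr U1U).
have disU : [disjoint U1 & U2].
  by rewrite -setI_eq0 /U2 setDE setICA setICr setI0.
rewrite mulr_suml; under [RHS]eq_bigr => t _ do rewrite mulr_sumr.
rewrite pair_big_dep /=.
rewrite (reindex_onto (fun p : triple * triple => forest_merge A1 p.1 p.2)
   (fun t => (forest_restrict A1 U1 t, forest_restrict A2 U2 t))) /=; last first.
  move=> [[a io] G] /andP[/forestP F /eqP tU1].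
  exact: forest_merge_restrict F disA s1 s2 tU1.
rewrite (eq_bigl (fun p : triple * triple => forest A1 U1 p.1 && forest A2 U2 p.2)).
  apply: eq_bigr => -[[[a1 io1] G1] [[a2 io2] G2]] /andP[/forestP F1 /forestP F2].
  by rewrite malgUM -(ctype_merge F1 F2 disU) UE.
move=> [t1 t2]; set t := forest_merge A1 t1 t2.
transitivity [&& forest (A1 :|: A2) U t, tree_part A1 U t == U1,
    forest_restrict A1 U1 t == t1 & forest_restrict A2 U2 t == t2].
  by rewrite -andbA.
apply/idP/idP; last first.
  rewrite {}/t; case: t1 t2 => [[a1 io1] G1] [[a2 io2] G2] /andP[/forestP F1 /forestP F2].
  rewrite -UE (forest_mergeP F1 F2) // (tree_part_merge F1 F2) // eqxx.
  by rewrite (forest_restrict_merge1 F1 F2) // (forest_restrict_merge2 F1 F2) // !eqxx.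
case: t => [[a io] G] /and4P[/forestP F /eqP tU1 /eqP E1 /eqP E2].
have := forest_restrictP F (subsetUl A1 A2) s1.
have := forest_restrictP F (subsetUr A1 A2) s2.
by rewrite (tree_partC F disA) tU1 E1 E2 => -> ->.
Qed.

End Forests.

(** * A permutation of several copies with a prescribed return map *)

Section Unroll.

Variables (K : finType) (i : nat).
Hypothesis i_gt0 : (0 < i)%N.
Implicit Types (b : {perm K}) (G : graph K) (p q : 'I_i).

Let p0 : 'I_i := Ordinal i_gt0.

(** A normal form: the trees of a cycle of roots are identified with the first one along the
    automorphism, so every step is trivial except the last, which carries the whole return map
    [b]. *)
Definition unroll_fun b (z : K * 'I_i) : K * 'I_i :=
  (if (z.2.+1 < i)%N then z.1 else b z.1, ordS z.2).

Lemma unroll_inj b : injective (unroll_fun b).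
Proof.
move=> [x p] [y q]; rewrite /unroll_fun /= => /eqP.
rewrite xpair_eqE => /andP[/eqP xy /eqP/ordS_inj pq].
by move: xy; rewrite pq; case: ifP => _; [move=> -> | move/perm_inj => ->].
Qed.

(* The cycles of [b] become [i] times longer: the [i]-th power of [unroll b]
   acts on each copy of [K] as [b]. *)
Definition unroll b : {perm K * 'I_i} := perm (@unroll_inj b).

Lemma unroll_iter b x p : (unroll b ^+ p)%g (x, p0) = (x, p).
Proof.
case: p => q qi /=; elim: q qi => [|q IH] qi.
  by rewrite perm1; congr (_, _); apply: val_inj.
rewrite expgSr permM (IH (ltnW qi)) permE /unroll_fun /= qi.
by congr (_, _); apply: val_inj; rewrite /= modn_small.
Qed.

Lemma unroll_expi b x : (unroll b ^+ i)%g (x, p0) = (b x, p0).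
Proof.
have hi : (i.-1 < i)%N by rewrite prednK.
have -> : (unroll b ^+ i = unroll b ^+ i.-1 * unroll b)%g by rewrite -expgSr prednK.
rewrite permM (unroll_iter b x (Ordinal hi)) permE /unroll_fun /=.
by rewrite prednK // ltnn; congr (_, _); apply: val_inj; rewrite /= prednK // modnn.
Qed.

(** From copy 0 each other copy is reached by a power below [i], and the [i]-th power runs through
    the cycle of [b]. *)
Lemma porbit_unroll b z : porbit (unroll b) z = setX (porbit b z.1) setT.
Proof.
have base x p : (x, p) \in porbit (unroll b) (x, p0).
  by rewrite -(unroll_iter b x p) mem_porbit.
have step x y : y \in porbit b x -> (y, p0) \in porbit (unroll b) (x, p0).
  case/porbitP=> q ->; elim: q => [|q IH]; first by rewrite perm1 porbit_id.
  rewrite expgSr permM -unroll_expi; rewrite -(porbit_eq IH); exact: mem_porbit.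
case: z => x p; apply/setP=> -[y q]; rewrite !inE andbT /=; apply/idP/idP.
  move=> yx; rewrite porbit_connect in yx; rewrite -eq_porbit_mem; apply/eqP/esym.
  apply: (connect_invariant (f := fun z => porbit b z.1)) yx => -[x' p'] z /eqP <-.
  by rewrite permE /unroll_fun /=; case: ifP; rewrite ?porbit_step.
move=> yx; rewrite (porbit_eq (base x p)) -(porbit_eq (step x y yx)).
exact: base.
Qed.

Lemma ctype_unroll b : ctype (unroll b) setT = dtype i b.
Proof.
rewrite /ctype /dtype.
have -> : porbit (unroll b) @: setT =
    (fun c : {set K} => setX c [set: 'I_i]) @: (porbit b @: setT).
  apply/setP=> c; apply/imsetP/imsetP=> [[z _ ->]|[_ /imsetP[x _ ->] ->]].
    by exists (porbit b z.1); rewrite ?imset_f ?porbit_unroll.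
  by exists (x, p0); rewrite ?porbit_unroll.
rewrite big_imset /=; last first.
  move=> c d _ _ /setP cd; apply/setP=> x; have := cd (x, p0).
  by rewrite !inE !andbT.
by apply: eq_bigr => c _; rewrite cardsX cardsT card_ord mulnC.
Qed.

Definition copies G : graph (K * 'I_i)%type :=
  graph_of [rel z w | (z.2 == w.2) && adj G z.1 w.1].

Lemma adj_copies G z w : adj (copies G) z w = (z.2 == w.2) && adj G z.1 w.1.
Proof.
rewrite adj_graph_of // => [u v|u] /=; last by rewrite adj_irr andbF.
by rewrite eq_sym adjC.
Qed.

Lemma connect_copies G z w :
  connect (adj (copies G)) z w = (z.2 == w.2) && connect (adj G) z.1 w.1.
Proof.
apply/idP/andP=> [zw|[/eqP zw]].
  split.
    apply/eqP; apply: (connect_invariant (f := snd)) zw => u v.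
    by rewrite adj_copies => /andP[/eqP].
  apply: (connect_homo (f := fst)) zw => u v.
  by rewrite adj_copies => /andP[_ uv]; apply: connect1.
case: z w zw => x p [y q] /= <-.
apply: (connect_homo (f := fun u => (u, p))) => u v uv.
by apply: connect1; rewrite adj_copies eqxx.
Qed.

(** The copies are disjoint; they are glued to the empty graph [G0], with [(x, p0)] as an arbitrary
    attachment vertex. *)
Lemma outerplanar_copies G (x : K) : outerplanar G -> outerplanar (copies G).
Proof.
move=> outG; have inj p : injective (fun x : K => (x, p)) by move=> u v [].
have F_level p z : z \in non_isolated (push_graph (fun x => (x, p)) G) -> z.2 = p.
  by rewrite inE => /existsP[w /(adj_pushP (inj p))[u [v [<-]]]].
pose G0 : graph (K * 'I_i)%type := graph_of (fun _ _ => false).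
have G0E : adj G0 =2 fun _ _ => false by apply: adj_graph_of.
apply: (outerplanar_glue_family (G0 := G0) (v := fun=> (x, p0))
         (F := fun p => push_graph (fun x => (x, p)) G)).
- move=> [y p] [z q]; rewrite adj_copies G0E /=; apply/andP/existsP => [[/eqP<- yz]|[p']].
    by exists p; apply/adj_pushP=> //; exists y, z.
  by case/(adj_pushP (inj p')) => u [v [[<- <-] [<- <-] uv]].
- by move=> p z; rewrite inE => /existsP[w]; rewrite G0E.
- by move=> p q z /F_level <- /F_level <-.
- by apply: outerplanar_matching => u v w; rewrite G0E.
by move=> p; rewrite outerplanar_push.
Qed.

End Unroll.

(** * Forests whose roots form a single cycle *)

Section SingleOrbit.

Variables (S T : finType) (sigma : {perm S}) (x0 : T) (j0 : S) (k : nat) (v0 : 'I_k).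
Variable U : {set T}.
Let A := porbit sigma j0.
Let i := #|A|.
Hypothesis card_U : #|U| = (i * k)%N.

Lemma orbit_gt0 : (0 < i)%N.
Proof. by rewrite lt0n card_porbit_neq0. Qed.

Let p0 : 'I_i := Ordinal orbit_gt0.

Definition orbit_pos j : 'I_i := odflt p0 [pick p : 'I_i | (sigma ^+ p)%g j0 == j].

Lemma orbit_inj (p q : 'I_i) : (sigma ^+ p)%g j0 = (sigma ^+ q)%g j0 -> p = q.
Proof.
move=> pq; apply/val_inj/eqP.
rewrite -(nth_uniq j0 _ _ (uniq_traject_porbit sigma j0)) ?size_traject ?ltn_ord //.
by rewrite !nth_traject ?ltn_ord //; move: pq; rewrite !permX => ->.
Qed.

Lemma orbit_posK j : j \in A -> (sigma ^+ (orbit_pos j))%g j0 = j.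
Proof.
rewrite /A porbit_traject => /trajectP[p pi jE]; rewrite /orbit_pos.
case: pickP => [q /eqP //|/(_ (Ordinal pi))]; by rewrite permX /= -jE eqxx.
Qed.

Lemma orbit_mem p : (sigma ^+ p)%g j0 \in A.
Proof. exact: mem_porbit. Qed.

Lemma orbit_posE (p : 'I_i) : orbit_pos ((sigma ^+ p)%g j0) = p.
Proof. by apply: orbit_inj; rewrite orbit_posK // orbit_mem. Qed.

Lemma orbit_expi : (sigma ^+ i)%g j0 = j0.
Proof. by rewrite permX iter_porbit. Qed.

Lemma orbit_pos0 : orbit_pos j0 = p0.
Proof. by rewrite -[RHS](orbit_posE p0) /= perm1. Qed.

Lemma orbit_pos_sigma j : j \in A -> orbit_pos (sigma j) = ordS (orbit_pos j).
Proof.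
move=> jA; rewrite -{1}(orbit_posK jA) -permM -expgSr.
apply: orbit_inj; rewrite orbit_posK ?orbit_mem //=.
have [lt|] := ltnP (orbit_pos j).+1 i; first by rewrite modn_small.
move=> le; have -> : (orbit_pos j).+1 = i by apply/eqP; rewrite eqn_leq le ltn_ord.
by rewrite modnn orbit_expi perm1.
Qed.

Lemma orbit_sigma j : (sigma j \in A) = (j \in A).
Proof. by rewrite /A porbit_sym porbit_step porbit_sym. Qed.

Local Notation K := 'I_k.
Local Notation triple := (triple S T).
Local Notation forest := (forest sigma x0 A U).
Local Notation spec := (forest_spec sigma x0 A U).

Definition first_tree (t : triple) : {set T} :=
  [set x in U | connect (adj t.2) x (t.1.2 j0)].

Section Facts.

Variables (a : {perm T}) (io : {ffun S -> T}) (G : graph T).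
Hypothesis F : spec a io G.
Let V := first_tree (a, io, G).

Lemma forest_rootX p : (a ^+ p)%g (io j0) = io ((sigma ^+ p)%g j0).
Proof.
elim: p => [|p IH]; first by rewrite !perm1.
by rewrite !expgSr !permM IH (forest_sigma F) // orbit_mem.
Qed.

Lemma forest_isoX p x y : adj G ((a ^+ p)%g x) ((a ^+ p)%g y) = adj G x y.
Proof.
elim: p => [|p IH]; first by rewrite !perm1.
by rewrite !expgSr !permM (forest_iso F).
Qed.

Lemma forest_connectX p x y :
  connect (adj G) ((a ^+ p)%g x) ((a ^+ p)%g y) = connect (adj G) x y.
Proof. by apply: connect_iso => u v; apply: forest_isoX. Qed.

Lemma forest_onX p x : ((a ^+ p)%g x \in U) = (x \in U).
Proof.
elim: p => [|p IH]; first by rewrite perm1.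
by rewrite expgSr permM (perm_on_stable _ (forest_on F)).
Qed.

Lemma first_treeX p x : x \in V ->
  connect (adj G) ((a ^+ p)%g x) (io ((sigma ^+ p)%g j0)).
Proof. by rewrite inE => /andP[_ xj]; rewrite -forest_rootX forest_connectX. Qed.

Lemma first_tree_level (p q : 'I_i) x y : x \in V -> y \in V ->
  connect (adj G) ((a ^+ p)%g x) ((a ^+ q)%g y) -> p = q.
Proof.
move=> xV yV xy; apply/orbit_inj/(forest_unique F); rewrite ?orbit_mem //.
apply: connect_trans (first_treeX q yV); apply: connect_trans xy.
rewrite (adj_sym G); exact: first_treeX.
Qed.

(** The powers of [a] below [i] carry the first tree to each of the trees exactly once. *)
Lemma card_first_tree_mul : (#|V| * i)%N = #|U|.
Proof.
have cardI : i = #|[set: 'I_i]| by rewrite cardsT card_ord.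
rewrite cardI -cardsX.
pose g (z : T * 'I_i) := (a ^+ z.2)%g z.1.
have <- : g @: setX V setT = U.
  apply/setP=> y; apply/imsetP/idP=> [[[x p]]|yU].
    by rewrite inE => /andP[/= xV _] ->; rewrite forest_onX; move: xV; rewrite inE => /andP[].
  have [j jA yj] := forest_cover F yU.
  set x := ((a ^+ orbit_pos j)^-1)%g y.
  have yE : y = (a ^+ orbit_pos j)%g x by rewrite permKV.
  exists (x, orbit_pos j) => //; rewrite !inE andbT /= -(forest_onX (orbit_pos j)) -yE yU /=.
  by rewrite -(forest_connectX (orbit_pos j)) -yE forest_rootX orbit_posK.
rewrite card_in_imset // => -[x p] [y q]; rewrite !inE /= !andbT => xV yV gxy.
have pq : p = q.
  by apply: (@first_tree_level p q x y); rewrite ?inE //; rewrite [X in connect _ _ X](esym gxy : g (y,q) = _) connect0.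
by move: gxy; rewrite /g /= pq => /perm_inj ->.
Qed.

Lemma card_first_tree : #|V| = k.
Proof.
by apply/eqP; rewrite -(eqn_pmul2r orbit_gt0) card_first_tree_mul card_U mulnC.
Qed.

End Facts.

(** A labelling [f] of the first tree, transported to the other trees by the powers of the
    automorphism; it labels all of [U]. *)
Definition levels (t : triple) (f : {ffun K -> T}) : {ffun K * 'I_i -> T} :=
  [ffun z => (t.1.1 ^+ (z.2 : 'I_i))%g (f z.1)].

Definition unrolled := ({ffun K * 'I_i -> T} * ({perm K} * rooted_graph K))%type.

Definition good (tf : triple * {ffun K -> T}) : bool :=
  [&& forest tf.1, tf.2 \in ffun_on (mem (first_tree tf.1)) & injectiveb tf.2].

Definition unrolled_good (u : unrolled) : bool :=
  [&& u.1 \in ffun_on (mem U), injectiveb u.1, u.2.2 \in classChat k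
    & rooted_iso u.2.1 u.2.2 u.2.2].

(** What a forest with labelled first tree amounts to: a labelling of [U], the first tree as a
    rooted graph on the labels, and the return map, which is its automorphism. The default [v0] is
    not taken on good data. *)
Definition fold (tf : triple * {ffun K -> T}) : unrolled :=
  (levels tf.1 tf.2,
   (pull_perm tf.2 (tf.1.1.1 ^+ i),
    (pull_graph tf.2 tf.1.2, odflt v0 [pick v | tf.2 v == tf.1.1.2 j0])))%g.

Definition unfold (u : unrolled) : triple * {ffun K -> T} :=
  let: (E, (b, (G, v))) := u in
  ((push_perm E (unroll i b),
    [ffun j => if j \in A then E (v, orbit_pos j) else x0],
    push_graph E (copies i G)),
   [ffun x => E (x, p0)]).

Section Fold.

Variables (a : {perm T}) (io : {ffun S -> T}) (G : graph T) (f : {ffun K -> T}).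
Hypotheses (F : spec a io G) (fV : forall x, f x \in first_tree (a, io, G)).
Hypothesis f_inj : injective f.
Let t : triple := (a, io, G).
Let V := first_tree t.
Let E := levels t f.
Let b := pull_perm f (a ^+ i)%g.
Let H := pull_graph f G.
Let v := odflt v0 [pick v | f v == io j0].

Lemma codom_first_tree y : (y \in codom f) = (y \in V).
Proof.
have sub : codom f \subset V by apply/subsetP=> _ /codomP[x ->]; apply: fV.
have /subset_cardP/(_ sub) : #|codom f| = #|V|.
  by rewrite card_codom // (card_first_tree F) card_ord.
by move->.
Qed.

Lemma levelsE x p : E (x, p) = (a ^+ p)%g (f x).
Proof. by rewrite ffunE. Qed.

Lemma levels0 x : E (x, p0) = f x.
Proof. by rewrite levelsE perm1. Qed.

Lemma levels_on z : E z \in U.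
Proof.
case: z => x p; rewrite levelsE (forest_onX F).
by have := fV x; rewrite inE => /andP[].
Qed.

Lemma levels_inj : injective E.
Proof.
move=> [x p] [y q]; rewrite !levelsE => xy.
have pq : p = q by apply: (first_tree_level F (fV x) (fV y)); rewrite xy connect0.
by move: xy; rewrite pq => /perm_inj/f_inj ->.
Qed.

Lemma codom_levels y : (y \in codom E) = (y \in U).
Proof.
have sub : codom E \subset U by apply/subsetP=> _ /codomP[z ->]; apply: levels_on.
have /subset_cardP/(_ sub) : #|codom E| = #|U|.
  by rewrite card_codom ?card_prod ?card_ord ?card_U 1?mulnC //; apply: levels_inj.
by move->.
Qed.

Lemma foldb x : f (b x) = (a ^+ i)%g (f x).
Proof.
apply: pull_permE => // y; rewrite codom_first_tree inE (forest_onX F).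
have := fV y; rewrite inE => /andP[-> yj] /=.
by rewrite -[X in connect _ _ (_ X)]orbit_expi -(forest_rootX F) (forest_connectX F).
Qed.

Lemma foldv : f v = io j0.
Proof.
rewrite /v; case: pickP => [w /eqP //|none] /=.
have : io j0 \in codom f.
  by rewrite codom_first_tree inE (forest_root F) ?connect0 // porbit_id.
by case/codomP=> w jw; have := none w; rewrite jw eqxx.
Qed.

Lemma fold_perm : push_perm E (unroll i b) = a.
Proof.
apply/permP=> y; have [/codomP[[x p] ->]|yE] := boolP (y \in codom E); last first.
  rewrite (push_perm_out levels_inj) // (perm_on_out (forest_on F)) //.
  by rewrite -codom_levels.
rewrite (push_permE levels_inj) permE /unroll_fun /= !levelsE /=.
(* Below the last level [a] leads one level up by construction of [levels]; from the last level it
   leads back to the first tree through the return map. *)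
have [lt|ge] := ltnP p.+1 i; first by rewrite modn_small // expgSr permM.
have pi : p.+1 = i by apply/eqP; rewrite eqn_leq ge ltn_ord.
by rewrite pi modnn perm1 foldb -permM -expgSr pi.
Qed.

Lemma fold_roots : [ffun j => if j \in A then E (v, orbit_pos j) else x0] = io.
Proof.
apply/ffunP=> j; rewrite ffunE; case: ifP => [jA|/negbT jA].
  by rewrite levelsE foldv (forest_rootX F) orbit_posK.
by rewrite (forest_default F).
Qed.

Lemma fold_graph : push_graph E (copies i H) = G.
Proof.
apply: graphP => y1 y2; apply/(adj_pushP levels_inj)/idP.
  case=> -[x p] [[y q] [<- <-]]; rewrite adj_copies /= => /andP[/eqP <-].
  by rewrite adj_pull !levelsE (forest_isoX F).
move=> y12; have := forest_supp F y12; have := forest_suppr F y12.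
rewrite -!codom_levels => /codomP[[y q] yE] /codomP[[x p] xE].
exists (x, p), (y, q); split=> //; rewrite adj_copies /= adj_pull.
have pq : p = q.
  apply: (first_tree_level F (fV x) (fV y)); apply: connect1.
  by rewrite -!levelsE -xE -yE.
rewrite pq eqxx /=; move: y12; rewrite xE yE !levelsE pq (forest_isoX F) //.
Qed.

Lemma fold_class : (H, v) \in classChat k.
Proof.
rewrite !inE /=; apply/andP; split.
  apply/andP; split; first by apply/card_gt0P; exists v0.
  apply/forallP=> x; apply/forallP=> y.
  rewrite -(connect_push f_inj (R' := adj G)).
  - have := fV x; have := fV y; rewrite !inE => /andP[_ yj] /andP[_ xj].
    by apply: connect_trans xj _; rewrite (adj_sym G).
  - by move=> c d; rewrite adj_pull.
  move=> c y' cy; rewrite codom_first_tree inE (forest_suppr F cy) /=.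
  have := fV c; rewrite inE => /andP[_]; apply: connect_trans.
  by rewrite (adj_sym G) connect1.
rewrite -(outerplanar_push f_inj); apply: outerplanar_sub (forest_outer F).
apply/subsetP=> -[x y]; case/(adj_pushP f_inj)=> c [d [<- <-]].
by rewrite adj_pull.
Qed.

Lemma fold_iso : rooted_iso b (H, v) (H, v).
Proof.
apply/andP; split=> /=.
  by apply/graph_isoP=> x y; rewrite !adj_pull !foldb (forest_isoX F).
by apply/eqP/f_inj; rewrite foldb foldv (forest_rootX F) orbit_expi.
Qed.

End Fold.

Section Unfold.

Variables (E : {ffun K * 'I_i -> T}) (b : {perm K}) (G : graph K) (v : K).
Hypotheses (EU : forall z, E z \in U) (E_inj : injective E).
Hypotheses (connG : forall x y, connect (adj G) x y) (outG : outerplanar G).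
Hypotheses (bG : forall x y, adj G (b x) (b y) = adj G x y) (bv : b v = v).
Let a := push_perm E (unroll i b).
Let io : {ffun S -> T} := [ffun j => if j \in A then E (v, orbit_pos j) else x0].
Let H := push_graph E (copies i G).
Let f : {ffun K -> T} := [ffun x => E (x, p0)].

Lemma codom_unfold y : (y \in codom E) = (y \in U).
Proof.
have sub : codom E \subset U by apply/subsetP=> _ /codomP[z ->]; apply: EU.
have /subset_cardP/(_ sub) : #|codom E| = #|U|.
  by rewrite card_codom ?card_prod ?card_ord ?card_U 1?mulnC.
by move->.
Qed.

Lemma unfoldX p z : (a ^+ p)%g (E z) = E ((unroll i b ^+ p)%g z).
Proof.
elim: p => [|p IH]; first by rewrite !perm1.
by rewrite !expgSr !permM IH push_permE.
Qed.

Lemma connect_unfold z w :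
  connect (adj H) (E z) (E w) = (z.2 == w.2).
Proof.
rewrite (connect_push E_inj (R := adj (copies i G))).
- by rewrite connect_copies connG andbT.
- by move=> c d; rewrite adj_push.
by move=> c y /(adj_push_codom E_inj) /andP[].
Qed.

Lemma unfold_root j : j \in A -> io j = E (v, orbit_pos j).
Proof. by move=> jA; rewrite ffunE jA. Qed.

Lemma unfold_forest : spec a io H.
Proof.
split.
- apply: perm_on_intro => x xU; apply: (push_perm_out E_inj).
  by rewrite codom_unfold.
- by rewrite outerplanar_push //; apply: (outerplanar_copies orbit_gt0 v outG).
- by move=> x y /(adj_push_codom E_inj) /andP[]; rewrite codom_unfold.
- move=> x y; have nadj u w : u \notin codom E -> adj H u w = false.
    by move=> uE; apply: contraNF uE => /(adj_push_codom E_inj)/andP[].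
  have [/codomP[[x1 p] ->]|xE] := boolP (x \in codom E); last first.
    by rewrite /a (push_perm_out E_inj _ xE) !nadj.
  have [/codomP[[y1 q] ->]|yE] := boolP (y \in codom E); last first.
    by rewrite /a (push_perm_out E_inj _ yE) adjC nadj // adjC nadj.
  rewrite !(push_permE E_inj) !adj_push // !adj_copies !permE /unroll_fun /=.
  rewrite (inj_eq (@ordS_inj i)); case: eqP => //= ->.
  by case: ifP.
- by move=> j jA; rewrite unfold_root.
- move=> j jA; rewrite !unfold_root ?orbit_sigma // push_permE //.
  by rewrite orbit_pos_sigma // permE /unroll_fun /= bv if_same.
- by move=> j /negPf jA; rewrite ffunE jA.
- move=> x; rewrite -codom_unfold => /codomP[[y p] ->].
  exists ((sigma ^+ p)%g j0); first exact: orbit_mem.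
  by rewrite unfold_root ?orbit_mem // connect_unfold /= orbit_posE.
move=> j j' jA j'A; rewrite !unfold_root // connect_unfold /= => /eqP jj'.
by rewrite -(orbit_posK jA) jj' orbit_posK.
Qed.

Lemma unfold_first x : f x \in first_tree (a, io, H).
Proof.
rewrite inE ffunE EU /= unfold_root; last by rewrite porbit_id.
by rewrite connect_unfold /= orbit_pos0.
Qed.

Lemma unfold_inj : injective f.
Proof. by move=> x y; rewrite !ffunE => /E_inj[]. Qed.

Lemma unfold_levels : levels (a, io, H) f = E.
Proof. by apply/ffunP=> -[x p]; rewrite !ffunE unfoldX (unroll_iter orbit_gt0). Qed.

Lemma unfold_perm : pull_perm f (a ^+ i)%g = b.
Proof.
have aif x : (a ^+ i)%g (f x) = f (b x) by rewrite !ffunE unfoldX (unroll_expi orbit_gt0).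
apply/permP=> x; apply: unfold_inj; rewrite pull_permE //; first exact: unfold_inj.
by move=> y; rewrite aif codom_f.
Qed.

Lemma unfold_graph : pull_graph f H = G.
Proof. by apply: graphP => x y; rewrite adj_pull !ffunE adj_push // adj_copies eqxx. Qed.

Lemma unfold_v : odflt v0 [pick w | f w == io j0] = v.
Proof.
have fv : f v = io j0.
  by rewrite ffunE unfold_root ?orbit_pos0 // porbit_id.
case: pickP => [w|/(_ v)]; rewrite -fv; last by rewrite eqxx.
by move/eqP/unfold_inj.
Qed.

End Unfold.

Lemma goodP (tf : triple * {ffun K -> T}) : reflect
  [/\ forest tf.1, forall x, tf.2 x \in first_tree tf.1 & injective tf.2] (good tf).
Proof.
apply: (iffP and3P) => -[h1 h2 h3]; split=> //.
- exact/ffun_onP.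
- exact/injectiveP.
- exact/ffun_onP.
exact/injectiveP.
Qed.

Lemma unrolled_goodP (E : {ffun K * 'I_i -> T}) (b : {perm K}) (G : graph K) (v : K) : reflect
  ([/\ forall z, E z \in U, injective E & forall x y, connect (adj G) x y] /\
   [/\ outerplanar G, forall x y, adj G (b x) (b y) = adj G x y & b v = v])
  (unrolled_good (E, (b, (G, v)))).
Proof.
apply: (iffP and4P) => [[/ffun_onP h1 /injectiveP h2]|[[h1 h2 h3] [h4 h5 h6]]].
  rewrite !inE /= => /andP[/andP[_ /forallP h3] h4] /andP[/graph_isoP h5 /eqP h6].
  by split; split=> // x y; apply/forallP.
split; [exact/ffun_onP | exact/injectiveP | | ].
  rewrite !inE /= h4 andbT; apply/andP; split; first by apply/card_gt0P; exists v.
  by apply/forallP=> x; apply/forallP=> y.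
by apply/andP; split; [exact/graph_isoP | apply/eqP].
Qed.

Lemma fold_good tf : good tf -> unrolled_good (fold tf) /\ unfold (fold tf) = tf.
Proof.
case: tf => -[[a io] G] f /goodP[/forestP F fV f_inj] /=; split.
  apply/and4P; split=> /=.
  - by apply/ffun_onP=> z; apply: levels_on F fV z.
  - by apply/injectiveP; apply: levels_inj F fV f_inj.
  - exact: fold_class F fV f_inj.
  exact: fold_iso F fV f_inj.
rewrite /fold /=; congr (_, _, _, _).
- exact: fold_perm F fV f_inj.
- exact: fold_roots F fV f_inj.
- exact: fold_graph F fV f_inj.
by apply/ffunP=> x; rewrite ffunE; apply: (levels0 a io G f).
Qed.

Lemma unfold_good u : unrolled_good u -> good (unfold u) /\ fold (unfold u) = u.
Proof.
case: u => E [b [G v]] /unrolled_goodP[[h1 h2 h3] [h4 h5 h6]]; split.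
  apply/goodP; split=> /=.
  - by apply/forestP; apply: unfold_forest.
  - by move=> x; apply: unfold_first.
  exact: unfold_inj.
rewrite /fold /=; congr (_, (_, (_, _))).
- exact: unfold_levels.
- exact: unfold_perm.
- exact: unfold_graph.
exact: unfold_v.
Qed.

Lemma unfold_ctype u : unrolled_good u -> ctype (unfold u).1.1.1 U = dtype i u.2.1.
Proof.
case: u => E [b [G v]] /unrolled_goodP[[h1 h2 _] _] /=.
rewrite -(ctype_unroll orbit_gt0) -(ctype_push setT h2 (push_permE h2 (unroll i b))).
congr (ctype _ _); apply/setP=> y; rewrite -(codom_unfold h1 h2).
by apply/codomP/imsetP=> [[z ->]|[z _ ->]]; exists z.
Qed.

(** Double counting through [fold] and [unfold]. A forest has k! labellings of its first tree; on
    the other side, the labelling of [U] is one of [#|U|] factorial bijections, chosen independently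
    of the rooted graph and of its automorphism [b]. *)
Lemma sum_forest_orbit (R : nmodType) (w : monomial -> R) :
  (\sum_(t | forest t) w (ctype t.1.1 U)) *+ (k`!)%N =
  (\sum_(b : {perm K}) w (dtype i b) *+ #|[set p in classChat k | rooted_iso b p p]|)
    *+ (#|U| `!)%N.
Proof.
transitivity (\sum_(tf | good tf) w (ctype tf.1.1.1 U)).
  rewrite -sumrMnl.
  transitivity (\sum_(t | forest t) \sum_(f : {ffun K -> T} |
      (f \in ffun_on (mem (first_tree t))) && injectiveb f) w (ctype t.1.1 U)).
    apply: eq_bigr => -[[a io] G] /forestP F; rewrite sumr_const; congr (_ *+ _).
    rewrite -(ffactnn k) -{1}(card_first_tree F) -[X in (_ ^_ X)%N]card_ord.
    by rewrite -card_inj_ffuns_on; apply: eq_card => f; rewrite !inE.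
  by rewrite pair_big_dep; apply: eq_bigl => -[t f].
rewrite (reindex_onto unfold fold) /=; last by move=> tf /fold_good[].
rewrite (eq_bigl unrolled_good); last first.
  move=> u; apply/andP/idP=> [[/fold_good[ug _] /eqP fu]|/unfold_good[-> ->]].
    by rewrite -fu.
  by rewrite eqxx.
rewrite (eq_bigr (fun u : unrolled => w (dtype i u.2.1))); last by move=> u ug; rewrite unfold_ctype.
transitivity (\sum_(E : {ffun K * 'I_i -> T} | (E \in ffun_on (mem U)) && injectiveb E)
   \sum_(b : {perm K}) w (dtype i b) *+ #|[set p in classChat k | rooted_iso b p p]|).
  transitivity (\sum_(E : {ffun K * 'I_i -> T} | (E \in ffun_on (mem U)) && injectiveb E)
     \sum_(q : {perm K} * rooted_graph K | (q.2 \in classChat k) && rooted_iso q.1 q.2 q.2)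
       w (dtype i q.1)).
    by rewrite pair_big_dep; apply: eq_bigl => -[E q] /=; rewrite /unrolled_good -!andbA.
  apply: eq_bigr => E _.
  transitivity (\sum_(b : {perm K}) \sum_(p | (p \in classChat k) && rooted_iso b p p) w (dtype i b)).
    by rewrite pair_big_dep; apply: eq_bigl.
  apply: eq_bigr => b _; rewrite sumr_const; congr (_ *+ _).
  by apply: eq_card => p; rewrite [RHS]in_set.
rewrite sumr_const; congr (_ *+ _).
(* By [card_U] source and target have equal size, so the injections are counted by the full
   factorial. *)
rewrite -(ffactnn #|U|) {2}card_U mulnC -[in (k * i)%N](card_ord k) -[in RHS](card_ord i) -card_prod.
by rewrite -card_inj_ffuns_on; apply: eq_card => f; rewrite !inE.
Qed.

End SingleOrbit.

Lemma scale_cancel (V : lmodType rat) (a b : rat) (x y : V) :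
  a != 0 -> a *: x = b *: y -> x = b *: (a^-1 *: y).
Proof. by move=> a0 E; rewrite scalerA mulrC -scalerA -E scalerA mulVf ?scale1r. Qed.

(** There are C(n, l) subsets of size l, and C(n, l) l! (n - l)! = n!. This is how exponential
    generating functions turn splittings of [U] into ordinary products. *)
Lemma sum_powerset_card (V : lmodType rat) (T : finType) (U : {set T}) (F : nat -> V) :
  \sum_(U1 in powerset U) (#|U1| `! * (#|U| - #|U1|)`!)%N%:R *: F #|U1| =
  (#|U| `!)%:R *: \sum_(l < #|U|.+1) F l.
Proof.
have bound (U1 : {set T}) : U1 \in powerset U -> (#|U1| < #|U|.+1)%N.
  by rewrite inE ltnS; apply: subset_leq_card.
rewrite (partition_big (fun U1 : {set T} => inord #|U1| : 'I_#|U|.+1) predT) //=.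
rewrite scaler_sumr; apply: eq_bigr => l _.
rewrite (eq_bigr (fun=> (l`! * (#|U| - l)`!)%N%:R *: F l)); last first.
  by move=> U1 /andP[U1U /eqP <-]; rewrite inordK ?bound.
rewrite sumr_const -scaler_nat scalerA -natrM; congr (_%:R *: _).
have -> : #|[pred U1 | (U1 \in powerset U) && (inord #|U1| == l)]| = 'C(#|U|, l).
  rewrite -cards_draws; apply: eq_card => U1; rewrite !inE.
  apply: andb_id2l => U1U; rewrite -val_eqE /= inordK // bound // inE //.
by rewrite bin_fact // -ltnS.
Qed.

(** * The generating polynomial of forests *)

Section ForestSeries.

Variables (S T : finType) (sigma : {perm S}) (x0 : T) (N : nat).

Definition fixed_classChat k (b : {perm 'I_k}) : rat :=
  #|[set p in classChat k | @rooted_iso 'I_k b p p]|%:R.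

Let X i : cpoly := truncate N (dilate i (perm_series fixed_classChat)).

(** This is [sum_forest_orbit] divided by k!, where k is the size of each tree. *)
Lemma forest_sum_orbit j0 (U : {set T}) : (#|U| <= N)%N ->
  forest_sum sigma x0 (porbit sigma j0) U =
  (#|U| `!)%:R *: hom #|U| (X #|porbit sigma j0|).
Proof.
move=> UN; set i := #|porbit sigma j0|.
have i_gt0 : (0 < i)%N by rewrite lt0n card_porbit_neq0.
rewrite /X hom_dilate_perm_series //.
(* The [i] trees of a cycle have equal size, and the dilated series only has weights divisible by
   [i]: otherwise both sides are zero. *)
have [/dvdnP[k Uk]|ndiv] := boolP (i %| #|U|)%N; last first.
  rewrite /forest_sum !big1 ?scaler0 // => [k /eqP ik|[[a io] G] /forestP F].
    by case/negP: ndiv; rewrite -ik dvdn_mulr.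
  by case/negP: ndiv; rewrite -(card_first_tree_mul F) dvdn_mull.
have kU : (k < #|U|.+1)%N by rewrite ltnS Uk leq_pmulr.
rewrite (big_pred1 (Ordinal kU)) => [/=|l]; last first.
  by rewrite [X in _ == X]Uk mulnC eqn_pmul2r // -val_eqE.
(* For size zero both sides vanish, as neither a tree nor a rooted graph is empty; for positive
   size, [ord0] supplies the default root. *)
case: k Uk kU => [|k] Uk kU.
  rewrite /forest_sum !big1 ?scaler0 // => [b _|[[a io] G] /forestP F].
    rewrite /fixed_classChat (_ : #|_| = 0%N) ?scale0r //; apply: eq_card0 => -[G v].
    by case: v.
  have := forest_root F (porbit_id sigma j0); rewrite (_ : U = set0) ?inE //.
  by apply/eqP; rewrite -cards_eq0 Uk.
have k0 : (k.+1`!)%:R != 0 :> rat by rewrite Num.Theory.pnatr_eq0 -lt0n fact_gt0.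
have UE : #|U| = (i * k.+1)%N by rewrite mulnC.
have E := sum_forest_orbit x0 ord0 UE (R := {malg rat[monomial]}) (fun u => << u >>).
have {}E : (k.+1`!)%:R *: forest_sum sigma x0 (porbit sigma j0) U =
    (#|U| `!)%:R *: \sum_(b : {perm 'I_k.+1}) fixed_classChat b *: << dtype i b >>.
  rewrite [LHS]scaler_nat [RHS]scaler_nat; apply: etrans E _; congr (_ *+ _).
  by apply: eq_bigr => b _; rewrite [RHS]scaler_nat.
exact: scale_cancel k0 E.
Qed.

Lemma forest_sum0 (U : {set T}) :
  forest_sum sigma x0 set0 U = (#|U| `!)%:R *: hom #|U| 1.
Proof.
rewrite hom1; have [->|/set0Pn[x xU]] := eqVneq U set0; last first.
  rewrite /forest_sum big1 => [|[[a io] G] /forestP F]; last first.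
    by have [j] := forest_cover F xU; rewrite inE.
  rewrite (_ : (_ == _) = false) ?scaler0 //.
  by apply/negbTE; rewrite -lt0n card_gt0; apply/set0Pn; exists x.
rewrite cards0 eqxx scale1r /forest_sum.
pose t0 : triple S T := (1%g, [ffun=> x0], graph_of (fun _ _ => false)).
have emptyE : adj (graph_of (fun _ _ : T => false)) =2 (fun _ _ => false).
  exact: adj_graph_of.
rewrite (big_pred1 t0) => [|[[a io] G]]; first by rewrite /ctype imset0 big_set0.
apply/forestP/eqP=> [F|[-> -> ->]].
  congr (_, _, _).
  - by apply/permP=> x; rewrite perm1 (perm_on_out (forest_on F)) ?inE.
  - by apply/ffunP=> j; rewrite ffunE (forest_default F) ?inE.
  apply: graphP => x y; rewrite emptyE; apply/negP=> /(forest_supp F).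
  by rewrite inE.
split=> //.
- exact: perm_on1.
- by apply: outerplanar_matching => x y z; rewrite emptyE.
- by move=> x y; rewrite emptyE.
- by move=> x y; rewrite !emptyE.
- by move=> j; rewrite inE.
- by move=> j; rewrite inE.
- by move=> j _; rewrite ffunE.
- by move=> x; rewrite inE.
by move=> i j; rewrite inE.
Qed.

(** Induction that removes one cycle of [sigma] at a time: splitting the forest is a convolution
    over subsets of [U], which [sum_powerset_card] turns into the convolution over weights of
    [homM]. *)
Lemma forest_sum_hom (A : {set S}) (U : {set T}) :
    (forall j, (sigma j \in A) = (j \in A)) -> (#|U| <= N)%N ->
  forest_sum sigma x0 A U =
  (#|U| `!)%:R *: hom #|U| (\prod_(z in porbit sigma @: A) X #|z|).
Proof.
have [n] := ubnP #|A|; elim: n A U => // n IH A U le_n sA UN.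
have [->|/set0Pn[j0 j0A]] := eqVneq A set0.
  by rewrite imset0 big_set0 forest_sum0.
pose A1 := porbit sigma j0; pose A2 := A :\: A1.
have s1 j : (sigma j \in A1) = (j \in A1) by rewrite /A1 porbit_sym porbit_step porbit_sym.
have s2 j : (sigma j \in A2) = (j \in A2) by rewrite !inE s1 sA.
have inA j j' : j' \in porbit sigma j -> (j' \in A) = (j \in A).
  rewrite porbit_connect => jj'; apply/esym.
  by apply: (connect_invariant (f := fun c => c \in A)) jj' => c d /eqP <-.
have A1A : A1 \subset A by apply/subsetP=> j /inA ->.
have AE : A1 :|: A2 = A by rewrite /A2 setDE setUIr setUCr setIT (setUidPr A1A).
have dis : [disjoint A1 & A2] by rewrite -setI_eq0 /A2 setDE setICA setICr setI0.
have ltA2 : (#|A2| < n)%N.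
  rewrite -ltnS; apply: leq_trans le_n; rewrite ltnS; apply: proper_card.
  by apply/properP; split; [apply: subsetDl | exists j0; rewrite // !inE porbit_id].
have -> : \prod_(z in porbit sigma @: A) X #|z| =
    X #|A1| * \prod_(z in porbit sigma @: A2) X #|z|.
  have -> : porbit sigma @: A = A1 |: porbit sigma @: A2.
    rewrite -{1}AE imsetU; congr (_ :|: _); apply/setP=> c; rewrite inE.
    apply/imsetP/eqP=> [[j jA1 ->]|->]; first exact: porbit_eq.
    by exists j0; rewrite ?porbit_id.
  rewrite big_setU1 //; apply/imsetP=> -[j jA2] A1E.
  by move: jA2; rewrite inE /A1 -/A1 A1E porbit_id.
set P := \prod_(z in _) _.
rewrite -{1}AE (forest_sum_split x0 U dis s1 s2) homM.
apply: etrans (sum_powerset_card U (fun j => hom j (X #|A1|) * hom (#|U| - j)%N P)).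
apply: eq_bigr => U1; rewrite inE => U1U.
have cardD : #|U :\: U1| = (#|U| - #|U1|)%N by rewrite cardsD (setIidPr U1U).
rewrite forest_sum_orbit; last by apply: leq_trans UN; apply: subset_leq_card.
rewrite IH //; last by rewrite cardD; apply: leq_trans UN; apply: leq_subr.
by rewrite -scalerAl -scalerAr scalerA cardD natrM.
Qed.

End ForestSeries.

(** * Decomposition along a block *)

Section Classes.

Variable T : finType.
Implicit Types (G : graph T) (s : {perm T}).

(** The single edge is the two-vertex case of nonseparability, so that the blocks of outerplanar
    graphs are exactly copies of members of [classD]. *)
Lemma nonseparable_class G :
  dissection G || single_edge G = nonseparable G setT && outerplanar G.
Proof.
have insideT : adj (inside G setT) =2 adj G.
  by move=> x y; rewrite adj_inside !inE !andbT.
have deleteT v : [rel a b | [&& adj (inside G setT) a b, a != v & b != v]] =2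
    [rel a b | [&& adj G a b, a != v & b != v]].
  by move=> x y /=; rewrite insideT.
have pairT (x y z : T) : #|T| = 2 -> x != y -> x != z -> y = z.
  move=> T2 xy xz; apply/eqP; apply: contraT => yz.
  have := max_card (mem (x |: [set y; z])).
  by rewrite T2 cardsU1 cards2 !inE negb_or xy xz yz.
apply/orP/andP=> [[/and3P[T2 /and3P[_ /andP[_ /forallP conn] /forallP cut] out]|]|].
- split=> //; apply/nonseparableP; split=> [|x y _ _|v x y _ _ xv yv].
  + by rewrite cardsT ltnW.
  + by rewrite (eq_connect insideT) (forallP (conn x)).
  rewrite (eq_connect (deleteT v)).
  by move/forallP/(_ x)/forallP/(_ y): (cut v); rewrite xv yv.
- case/andP=> /eqP T2 /forallP adjE.
  have {}adjE x y : adj G x y = (x != y) by apply/eqP/(forallP (adjE x)).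
  split; last first.
    by apply: outerplanar_matching => x y z; rewrite !adjE => xy /(pairT _ _ _ T2 xy).
  apply/nonseparableP; split=> [|x y _ _|v x y _ _ xv yv].
  + by rewrite cardsT T2.
  + rewrite (eq_connect insideT); have [->|xy] := eqVneq x y; first exact: connect0.
    by apply: connect1; rewrite adjE.
  by rewrite (pairT v x y) ?connect0 // eq_sym.
case=> /nonseparableP[]; rewrite cardsT => T1 conn cut out.
have {}conn x y : connect (adj G) x y by rewrite -(eq_connect insideT) conn.
have [T2|T2] := ltnP 2 #|T|; [left | right].
  apply/and3P; split=> //; apply/and3P; split=> //.
    rewrite /connected (ltnW T1); apply/forallP=> x; exact/forallP.
  apply/forallP=> v; apply/forallP=> x; apply/forallP=> y; apply/implyP=> xv; apply/implyP=> yv.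
  by rewrite -(eq_connect (deleteT v)) cut.
have {T1}T2 : #|T| = 2 by apply/eqP; rewrite eqn_leq T2.
rewrite /single_edge T2 eqxx; apply/forallP=> x; apply/forallP=> y; apply/eqP.
have [->|xy] := eqVneq x y; first by rewrite adj_irr.
case/connectP: (conn x y) => -[_ yx|z p /= /andP[xz _] _]; first by rewrite yx eqxx in xy.
rewrite (pairT x y z) //; apply: contraTneq xz => ->; by rewrite adj_irr.
Qed.

Lemma nonseparable_pull (S : finType) (f : S -> T) G : injective f ->
  nonseparable (pull_graph f G) setT = nonseparable G (f @: setT).
Proof.
move=> f_inj; have fT x : f x \in f @: setT by rewrite imset_f.
have E a b : adj (inside G (f @: setT)) (f a) (f b) = adj (inside (pull_graph f G) setT) a b.
  by rewrite !adj_inside !fT !inE !andbT adj_pull.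
have C a y : adj (inside G (f @: setT)) (f a) y -> y \in codom f.
  by rewrite adj_inside => /and3P[_ _ /imsetP[b _ ->]]; apply: codom_f.
have connE := connect_push f_inj E C.
have deleteE v a b : connect [rel x y | [&& adj (inside G (f @: setT)) x y, x != f v & y != f v]]
      (f a) (f b) =
    connect [rel x y | [&& adj (inside (pull_graph f G) setT) x y, x != v & y != v]] a b.
  apply: connect_push => //= [c d|c y /and3P[/C]] //.
  by rewrite E !(inj_eq f_inj).
apply/nonseparableP/nonseparableP=> -[card conn cut]; split.
- by rewrite card_imset.
- by move=> _ _ /imsetP[x _ ->] /imsetP[y _ ->]; rewrite connE conn ?inE.
- move=> v _ _ /imsetP[x _ ->] /imsetP[y _ ->] xv yv.
  have [/codomP[w vE]|vf] := boolP (v \in codom f).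
    by rewrite vE !(inj_eq f_inj) in xv yv *; rewrite deleteE cut ?inE.
  have := conn x y; rewrite -connE !inE => /(_ isT isT).
  rewrite (@connect_restrict _ _
    [rel x y | [&& adj (inside G (f @: setT)) x y, x != v & y != v]] (mem (codom f)))
    ?codom_f //; last first.
    by move=> _ b /codomP[c ->] /C.
  move=> a b /codomP[c ->] /=; apply/esym/andb_idr => /C bf.
  by apply/andP; split; apply: contraNneq vf => <-; rewrite // codom_f.
- by rewrite -(card_imset _ f_inj).
- by move=> x y _ _; rewrite -connE conn.
by move=> v x y _ _ xv yv; rewrite -deleteE cut // (inj_eq f_inj).
Qed.

Lemma imset_perm_setT s : s @: [set: T] = setT.
Proof. by apply/eqP; rewrite eqEcard subsetT card_imset ?leqnn //; apply: perm_inj. Qed.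

Lemma push_class s G : dissection (push_graph s G) || single_edge (push_graph s G) =
  dissection G || single_edge G.
Proof.
have s_inj := @perm_inj _ s.
rewrite [LHS]nonseparable_class [RHS]nonseparable_class (outerplanar_push s_inj).
by have := nonseparable_pull (push_graph s G) s_inj; rewrite (pull_pushG s_inj) imset_perm_setT => ->.
Qed.

Lemma push_connected s G : connected (push_graph s G) = connected G.
Proof.
have s_inj := @perm_inj _ s; rewrite /connected; congr (_ && _).
have connE := connect_push s_inj (adj_push s_inj G)
  (fun a y h => proj2 (andP (adj_push_codom s_inj h))).
apply/forallP/forallP=> conn x; apply/forallP=> y.
  by rewrite -connE (forallP (conn (s x))).
rewrite -(permKV s x) -(permKV s y) connE; exact/forallP.
Qed.

Lemma push_graph1 G : push_graph (1 : {perm T})%g G = G.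
Proof.
by apply: graphP => x y; rewrite -{1}[x]perm1 -{1}[y]perm1 adj_push //; apply: perm_inj.
Qed.

Lemma push_graphM s (t : {perm T}) G :
  push_graph (s * t)%g G = push_graph t (push_graph s G).
Proof.
apply: graphP => x y; rewrite -(permKV (s * t) x) -(permKV (s * t) y) adj_push; last exact: perm_inj.
by rewrite !permM !adj_push //; apply: perm_inj.
Qed.

Lemma graph_iso_push s G H : graph_iso s G H = (push_graph s G == H).
Proof.
have s_inj := @perm_inj _ s; apply/graph_isoP/eqP=> [E|<- x y]; last exact: adj_push.
by apply: graphP => x y; rewrite -(permKV s x) -(permKV s y) adj_push.
Qed.

End Classes.

(** * Graphs with a labelled fixed block, and their pieces *)

Section Composition.

Variables (S T : finType) (x0 : T).

Definition composed := ({perm S} * graph S * triple S T)%type.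

Definition marked := ({perm T} * {ffun S -> T} * graph T)%type.

Definition composed_good (q : composed) : bool :=
  let: (sigma, D, t) := q in
  [&& nonseparable D setT, outerplanar D, graph_iso sigma D D & forest sigma x0 setT setT t].

(** [io] labels the vertices of the fixed block by [S]; its image recovers the block. *)
Definition marked_good (p : marked) : bool :=
  let: (a, io, G) := p in
  [&& injectiveb io, [forall x, forall y, connect (adj G) x y], outerplanar G,
      graph_iso a G G, block G (io @: setT) & a @: (io @: setT) == io @: setT].

Definition join (q : composed) : marked :=
  let: (sigma, D, (a, io, G)) := q in (a, io, graph_union (push_graph io D) G).

(** The block, read through its labels, with the permutation induced on it, and the forest left when
    the edges of the block are removed. The roots of that forest are the labels [io] themselves. *)
Definition cut (p : marked) : composed :=
  let: (a, io, G) := p in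
  (pull_perm io a, pull_graph io G, (a, io, outside G (io @: setT))).

Lemma marked_goodP (a : {perm T}) (io : {ffun S -> T}) (G : graph T) : reflect
  [/\ injective io, forall x y, connect (adj G) x y, outerplanar G,
      forall x y, adj G (a x) (a y) = adj G x y
    & block G (io @: setT) /\ a @: (io @: setT) = io @: setT]
  (marked_good (a, io, G)).
Proof.
apply: (iffP and5P) => [[/injectiveP h1 /forallP h2 h3 /graph_isoP h4 /andP[h5 /eqP h6]]|].
  by split=> // x; apply/forallP.
case=> h1 h2 h3 h4 [h5 h6]; split=> //.
- exact/injectiveP.
- by apply/forallP=> x; apply/forallP.
- exact/graph_isoP.
by rewrite h5 h6 eqxx.
Qed.

Section Cut.

Variables (a : {perm T}) (io : {ffun S -> T}) (G : graph T).
Hypothesis good : marked_good (a, io, G).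
Lemma marked_perm j : io (pull_perm io a j) = a (io j).
Proof.
have [io_inj _ _ _ [_ aB]] := marked_goodP _ _ _ good.
apply: pull_permE => // i.
have : a (io i) \in a @: (io @: setT) by rewrite mem_imset_perm imset_f.
by rewrite aB => /imsetP[j' _ ->]; apply: codom_f.
Qed.

Lemma cut_good : composed_good (cut (a, io, G)).
Proof.
have [io_inj conn out aG [blockB aB]] := marked_goodP _ _ _ good.
have [nonsepB sepB] := andP blockB.
have ioB j : io j \in io @: setT by rewrite imset_f.
have aBE x : (a x \in io @: setT) = (x \in io @: setT) by rewrite -{1}aB mem_imset_perm.
apply/and4P; split.
- by rewrite nonseparable_pull.
- rewrite -(outerplanar_push io_inj); apply: outerplanar_sub out.
  apply/subsetP=> -[x y]; rewrite -![_ \in _]/(adj _ x y).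
  by case/(adj_pushP io_inj)=> i [j [<- <-]]; rewrite adj_pull.
- by apply/graph_isoP=> i j; rewrite !adj_pull !marked_perm aG.
apply/forestP; split=> //.
- by apply: perm_on_intro => x; rewrite inE.
- apply: outerplanar_sub out; apply/subsetP=> -[x y]; rewrite -![_ \in _]/(adj _ x y).
  by rewrite adj_outside => /andP[].
- by move=> x y; rewrite !adj_outside aG !aBE.
- by move=> j _; rewrite marked_perm.
- by move=> j; rewrite inE.
- move=> x _; have [/imsetP[j _ jE] xj] := projP conn (nonseparable_neq0 nonsepB) x.
  by exists j; rewrite // -jE.
move=> i j _ _ /(separatedP _ _ sepB) ij; apply: io_inj; exact: ij.
Qed.

Lemma cutK : join (cut (a, io, G)) = (a, io, G).
Proof.
have [io_inj _ _ _ _] := marked_goodP _ _ _ good.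
congr (_, _, _); apply: graphP => x y; rewrite adj_union adj_outside.
apply/orP/idP=> [[/(adj_pushP io_inj)[i [j [<- <-]]]|/andP[]] //|xy].
  by rewrite adj_pull.
rewrite xy /=; case: (boolP (_ && _)) => [/andP[/imsetP[i _ xE] /imsetP[j _ yE]]|]; last by right.
by left; rewrite xE yE adj_push // adj_pull -xE -yE.
Qed.

End Cut.

Section Join.

Variables (sigma : {perm S}) (D : graph S) (a : {perm T}) (io : {ffun S -> T}) (F : graph T).
Hypothesis good : composed_good (sigma, D, (a, io, F)).
Let P := push_graph io D.
Let G := graph_union P F.

Lemma composed_goodP :
  [/\ nonseparable D setT, outerplanar D, forall i j, adj D (sigma i) (sigma j) = adj D i j
    & forest_spec sigma x0 setT setT a io F].
Proof. by case/and4P: good => h1 h2 /graph_isoP h3 /forestP h4. Qed.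

Lemma composed_roots i j : connect (adj F) (io i) (io j) -> i = j.
Proof. by have [_ _ _ f] := composed_goodP; apply: (forest_unique f); rewrite inE. Qed.

Lemma composed_inj : injective io.
Proof. by move=> i j ij; apply: composed_roots; rewrite ij connect0. Qed.

Lemma composed_perm j : a (io j) = io (sigma j).
Proof. by have [_ _ _ f] := composed_goodP; rewrite (forest_sigma f) ?inE. Qed.

Lemma composed_edge i j : adj F (io i) (io j) = false.
Proof.
apply/negP=> ij; have E := composed_roots (connect1 ij).
by rewrite E adj_irr in ij.
Qed.

Lemma join_pull : pull_graph io G = D.
Proof.
apply: graphP => i j; rewrite adj_pull adj_union composed_edge orbF.
exact: adj_push composed_inj _ _ _.
Qed.

Lemma join_outside : outside G (io @: setT) = F.
Proof.
apply: graphP => x y; rewrite adj_outside adj_union.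
apply/andP/idP=> [[/orP[/(adj_pushP composed_inj)[i [j [<- <- _]]]|] //]|xy].
  by rewrite !imset_f.
rewrite xy orbT; split=> //; apply/andP=> -[/imsetP[i _ xE] /imsetP[j _ yE]].
by rewrite xE yE composed_edge in xy.
Qed.

Lemma join_stable x : (a x \in codom io) = (x \in codom io).
Proof.
have stable : forall x, (a x \in [set y in codom io]) = (x \in [set y in codom io]).
  apply: perm_stable => y; rewrite !inE => /codomP[j ->].
  by rewrite composed_perm codom_f.
by have := stable x; rewrite !inE.
Qed.

(** The trees are glued onto the block one by one, each meeting it only in its root. *)
Lemma join_outerplanar : outerplanar G.
Proof.
have [_ outD _ f] := composed_goodP.
pose tree j := [set x | connect (adj F) x (io j)].
have isolated (H : graph T) x : x \in non_isolated H -> exists y, adj H x y.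
  by rewrite inE => /existsP.
have rootP j x : x \in non_isolated (inside F (tree j)) -> connect (adj F) x (io j).
  by case/isolated=> y; rewrite adj_inside !inE => /and3P[].
apply: (@outerplanar_glue_family _ _ G P (fun j => inside F (tree j)) io).
- move=> x y; rewrite adj_union; congr (_ || _); apply/idP/existsP=> [xy|[j]].
    have [j _ xj] := forest_cover f (in_setT x).
    exists j; rewrite adj_inside xy !inE xj /=; apply: connect_trans xj.
    by apply: connect1; rewrite adjC.
  by rewrite adj_inside => /and3P[].
- move=> j x /isolated[y /(adj_pushP composed_inj)[i [_ [<- _ _]]]] /rootP ij.
  by rewrite (composed_roots ij).
- move=> i j x /rootP xi /rootP xj; apply: composed_roots.
  by apply: connect_trans xj; rewrite (adj_sym F).
- by rewrite /P outerplanar_push //; apply: composed_inj.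
move=> j; apply: outerplanar_sub (forest_outer f).
by apply/subsetP=> -[x y]; rewrite -![_ \in _]/(adj _ x y) adj_inside => /and3P[].
Qed.

Lemma join_good : marked_good (join (sigma, D, (a, io, F))).
Proof.
have [nonsepD outD sD f] := composed_goodP; have io_inj := composed_inj.
have subF : forall x y, connect (adj F) x y -> connect (adj G) x y.
  apply: connect_sub => x y xy; apply: connect1; by rewrite adj_union xy orbT.
have aB : a @: (io @: setT) = io @: setT.
  apply/eqP; rewrite eqEcard (card_imset _ (@perm_inj _ a)) leqnn andbT.
  apply/subsetP=> _ /imsetP[_ /imsetP[j _ ->] ->]; by rewrite composed_perm imset_f.
apply/marked_goodP; split=> //.
- move=> x y; have [i _ xi] := forest_cover f (in_setT x).
  have [j _ yj] := forest_cover f (in_setT y).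
  apply: connect_trans (subF _ _ xi) _; rewrite (adj_sym G) in yj *.
  apply: connect_trans (subF _ _ yj) _.
  have [_ conn _] := nonseparableP _ _ nonsepD.
  apply: (connect_homo (R := adj (inside D setT))); last exact: conn.
  move=> k l; rewrite adj_inside => /and3P[kl _ _]; apply: connect1.
  by rewrite adj_union adj_push // kl.
- exact: join_outerplanar.
- move=> x y; rewrite !adj_union (forest_iso f); congr (_ || _).
  have [xio|xio] := boolP (x \in codom io); last first.
    by apply/idP/idP=> /(adj_push_codom io_inj); rewrite ?join_stable (negPf xio).
  have [yio|yio] := boolP (y \in codom io); last first.
    by apply/idP/idP=> /(adj_push_codom io_inj); rewrite ?join_stable (negPf yio) andbF.
  case/codomP: xio => i ->; case/codomP: yio => j ->.
  by rewrite !composed_perm !adj_push.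
split; last exact: aB.
apply/andP; split; first by rewrite -(nonseparable_pull _ io_inj) join_pull.
apply/separatedP=> _ _ /imsetP[i _ ->] /imsetP[j _ ->].
by rewrite join_outside => /composed_roots ->.
Qed.

Lemma joinK : cut (join (sigma, D, (a, io, F))) = (sigma, D, (a, io, F)).
Proof.
rewrite /= join_pull join_outside; congr (_, _, _); apply/permP=> j; apply: composed_inj.
rewrite pull_permE ?composed_perm // => [|i]; first exact: composed_inj.
by rewrite composed_perm codom_f.
Qed.

End Join.

Lemma sum_composed (R : nmodType) (w : {perm S} -> {perm T} -> R) :
  \sum_(q | composed_good q) w q.1.1 q.2.1.1 =
  \sum_(p | marked_good p) w (pull_perm p.1.2 p.1.1) p.1.1.
Proof.
rewrite (reindex_onto cut join); last first.
  by move=> [[s D] [[a io] F]] good; apply: joinK.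
apply: eq_big => [[[a io] G]|[[a io] G] _] //.
apply/andP/idP=> [[good /eqP E]|good]; last by rewrite cut_good // cutK.
rewrite -E; move: good; case: (cut _) => -[s D] [[a' io'] F] good.
exact: join_good good.
Qed.

(** A fixed block with as many vertices as [S] has [#|S|] factorial labellings, and a labelling
    matches the fixed points of the induced permutation with the vertices of the block fixed by
    [a]. *)
Lemma sum_marked (R : nmodType) (w : nat -> {perm T} -> R) :
  \sum_(p | marked_good p) w #|[set j | pull_perm p.1.2 p.1.1 j == j]| p.1.1 =
  (\sum_(a : {perm T})
    \sum_(G | [forall x, forall y, connect (adj G) x y] && outerplanar G && graph_iso a G G)
    \sum_(B : {set T} | (block G B && (a @: B == B)) && (#|B| == #|S|))
      w #|[set x in B | a x == x]| a) *+ (#|S| `!)%N.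
Proof.
pose conn (G : graph T) := [forall x, forall y, connect (adj G) x y].
transitivity (\sum_(a : {perm T})
    \sum_(G | conn G && outerplanar G && graph_iso a G G)
    \sum_(io : {ffun S -> T} | injectiveb io && (block G (io @: setT) && (a @: (io @: setT) == io @: setT)))
      w #|[set x in io @: setT | a x == x]| a).
  rewrite pair_big_dep /= pair_big_dep /=.
  rewrite (reindex (fun p : {perm T} * graph T * {ffun S -> T} => (p.1.1, p.2, p.1.2) : marked)) /=; last first.
    by exists (fun p : marked => (p.1.1, p.2, p.1.2)) => [[[? ?] ?]|[[? ?] ?]].
  apply: eq_big => [[[a G] io]|[[a G] io] /= good] /=.
    by rewrite /conn; do !bool_congr.
  congr (w _ _); have [io_inj _ _ _ _] := marked_goodP _ _ _ good.
  rewrite -(card_imset _ io_inj); apply: eq_card => x; rewrite !inE.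
  apply/imsetP/andP=> [[j]|[/imsetP[j _ ->]]].
    rewrite inE => /eqP E ->; rewrite imset_f //; split=> //.
    by rewrite -(marked_perm good) E.
  by rewrite -(marked_perm good) => /eqP/io_inj E; exists j; rewrite ?inE ?E.
rewrite -sumrMnl; apply: eq_bigr => a _; rewrite -sumrMnl; apply: eq_bigr => G _.
rewrite (partition_big (fun io : {ffun S -> T} => io @: setT)
  (fun B => (block G B && (a @: B == B)) && (#|B| == #|S|))) /=; last first.
  by move=> io /andP[/injectiveP io_inj ->]; rewrite card_imset // cardsT eqxx.
rewrite -sumrMnl; apply: eq_bigr => B /andP[blockB /eqP cardB].
rewrite (eq_bigr (fun=> w #|[set x in B | a x == x]| a)); last first.
  by move=> io /andP[_ /eqP->].
rewrite sumr_const; congr (_ *+ _).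
rewrite -(ffactnn #|S|) -{1}cardB -card_inj_ffuns_on; apply: eq_card => io; rewrite !inE.
apply/andP/andP=> [[/andP[io_inj _] /eqP E]|[/ffun_onP on io_inj]].
  by split=> //; apply/ffun_onP=> j; rewrite -E imset_f.
have E : io @: setT = B.
  apply/eqP; rewrite eqEcard cardB card_imset ?cardsT ?leqnn ?andbT; last exact/injectiveP.
  by apply/subsetP=> _ /imsetP[j _ ->].
by rewrite E io_inj blockB.
Qed.

End Composition.

Lemma eq_truncate N F F' : F =1 F' -> truncate N F = truncate N F'.
Proof. by move=> FF'; apply: eq_bigr => u _; rewrite FF'. Qed.

Lemma eq_subst F F' t t' : F =1 F' -> (forall i, t i =1 t' i) ->
  subst F t =1 subst F' t'.
Proof.
move=> FF' tt' m; rewrite /subst [LHS]mcoeff_sum [RHS]mcoeff_sum.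
apply: eq_bigr => u _.
have E : \prod_(i < weight m) truncate (weight m) (t i.+1) ^+ u (val i) =
    \prod_(i < weight m) truncate (weight m) (t' i.+1) ^+ u (val i).
  by apply: eq_bigr => i _; rewrite (eq_truncate _ (tt' _)).
apply: etrans (cmcoeffZ _ _ _) _.
apply: etrans _ (esym (cmcoeffZ _ _ _)).
exact: (congr2 *%R (FF' u) (congr1 _ E)).
Qed.

Definition fixed_graphs (K : forall n, {set graph 'I_n}) k (s : {perm 'I_k}) : nat :=
  #|[set G in K k | graph_iso s G G]|.

(** * The cycle index sums of the classes as permutation series *)

Section CycleIndices.

Variable K : forall n, {set graph 'I_n}.
Hypothesis K_push : forall n (G : graph 'I_n) (s : {perm 'I_n}),
  (push_graph s G \in K n) = (G \in K n).

Lemma Z_graphs : Z K =1 perm_series (fun k s => (fixed_graphs K s)%:R).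
Proof.
move=> u; rewrite /Z /cycle_index_sum.
apply: (@sum_representatives _ _ (fun n => @graph_iso 'I_n)
  (fun G s => push_graph s G)) => [G|G s t|s G H|G s].
- exact: push_graph1.
- exact: push_graphM.
- exact: graph_iso_push.
exact: K_push.
Qed.

(** An automorphism fixes a rooted graph when it fixes the graph and the root, so rooting multiplies
    the count by the number of fixed points. On cycle indices this is the operator s_1 d/ds_1. *)
Lemma card_fixed_rooted k (s : {perm 'I_k}) :
  #|[set p : rooted_graph 'I_k in [set p : rooted_graph 'I_k | p.1 \in K k] | rooted_iso s p p]| =
  (#|[set x | s x == x]| * fixed_graphs K s)%N.
Proof.
rewrite mulnC /fixed_graphs -cardsX; apply: eq_card => -[G x].
by rewrite !inE /rooted_iso /= andbA.
Qed.

Lemma Z_rooted : Zrooted (fun n => [set p : rooted_graph 'I_n | p.1 \in K n]) =1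
  perm_series (fun k s => (#|[set x | s x == x]| * fixed_graphs K s)%:R).
Proof.
move=> u; rewrite /Zrooted /cycle_index_sum.
apply: etrans.
  apply: (@sum_representatives _ _ (fun n => @rooted_iso 'I_n)
    (fun p s => (push_graph s p.1, s p.2))) => [[G x]|[G x] s t|s [G x] [H y]|[G x] s] /=.
  - by rewrite push_graph1 perm1.
  - by rewrite push_graphM permM.
  - by rewrite /rooted_iso graph_iso_push.
  by rewrite !inE K_push.
rewrite /perm_series; congr (_ * _); apply: eq_bigr => s _.
by rewrite card_fixed_rooted.
Qed.

End CycleIndices.

Lemma classC_push n (G : graph 'I_n) (s : {perm 'I_n}) :
  (push_graph s G \in classC n) = (G \in classC n).
Proof.
rewrite [LHS]in_set [RHS]in_set push_connected outerplanar_push //; exact: perm_inj.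
Qed.

Lemma classD_push n (G : graph 'I_n) (s : {perm 'I_n}) :
  (push_graph s G \in classD n) = (G \in classD n).
Proof. by rewrite [LHS]in_set [RHS]in_set; apply: push_class. Qed.

(** * Substitution as a sum over fixed blocks *)

Section BlockSums.

Variables (g : nat -> nat) (m : monomial).
Let n := weight m.
Let X i := truncate n (dilate i (perm_series fixed_classChat)).

(** The case of [forest_sum_hom] where all labels are roots and the forest spans all [n] vertices;
    the factor n! is moved to the other side. *)
Lemma prod_coefficient (x0 : 'I_n) k (s : {perm 'I_k}) :
  (\prod_(z in porbit s @: setT) X #|z|)@_m =
  (n`!%:R)^-1 * \sum_(t | forest s x0 setT setT t) (ctype t.1.1 setT == m)%:R.
Proof.
have leT : (#|[set: 'I_n]| <= n)%N by rewrite cardsT card_ord.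
have stable j : (s j \in [set: 'I_k]) = (j \in [set: 'I_k]) by rewrite !inE.
have := congr1 (mcoeff m) (forest_sum_hom x0 stable leT).
rewrite /forest_sum [X in X = _ -> _]mcoeff_sum [X in _ = X -> _]cmcoeffZ homE cardsT card_ord eqxx.
rewrite (eq_bigr (fun t : triple _ _ => (ctype t.1.1 setT == m)%:R)) => [->|t _]; last exact: mcoeffU1.
by rewrite mulrA mulVf ?mul1r // Num.Theory.pnatr_eq0 -lt0n fact_gt0.
Qed.

(** The weight [g] of the number of fixed points treats both substitutions at once: the constant 1
    counts fixed blocks and stands for [classD], the identity counts fixed vertices in fixed blocks
    and stands for [classV]. *)
Lemma subst_blocks :
  subst (perm_series (fun k s => (g #|[set x | s x == x]| * fixed_graphs classD s)%:R))
    (fun i => dilate i (perm_series fixed_classChat)) m =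
  (n`!%:R)^-1 * \sum_(a : {perm 'I_n} | ctype a setT == m)
    \sum_(G in classC n | graph_iso a G G)
      \sum_(B : {set 'I_n} | block G B && (a @: B == B)) (g #|[set x in B | a x == x]|)%:R.
Proof.
rewrite subst_perm_series -/n.
(* A vertex is needed as default root. Without vertices both sides are zero, because a block and a
   member of [classD] have at least two. *)
case: (pickP (fun _ : 'I_n => true)) => [x0 _|no]; last first.
  have n0 : n = 0%N by case: (n) no => // n' /(_ ord0).
  rewrite big1 => [|k _]; last first.
    rewrite big1 ?mulr0 // => s _.
    rewrite (_ : fixed_graphs classD s = 0%N) ?muln0 ?mul0r //.
    apply: eq_card0 => D; rewrite inE [_ \in classD _]in_set nonseparable_class.
    case: nonseparableP => //; rewrite cardsT card_ord => -[].
    by move=> k1; move: (leq_trans k1 (ltn_ord k : (k <= n)%N)); rewrite [X in (_ < X)%N]n0.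
  rewrite big1 ?mulr0 // => a _; rewrite big1 // => G _; rewrite big1 // => B.
  case/andP=> /andP[/nonseparableP[B1 _ _] _] _.
  by move: (leq_trans B1 (max_card _)); rewrite [X in (_ < X)%N]card_ord [X in (_ < X)%N]n0.
pose w l (a : {perm 'I_n}) : rat := (g l)%:R * (ctype a setT == m)%:R.
transitivity ((n`!%:R)^-1 * \sum_(k < n.+1) \sum_(a : {perm 'I_n})
    \sum_(G : graph 'I_n | [forall x, forall y, connect (adj G) x y] && outerplanar G && graph_iso a G G)
    \sum_(B : {set 'I_n} | (block G B && (a @: B == B)) && (#|B| == #|'I_k|))
      w #|[set x in B | a x == x]| a).
  rewrite mulr_sumr; apply: eq_bigr => k _; rewrite mulrC.
  have k0 : (k`!%:R : rat) != 0 by rewrite Num.Theory.pnatr_eq0 -lt0n fact_gt0.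
  apply: (mulIf k0); rewrite -mulrA mulVf // mulr1 -[RHS]mulrA [X in _ * X]mulr_natr.
  (* The k! labellings of a block with k vertices cancel the 1 / k! of the series. *)
  have := sum_marked ('I_k) w (T := 'I_n); rewrite [in (#|'I_k|)`!]card_ord.
  move=> <-; rewrite -(sum_composed x0 (fun s a => w #|[set j | s j == j]| a)) mulr_sumr.
  transitivity (\sum_(s : {perm 'I_k})
      \sum_(D | [&& nonseparable D setT, outerplanar D & graph_iso s D D])
      \sum_(t | forest s x0 setT setT t) (n`!%:R)^-1 * w #|[set x | s x == x]| t.1.1).
    apply: eq_bigr => s _; rewrite (prod_coefficient x0) sumr_const -[RHS]mulr_natl.
    have -> : fixed_graphs classD s =
        #|[pred D | [&& nonseparable D setT, outerplanar D & graph_iso s D D]]|.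
      apply: eq_card => D; rewrite [LHS]inE [D \in classD _]in_set nonseparable_class.
      by rewrite -andbA.
    rewrite natrM [_%:R * _%:R]mulrC -mulrA; congr (_ * _).
    rewrite mulrCA -mulr_sumr; congr (_ * _); rewrite mulr_sumr.
    by apply: eq_bigr => t _; rewrite /w.
  rewrite pair_big_dep /= pair_big_dep /=; apply: eq_bigl => -[[s D] t] /=.
  by rewrite -!andbA.
rewrite exchange_big /= [X in _ = _ * X]big_mkcond; congr (_ * _); apply: eq_bigr => a _.
rewrite exchange_big /=.
transitivity (\sum_(G in classC n | graph_iso a G G)
    \sum_(B : {set 'I_n} | block G B && (a @: B == B)) w #|[set x in B | a x == x]| a).
  apply: eq_big => [G|G _].
    by rewrite in_set /connected card_ord (leq_ltn_trans (leq0n x0) (ltn_ord x0)).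
  (* The index k of the series is the size of the block. *)
  rewrite [RHS](partition_big (fun B : {set 'I_n} => inord #|B| : 'I_n.+1) predT) //=.
  apply: eq_bigr => k _; apply: eq_bigl => B; congr (_ && _).
  rewrite card_ord -val_eqE /= inordK // ltnS -[X in (_ <= X)%N]card_ord; exact: max_card.
case: ifP => am; last first.
  by rewrite big1 // => G _; rewrite big1 // => B _; rewrite /w am mulr0.
by apply: eq_bigr => G _; apply: eq_bigr => B _; rewrite /w am mulr1.
Qed.

End BlockSums.

Theorem theorem10 (m : monomial) :
  Z classC m =
    Zrooted classChat m
    + subst (Z classD) (fun i => dilate i (Zrooted classChat)) m
    - subst (Zrooted classV) (fun i => dilate i (Zrooted classChat)) m.
Proof.
have ZhatE : Zrooted classChat =1 perm_series fixed_classChat.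
  move=> u; rewrite (Z_rooted classC_push) /perm_series; congr (_ * _).
  by apply: eq_bigr => s _; rewrite -card_fixed_rooted.
have dilateE i : dilate i (Zrooted classChat) =1 dilate i (perm_series fixed_classChat).
  exact: eq_subst.
have ZDE : Z classD =1
    perm_series (fun k s => ((fun=> 1) #|[set x | s x == x]| * fixed_graphs classD s)%N%:R).
  by move=> u; rewrite (Z_graphs classD_push) /perm_series; under eq_bigr => s _ do rewrite -[X in X%:R]mul1n.
rewrite (eq_subst ZDE dilateE) (eq_subst (Z_rooted classD_push) dilateE).
rewrite (subst_blocks (fun=> 1%N)) (subst_blocks id) Z_graphs; last exact: classC_push.
rewrite Z_rooted; last exact: classC_push.
rewrite /perm_series -mulrDr -mulrBr; congr (_ * _).
rewrite -big_split /= -sumrB; apply: eq_bigr => a _.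
(* Every term is now a sum over the same pairs [(a, G)], so the identity can be checked pair by
   pair: a [1] for each pair on the left, fixed vertices plus fixed blocks minus incidences on the
   right. *)
pose P G := (G \in classC (weight m)) && graph_iso a G G.
have -> : fixed_graphs classC a = #|[pred G | P G]| by apply: eq_card => G; rewrite inE.
rewrite natrM mulr_natr -!sumr_const -big_split -sumrB; apply: eq_bigr => G /andP[].
(* Connected graphs are nonempty by definition, which provides the base vertex [r] of
   [dissymmetry]. *)
rewrite in_set => /andP[/andP[/card_gt0P[r _] conn] _] aG.
have {}conn x y : connect (adj G) x y by rewrite (forallP (forallP conn x)).
apply/eqP; rewrite eq_sym subr_eq; apply/eqP.
rewrite /= !sumr_const -natr_sum -natrD -(natrD _ 1) -(dissymmetry r conn aG).
by congr ((_ + _)%:R); apply: eq_card => B; rewrite !inE.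
Qed.
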